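(* Assume $0<\Delta_n\le 1$, $\Delta_n\to0$ and $n\Delta_n\to\infty$ as $n\to\infty$. Let $\theta\in\mathbb R$, $\sigma>0$, $\lambda>0$ and $z=(u,v,w)\in\mathbb R^3$, and set $\theta_n=\theta+\frac{u}{\sqrt{n\Delta_n}}$, $\sigma_n=\sigma+\frac{v}{\sqrt n}$, $\lambda_n=\lambda+\frac{w}{\sqrt{n\Delta_n}}$. Then, as $n\to\infty$, $$\log\frac{p(X^n;(\theta_n,\sigma_n,\lambda_n))}{p(X^n;(\theta,\sigma,\lambda))}\ \xrightarrow{\ \mathcal L(\mathbb P_x^{\theta,\sigma,\lambda})\ }\ z^{\mathsf T}\mathcal N(0,\Gamma(\theta,\sigma,\lambda))-\tfrac12 z^{\mathsf T}\Gamma(\theta,\sigma,\lambda)z,$$ where $\mathcal N(0,\Gamma)$ is a centered Gaussian vector in $\mathbb R^3$ with covariance matrix $$\Gamma(\theta,\sigma,\lambda)=\frac1{\sigma^2}\begin{pmatrix}1&0&-1\\0&2&0\\-1&0&1+\frac{\sigma^2}{\lambda}\end{pmatrix}.$$ That is, the LAN property holds at every $(\theta,\sigma,\lambda)$ with rates $(\sqrt{n\Delta_n},\sqrt n,\sqrt{n\Delta_n})$ and Fisher information $\Gamma(\theta,\sigma,\lambda)$.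
   Context: Let $B$ be a standard Brownian motion and $N$ an independent Poisson process with intensity $\lambda>0$. For $x\in\mathbb R$, $\theta\in\mathbb R$, $\sigma>0$, $\lambda>0$ the process is $X_t=x+\theta t+\sigma B_t+N_t-\lambda t$, $t\ge0$, and $\mathbb P_x^{\theta,\sigma,\lambda}$ denotes its law (the convergence in the claim is convergence in law under this measure). Observation times are $t_k=k\Delta_n$, $k=0,\dots,n$, and $X^n=(X_{t_0},\dots,X_{t_n})$. The transition density is $p^{\theta,\sigma,\lambda}(\Delta,x,y)=\sum_{m\ge0}e^{-\lambda\Delta}\frac{(\lambda\Delta)^m}{m!}(2\pi\sigma^2\Delta)^{-1/2}\exp\!\big(-\frac{(y-x-(\theta-\lambda)\Delta-m)^2}{2\sigma^2\Delta}\big)$ (the density of $x+\theta\Delta+\sigma B_\Delta+N_\Delta-\lambda\Delta$), and the likelihood of the observations is $p(X^n;(\theta,\sigma,\lambda))=\prod_{k=0}^{n-1}p^{\theta,\sigma,\lambda}(\Delta_n,X_{t_k},X_{t_{k+1}})$. *)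

(* Defs.v *)
From HB Require Import structures.
From mathcomp Require Import all_boot all_order all_algebra.
From mathcomp Require Import all_classical all_reals all_analysis.
Set Implicit Arguments. Unset Strict Implicit. Unset Printing Implicit Defensive.
Import Order.TTheory GRing.Theory Num.Theory.
Import numFieldNormedType.Exports.
Local Open Scope classical_set_scope.
Local Open Scope ring_scope.

Definition mutually_independent {d} {T : measurableType d} {R : realType}
  (P : probability T R) (I : finType) (Y : I -> T -> R) : Prop :=
  forall A : I -> set R, (forall i, measurable (A i)) ->
    P (\bigcap_(i in [set: I]) (Y i @^-1` A i)) = (\prod_(i : I) P (Y i @^-1` A i))%E.

Definition has_normal_law {d} {T : measurableType d} {R : realType}
  (P : probability T R) (Y : T -> R) (m v : R) : Prop :=
  forall A : set R, measurable A ->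
    P (Y @^-1` A) = if v == 0 then \d_m A else normal_prob m (Num.sqrt v) A.

Definition has_poisson_law {d} {T : measurableType d} {R : realType}
  (P : probability T R) (Y : T -> R) (r : R) : Prop :=
  forall k : nat, P (Y @^-1` [set k%:R]) = (poisson_pmf r k)%:E.

Definition BM_indep_Poisson {d} {T : measurableType d} {R : realType}
  (P : probability T R) (B N : R -> T -> R) (lam : R) : Prop :=
  (forall t, measurable_fun [set: T] (B t)) /\
  (forall t, measurable_fun [set: T] (N t)) /\
  (forall w, B 0 w = 0 /\ N 0 w = 0) /\
  (forall w, {within `[0, +oo[, continuous (fun t => B t w)}) /\
  (forall w t, 0 <= t -> exists k : nat, N t w = k%:R) /\
  (forall w s t, 0 <= s -> s <= t -> N s w <= N t w) /\
  (forall w t, 0 <= t -> (fun u => N u w) @ at_right t --> N t w) /\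
  (forall (k : nat) (s : nat -> R), 0 <= s 0%N ->
     (forall i, (i < k)%N -> s i < s i.+1) ->
     [/\ mutually_independent P
           (fun j : ('I_k + 'I_k)%type => match j with
              | inl i => fun w => B (s i.+1) w - B (s i) w
              | inr i => fun w => N (s i.+1) w - N (s i) w end),
         (forall i, (i < k)%N ->
            has_normal_law P (fun w => B (s i.+1) w - B (s i) w) 0 (s i.+1 - s i)) &
         (forall i, (i < k)%N ->
            has_poisson_law P (fun w => N (s i.+1) w - N (s i) w) (lam * (s i.+1 - s i)))]).

Definition centered_gaussian_vector {d} {T : measurableType d} {R : realType}
  (Q : probability T R) (Gv : T -> 'cV[R]_3) (Gam : 'M[R]_3) : Prop :=
  (forall i, measurable_fun [set: T] (fun w => Gv w i 0)) /\
  forall a : 'cV[R]_3,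
    has_normal_law Q (fun w => (a^T *m Gv w) 0 0) 0 ((a^T *m Gam *m a) 0 0).

Definition dens_term {R : realType} (th sg lam Dl x y : R) (m : nat) : R :=
  expR (- (lam * Dl)) * (lam * Dl) ^+ m / (m`!)%:R
  * (Num.sqrt (2 * pi * sg ^+ 2 * Dl))^-1
  * expR (- (y - x - (th - lam) * Dl - m%:R) ^+ 2 / (2 * sg ^+ 2 * Dl)).

Definition trans_dens {R : realType} (th sg lam Dl x y : R) : R :=
  limn (series (dens_term th sg lam Dl x y)).

Definition likelihood {R : realType} (th sg lam Dl : R) (n : nat) (obs : nat -> R) : R :=
  \prod_(k < n) trans_dens th sg lam Dl (obs k) (obs k.+1).

Definition Gamma_entry {R : realType} (sg lam : R) (i j : nat) : R :=
  (match i, j with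
   | 0%N, 0%N => 1 | 0%N, 2%N => -1 | 1%N, 1%N => 2 | 2%N, 0%N => -1
   | 2%N, 2%N => 1 + sg ^+ 2 / lam | _, _ => 0 end) / sg ^+ 2.

Definition Gamma {R : realType} (sg lam : R) : 'M[R]_3 :=
  \matrix_(i, j) Gamma_entry sg lam i j.

Definition cvg_in_law {d d'} {T : measurableType d} {T' : measurableType d'}
  {R : realType} (P : probability T R) (Y : nat -> T -> R)
  (Q : probability T' R) (Z : T' -> R) : Prop :=
  forall f : R -> R, continuous f -> (exists M : R, forall x, `|f x| <= M) ->
    ('E_P[f \o Y n])%E @[n --> \oo] --> ('E_Q[f \o Z])%E.

(* Main.v *)
(* The increments of the observed process are i.i.d. copies of a + s xi + M with xi standard
   normal and M an independent Poisson variable, so the log-likelihood ratio is the sum of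
   ln (1 + Y_k), where 1 + Y_k is the one-step likelihood ratio of the k-th increment.  Given the
   increment, 1 + Y_k is the conditional expectation of the likelihood ratio of the pair (M, xi),
   which factors into a Poisson and a Gaussian ratio; its L2 distance to 1 plus the linear score
   m xi + e (xi^2 - 1) + c (M - mu) is explicit.  The score itself is not a function of the
   increment, but it becomes one, up to a small L2 error, when M is replaced by the rounded
   increment.  Conditional Jensen then gives n E (Y - score)^2 -> 0, hence n E Y^2 -> I, where
   I = z^T Gamma z, and n P(|Y| > 1/2) -> 0.  After clipping Y at 1/2, ln (1 + Y) has mean
   -I/(2n), second moment I/n and third absolute moment o(1/n) up to o(1/n) errors, and the sum is
   compared, by replacing one summand at a time, with the drifted increments of B over a grid of
   [0, I], whose sum has exactly the law N(-I/2, I).  The replacement is carried out for test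
   functions with a third-order Taylor expansion; cubic splines show that these determine
   convergence in law. *)
Require Import Defs.
From HB Require Import structures.
From mathcomp Require Import all_boot all_order all_algebra.
From mathcomp Require Import all_classical all_reals all_analysis.
From mathcomp Require Import measurable_realfun ring lra.
Import Order.TTheory GRing.Theory Num.Theory.
Import numFieldNormedType.Exports.
Local Open Scope classical_set_scope.
Local Open Scope ring_scope.
Set Implicit Arguments. Unset Strict Implicit. Unset Printing Implicit Defensive.

(** * Convolution and replacement of summands *)

Section bounded_measurable.
Context {d} {T : measurableType d} {R : realType}.
Implicit Types (f g : T -> R) (P : probability T R).

(** The obstacle is that the density of an increment is an infinite Poisson mixture, whose parameter
    derivatives are awkward to bound. It is never differentiated: the ratio for the pair [(M, xi)]
    is explicit, and passing to the increment contracts L2 distances. The contraction compares only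
    with functions of the increment, which forces the rounded score; rounding fails only for
    [|s * xi| >= 1 / 2], and a sixth-moment Chebyshev bound leaves a positive power of [s] in every
    term.

    Perturbations are measured in the units of one step: [m] and [e] of order [1 / sqrt n] for the
    location and the relative scale of the Gaussian part, [c] of order [1 / sqrt (n * Delta n)] for
    the relative intensity. For large [n] the variance [m ^+ 2 + 2 * e ^+ 2 + c ^+ 2 * mu] of the
    score is then exactly [I / n]. Drift and compensator both move the location, through [u - w];
    this is the source of the entries [-1] of [Gamma].

    One quantity, the minimum of [|y| ^+ 3] and [y ^+ 2], controls the Taylor error, the clipping
    error and the tail probability together. The case [I = 0] has no grid to compare with and is
    settled separately. *)

Definition bmeas f := measurable_fun setT f /\ exists M : R, forall x, `|f x| <= M.

Lemma bmeas_integrable P f : bmeas f -> P.-integrable setT (EFin \o f).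
Proof.
move=> [mf [M fM]]; apply: measurable_bounded_integrable => //.
  by apply: le_lt_trans (probability_le1 P measurableT) _; rewrite ltry.
exists M; split; first by rewrite num_real.
by move=> x Mx y _ /=; apply: le_trans (fM y) (ltW Mx).
Qed.

Lemma bmeas_cst c : bmeas (cst c).
Proof. by split => //; exists `|c|. Qed.

Lemma bmeasD f g : bmeas f -> bmeas g -> bmeas (fun x => f x + g x).
Proof.
move=> [mf [M fM]] [mg [N gN]]; split; first exact: measurable_funD.
by exists (M + N) => x; rewrite (le_trans (ler_normD _ _))// lerD.
Qed.

Lemma bmeasZ c f : bmeas f -> bmeas (fun x => c * f x).
Proof.
move=> [mf [M fM]]; split; first exact: measurable_funM.
by exists (`|c| * M) => x; rewrite normrM ler_wpM2l.
Qed.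

Lemma bmeasB f g : bmeas f -> bmeas g -> bmeas (fun x => f x - g x).
Proof.
move=> bf bg; have := bmeasD bf (bmeasZ (-1) bg).
by under eq_fun do rewrite mulN1r.
Qed.

Lemma Rintegral_prob_cst P c : \int[P]_x c = c.
Proof. by rewrite /Rintegral integral_cst// [X in (_ * X)%E]probability_setT mule1. Qed.

Lemma Rintegral_norm_le P f c : bmeas f -> (forall x, `|f x| <= c) ->
  `|\int[P]_x f x| <= c.
Proof.
move=> bf fc; apply: le_trans (le_normr_Rintegral _ (bmeas_integrable P bf)) _ => //.
rewrite -[leRHS](Rintegral_prob_cst P); apply: le_Rintegral => //.
- apply: (bmeas_integrable P (f := fun x => `|f x|)).
  by case: bf => mf _; split; [exact: measurableT_comp|exists c => x; rewrite normr_id].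
- exact: (bmeas_integrable P (bmeas_cst c)).
Qed.

End bounded_measurable.

Lemma bmeas_comp {d d'} {T : measurableType d} {T' : measurableType d'} {R : realType}
  (f : T' -> R) (g : T -> T') : bmeas f -> measurable_fun setT g -> bmeas (f \o g).
Proof.
move=> [mf [M fM]] mg; split; first exact: measurableT_comp.
by exists M => x; exact: fM.
Qed.

(** * Convolution operators on bounded test functions *)

Section conv.
Context {R : realType}.
Notation RR := (measurableTypeR R).
Implicit Types (f g : RR -> R) (nu mu : probability RR R).

(** A law acts here on test functions, so that a sum of [n] independent summands becomes an [n]-th
    iterate, and replacing a summand becomes replacing an operator. *)
Definition conv nu f (x : R) : R := \int[nu]_y f (x + y).

Lemma bmeas_add f : bmeas f -> bmeas (fun z : RR * RR => f (z.1 + z.2)).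
Proof. by move=> bf; apply: (bmeas_comp bf) => /=; exact: measurable_funD. Qed.

Lemma bmeas_addr f x : bmeas f -> bmeas (fun z : RR => f (x + z)).
Proof. by move=> bf; apply: (bmeas_comp bf) => /=; exact: measurable_funD. Qed.

Lemma bmeas_addl f x : bmeas f -> bmeas (fun z : RR => f (z + x)).
Proof. by move=> bf; apply: (bmeas_comp bf) => /=; exact: measurable_funD. Qed.

Lemma bmeas_prod_integrable {d1 d2} {T1 : measurableType d1} {T2 : measurableType d2}
  (P1 : probability T1 R) (P2 : probability T2 R) (F : T1 * T2 -> R) :
  bmeas F -> (P1 \x P2)%E.-integrable setT (EFin \o F).
Proof. exact: (@bmeas_integrable _ _ _ (P1 \x P2)%E). Qed.

Lemma bmeas_Rintegral2 {d1 d2} {T1 : measurableType d1} {T2 : measurableType d2}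
  (P1 : probability T1 R) (P2 : probability T2 R) (F : T1 * T2 -> R) :
  bmeas F -> bmeas (fun x => \int[P2]_y F (x, y)).
Proof.
move=> bF; have := bF => -[mF [M FM]]; split; last first.
  exists M => x; apply: Rintegral_norm_le => //.
  by apply: (bmeas_comp bF); exact: pair1_measurable.
have := measurable_fubini_F (bmeas_prod_integrable P1 P2 bF).
exact: (measurableT_comp (@fine_measurable _ setT measurableT)).
Qed.

Lemma Rintegral_fubini {d1 d2} {T1 : measurableType d1} {T2 : measurableType d2}
  (P1 : probability T1 R) (P2 : probability T2 R) (F : T1 * T2 -> R) :
  bmeas F -> \int[P1]_x \int[P2]_y F (x, y) = \int[(P1 \x P2)%E]_z F z.
Proof.
move=> bF; rewrite /Rintegral -(integral12_prod_meas1 (bmeas_prod_integrable P1 P2 bF)).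
congr fine; apply: eq_integral => x _; rewrite fineK//.
apply: integrable_fin_num => //; apply: (bmeas_integrable P2 (f := fun y => F (x, y))).
by apply: (bmeas_comp bF); exact: pair1_measurable.
Qed.

Lemma Rintegral_swap {d1 d2} {T1 : measurableType d1} {T2 : measurableType d2}
  (P1 : probability T1 R) (P2 : probability T2 R) (F : T1 * T2 -> R) :
  bmeas F -> \int[P1]_x \int[P2]_y F (x, y) = \int[P2]_y \int[P1]_x F (x, y).
Proof.
move=> bF; have [mF [M FM]] := bF.
have F1 x : P2.-integrable setT (EFin \o (fun y => F (x, y))).
  by apply: bmeas_integrable; apply: (bmeas_comp bF); exact: pair1_measurable.
have F2 y : P1.-integrable setT (EFin \o (fun x => F (x, y))).
  by apply: bmeas_integrable; apply: (bmeas_comp bF); exact: pair2_measurable.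
rewrite /Rintegral; congr fine.
under eq_integral => x _ do rewrite fineK ?(integrable_fin_num measurableT (F1 x))//.
under [RHS]eq_integral => x _ do rewrite fineK ?(integrable_fin_num measurableT (F2 x))//.
exact: (Fubini (bmeas_prod_integrable P1 P2 bF)).
Qed.

Lemma bmeas_conv nu f : bmeas f -> bmeas (conv nu f).
Proof. by move=> /bmeas_add /(bmeas_Rintegral2 nu nu). Qed.

(** Fubini together with the commutativity of addition. Commutation is what lets one factor of an
    iterate be exchanged at any position. *)
Lemma conv_comm nu mu f : bmeas f -> conv nu (conv mu f) = conv mu (conv nu f).
Proof.
move=> bf; apply/funext => x; rewrite /conv.
rewrite (Rintegral_swap nu mu (F := fun z : RR * RR => f (x + z.1 + z.2))).
  by apply: eq_Rintegral => y _; apply: eq_Rintegral => z _ /=; rewrite addrAC.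
apply: (bmeas_comp (f := f) (g := fun z : RR * RR => x + z.1 + z.2)) => //.
by apply: measurable_funD => //; exact: measurable_funD.
Qed.

Lemma convB nu f g : bmeas f -> bmeas g ->
  conv nu (fun x => f x - g x) = (fun x => conv nu f x - conv nu g x).
Proof.
move=> bf bg; apply/funext => x; rewrite /conv RintegralB//.
  exact: (bmeas_integrable nu (bmeas_addr x bf)).
exact: (bmeas_integrable nu (bmeas_addr x bg)).
Qed.

Lemma conv_norm_le nu f c : bmeas f -> (forall x, `|f x| <= c) ->
  forall x, `|conv nu f x| <= c.
Proof. by move=> bf fc x; apply: Rintegral_norm_le => //; exact: bmeas_addr. Qed.

Lemma bmeas_iter_conv nu n f : bmeas f -> bmeas (iter n (conv nu) f).
Proof. by move=> bf; elim: n => //= n IH; exact: bmeas_conv. Qed.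

(** Telescoping of a difference of [n]-th powers of two commuting contractions for the sup norm:
    each of the [n] exchanges costs at most [delta]. In the induction, the bound for [f] passes to
    [conv mu f] because the operators commute. *)
Lemma trotter nu mu f (delta : R) n : bmeas f ->
  (forall x, `|conv nu f x - conv mu f x| <= delta) ->
  forall x, `|iter n (conv nu) f x - iter n (conv mu) f x| <= n%:R * delta.
Proof.
elim: n f => [|n IH] f bf fd x; first by rewrite subrr normr0 mul0r.
have bnf := bmeas_conv nu bf; have bmf := bmeas_conv mu bf.
rewrite !iterSr; set A := iter _ _ _ _; set B := iter _ _ _ _.
rewrite -(subrKA (iter n (conv nu) (conv mu f) x)) mulrSr mulrDl mul1r addrC.
rewrite (le_trans (ler_normD _ _))//; apply: lerD.
  apply: IH => // y.
  have -> : conv nu (conv mu f) y - conv mu (conv mu f) y =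
      conv mu (fun z => conv nu f z - conv mu f z) y by rewrite conv_comm// convB.
  by apply: conv_norm_le => //; apply: bmeasB.
have iterB m (h k : RR -> R) : bmeas h -> bmeas k ->
    iter m (conv nu) (fun z => h z - k z) =
    (fun z => iter m (conv nu) h z - iter m (conv nu) k z).
  move=> bh bk; elim: m => //= m ->; rewrite convB//; exact: bmeas_iter_conv.
have -> : A - iter n (conv nu) (conv mu f) x =
    iter n (conv nu) (fun z => conv nu f z - conv mu f z) x by rewrite iterB.
clear A B IH; elim: n x => [|n IH] x /=; first exact: fd.
by apply: conv_norm_le => //; apply: bmeas_iter_conv; exact: bmeasB.
Qed.

End conv.

(** * Expectations under independence and under image laws *)

Section transfer.
Context {d} {T : measurableType d} {R : realType} (P : probability T R).
Notation RR := (measurableTypeR R).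

(** The hypothesis on rectangles says at once that [U] and [V] are independent and that their laws
    are [P1] and [P2]; a measure agreeing with the product on rectangles is the product. *)
Lemma Rintegral_indep {d1 d2} {T1 : measurableType d1} {T2 : measurableType d2}
  (U : T -> T1) (V : T -> T2) (P1 : probability T1 R) (P2 : probability T2 R)
  (F : T1 * T2 -> R) :
  measurable_fun setT U -> measurable_fun setT V ->
  (forall A B, measurable A -> measurable B ->
     P (U @^-1` A `&` V @^-1` B) = (P1 A * P2 B)%E) ->
  bmeas F -> \int[P]_w F (U w, V w) = \int[P1]_x \int[P2]_y F (x, y).
Proof.
move=> mU mV UV bF; rewrite Rintegral_fubini// /Rintegral; congr fine.
have mUV : measurable_fun setT (fun w => (U w, V w)) by exact: measurable_fun_pair.
have bFUV := bmeas_comp bF mUV.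
have -> : (\int[P]_w (F (U w, V w))%:E =
   \int[pushforward P (fun w => (U w, V w))]_z (F z)%:E)%E.
  rewrite (integral_pushforward mUV)//.
    by apply/measurable_EFinP; case: bF.
  exact: (bmeas_integrable P bFUV).
apply: eq_measure_integral => A mA _.
apply/esym; apply: (@product_measure_unique _ _ _ _ _ P1 P2 (pushforward P (fun w => (U w, V w)))) => //.
Qed.

Definition law {d1} {T1 : measurableType d1} (U : T -> T1)
    (mU : measurable_fun setT U) : probability T1 R :=
  let X : {mfun T >-> T1} := HB.pack U (isMeasurableFun.Build _ _ _ _ U mU) in
  distribution P X.

Lemma lawE {d1} {T1 : measurableType d1} (U : T -> T1)
  (mU : measurable_fun setT U) A : law mU A = P (U @^-1` A).
Proof. by []. Qed.

Lemma Rintegral_law {d1} {T1 : measurableType d1} (U : T -> T1)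
  (mU : measurable_fun setT U) (f : T1 -> R) :
  bmeas f -> \int[law mU]_x f x = \int[P]_w f (U w).
Proof.
move=> bf; rewrite /Rintegral; congr fine.
rewrite (integral_pushforward mU)//; first by apply/measurable_EFinP; case: bf.
exact: (bmeas_integrable P (bmeas_comp bf mU)).
Qed.

(** The last summand is integrated out first, which turns [f] into [conv nu f]; hence the induction
    is over all [f]. Only independence of each summand from the preceding partial sum enters. *)
Lemma Rintegral_sum_indep (zeta : nat -> T -> RR) (nu : probability RR R) n (f : RR -> R) :
  (forall k, measurable_fun setT (zeta k)) ->
  (forall k, (k < n)%N -> forall A B, measurable A -> measurable B ->
     P ((fun w => \sum_(j < k) zeta j w) @^-1` A `&` zeta k @^-1` B) =
     (P ((fun w => (\sum_(j < k) zeta j w)%R) @^-1` A) * nu B)%E) ->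
  bmeas f -> \int[P]_w f (\sum_(j < n) zeta j w) = iter n (conv nu) f 0.
Proof.
move=> mz; elim: n f => [|n IH] f ind bf.
  under eq_Rintegral do rewrite big_ord0.
  by rewrite Rintegral_prob_cst.
have mS : measurable_fun setT (fun w => \sum_(j < n) zeta j w).
  by apply: measurable_sum => i; exact: mz.
under eq_Rintegral do rewrite big_ord_recr/=.
rewrite (@Rintegral_indep _ _ _ _ _ _ (law mS) nu
  (fun z : RR * RR => f (z.1 + z.2)) mS (mz n)) //=.
- rewrite -[RHS]/(iter n.+1 (conv nu) f 0) iterSr -IH => [|k kn|]; last exact: bmeas_conv.
    by rewrite (Rintegral_law mS (bmeas_conv nu bf)).
  by apply: ind; exact: ltnW.
- exact: ind.
- exact: bmeas_add.
Qed.

End transfer.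

(** * Test functions with a third-order expansion *)

Section spline.
Context {R : realType}.
Implicit Types x y : R.

Definition cubic_plus x : R := Num.max x 0 ^+ 3.

(** The second derivative [6 * max x 0] is Lipschitz with constant 6, so the remainder is at most
    [|y| ^+ 3]; the four sign patterns of [x] and [x + y] verify this without derivatives. *)
Lemma cubic_plus_taylor x y :
  `|cubic_plus (x + y) - cubic_plus x - 3 * Num.max x 0 ^+ 2 * y
     - 3 * Num.max x 0 * y ^+ 2| <= `|y| ^+ 3.
Proof.
rewrite /cubic_plus !maxEle.
case: (leP x 0) => hx; case: (leP (x + y) 0) => hy.
- by rewrite !expr0n /= !mulr0 !mul0r !subr0 normr0 exprn_ge0.
- rewrite !expr0n /= !mulr0 !mul0r !subr0.
  by rewrite !ger0_norm ?exprn_ge0//; try lra; apply: lerXn2r; rewrite ?nnegrE; lra.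
- rewrite (_ : _ - _ = - ((x + y) ^+ 3 - y ^+ 3)) ?normrN; last by ring.
  rewrite (@ler0_norm _ y); last lra.
  rewrite ger0_norm; last first.
    rewrite subr_ge0 -subr_ge0 (_ : _ - _ = x * ((x + y) ^+ 2 + (x + y) * y + y ^+ 2)); last by ring.
    apply: mulr_ge0; first lra.
    by have := sqr_ge0 (x + y + y / 2); have := sqr_ge0 y; nra.
  have : 0 <= (- (x + y)) ^+ 3 by rewrite exprn_ge0//; lra.
  rewrite (_ : (- (x + y)) ^+ 3 = - (x + y) ^+ 3); last by ring.
  rewrite (_ : (- y) ^+ 3 = - y ^+ 3); last by ring.
  by set u := (x + y) ^+ 3; set v := y ^+ 3; lra.
- by rewrite (_ : _ - _ = y ^+ 3) ?normrX//; ring.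
Qed.

(** The distribution function of a sum of three independent uniform variables on [[0, 1]]: a twice
    continuously differentiable step rising from 0 to 1 on [[0, 3]]. *)
Definition spline x : R :=
  (cubic_plus x - 3 * cubic_plus (x - 1) + 3 * cubic_plus (x - 2) - cubic_plus (x - 3)) / 6.

Lemma spline_le0 x : x <= 0 -> spline x = 0.
Proof.
by move=> x0; rewrite /spline /cubic_plus !max_r; (try lra); ring.
Qed.

Lemma spline_ge3 x : 3 <= x -> spline x = 1.
Proof.
by move=> x3; rewrite /spline /cubic_plus !max_l; (try lra); field.
Qed.

Lemma cubic_plus_neg x : x <= 0 -> cubic_plus x = 0.
Proof. by move=> ?; rewrite /cubic_plus max_r// expr0n. Qed.

Lemma cubic_plus_pos x : 0 <= x -> cubic_plus x = x ^+ 3.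
Proof. by move=> ?; rewrite /cubic_plus max_l. Qed.

Lemma spline_homo : {homo spline : x y / x <= y}.
Proof.
have cub (u v : R) : u <= v -> u ^+ 3 <= v ^+ 3.
  move=> uv; rewrite -subr_ge0.
  rewrite (_ : _ - _ = (v - u) * (((u + v) ^+ 2 + u ^+ 2 + v ^+ 2) / 2)); last by field.
  by rewrite mulr_ge0 ?subr_ge0// divr_ge0// !addr_ge0// sqr_ge0.
(* Monotonicity on two adjacent intervals passes through the common end point [b], so each
   polynomial piece can be treated alone. *)
have glue (f : R -> R) (a b : R) :
    (forall x y, a <= x -> x <= y -> y <= b -> f x <= f y) ->
    (forall x y, b <= x -> x <= y -> f x <= f y) ->
    forall x y, a <= x -> x <= y -> f x <= f y.
  move=> fl fr x y ax xy; have [yb|/ltW yb] := leP y b; first exact: fl.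
  have [xb|/ltW xb] := leP x b; last exact: fr.
  by apply: (@le_trans _ _ (f b)); [exact: fl|exact: fr].
have s0 : forall x y, 0 <= x -> x <= y -> spline x <= spline y.
  apply: (glue _ _ 1) => [x y x0 xy y1|].
    rewrite /spline ![cubic_plus (_ - _)]cubic_plus_neg; try lra.
    rewrite !cubic_plus_pos; try lra.
    have := cub _ _ xy; lra.
  apply: (glue _ _ 2) => [x y x0 xy y1|].
    rewrite /spline ![cubic_plus (_ - 2)]cubic_plus_neg; try lra.
    rewrite ![cubic_plus (_ - 3)]cubic_plus_neg; try lra.
    rewrite !cubic_plus_pos; try lra.
    (* Six times the increment of the spline on [[1, 2]], with the divided difference written so
       that each term is visibly nonnegative there. *)
    suff : 0 <= (y - x) * (2 * ((x - 1) * (2 - x)) + 2 * ((y - 1) * (2 - y))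
        + (x - 1) * (2 - y) + (y - 1) * (2 - x) + 3) by lra.
    by rewrite mulr_ge0 ?subr_ge0// !addr_ge0// ?mulr_ge0//; lra.
  apply: (glue _ _ 3) => [x y x0 xy y1|x y x3 xy].
    rewrite /spline ![cubic_plus (_ - 3)]cubic_plus_neg; try lra.
    rewrite !cubic_plus_pos; try lra.
    (* On [[2, 3]] the spline equals [1 - (3 - x) ^+ 3 / 6]. *)
    have : (3 - y) ^+ 3 <= (3 - x) ^+ 3 by apply: cub; lra.
    lra.
  by rewrite !spline_ge3//; lra.
move=> x y xy; have [y0|/ltW y0] := leP y 0; first by rewrite !spline_le0//; lra.
have [x0|/ltW x0] := leP x 0; last exact: s0.
by rewrite (spline_le0 x0) -(spline_le0 (lexx 0)); exact: s0.
Qed.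

Lemma spline_ge0 x : 0 <= spline x.
Proof.
have [x0|x0] := leP x 0; first by rewrite spline_le0.
by rewrite -(spline_le0 (lexx 0)) spline_homo// ltW.
Qed.

Lemma spline_le1 x : spline x <= 1.
Proof.
have [x0|x0] := leP 3 x; first by rewrite spline_ge3.
by rewrite -(spline_ge3 (lexx 3)) spline_homo// ltW.
Qed.

Lemma measurable_spline : measurable_fun setT spline.
Proof.
have mc (a : R) : measurable_fun setT (fun x => cubic_plus (x - a)).
  apply: measurable_funX; apply: measurable_maxr => //.
  exact: measurable_funB.
have mc0 : measurable_fun setT cubic_plus.
  by apply: measurable_funX; exact: measurable_maxr.
apply: measurable_funM => //; apply: measurable_funB => //.
apply: measurable_funD; last exact: measurable_funM.
by apply: measurable_funB => //; exact: measurable_funM.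
Qed.

End spline.

(** * Test functions with a uniform third-order expansion *)

Section taylor3.
Context {R : realType}.
Notation RR := (measurableTypeR R).
Implicit Types f g : RR -> R.

(** The functions [a] and [b] stand for the first derivative and half the second one. Stating the
    expansion instead of differentiability lets piecewise polynomials in directly, and uniform
    bounds are what the exchange of summands consumes. *)
Definition taylor3 f := bmeas f /\ exists (C : R) (a b : R -> R),
  [/\ forall x, `|a x| <= C, forall x, `|b x| <= C &
      forall x y, `|f (x + y) - f x - a x * y - b x * y ^+ 2| <= C * `|y| ^+ 3].

Lemma taylor3_cst c : taylor3 (cst c).
Proof.
split; first exact: bmeas_cst.
exists 0, (cst 0), (cst 0); split=> x /=; rewrite ?normr0//.
by move=> y; rewrite !mul0r subrr !subr0 normr0.
Qed.

Lemma taylor3D f g : taylor3 f -> taylor3 g -> taylor3 (fun x => f x + g x).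
Proof.
move=> [bf [C [a [b [aC bC fC]]]]] [bg [D [a' [b' [aD bD gD]]]]].
split; first exact: bmeasD.
exists (C + D), (fun x => a x + a' x), (fun x => b x + b' x); split => x.
- by rewrite (le_trans (ler_normD _ _))// lerD.
- by rewrite (le_trans (ler_normD _ _))// lerD.
- move=> y; rewrite [leRHS]mulrDl; apply: le_trans (lerD (fC x y) (gD x y)).
  apply: le_trans (ler_normD _ _); rewrite le_eqVlt; apply/orP; left; apply/eqP.
  by congr `|_|; ring.
Qed.

Lemma taylor3Z c f : taylor3 f -> taylor3 (fun x => c * f x).
Proof.
move=> [bf [C [a [b [aC bC fC]]]]]; split; first exact: bmeasZ.
exists (`|c| * C), (fun x => c * a x), (fun x => c * b x); split => x.
- by rewrite normrM ler_wpM2l.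
- by rewrite normrM ler_wpM2l.
- by move=> y; rewrite -!mulrA -!mulrBr normrM ler_wpM2l// !mulrA.
Qed.

Lemma taylor3_sum (I : Type) (r : seq I) (F : I -> RR -> R) :
  (forall i, taylor3 (F i)) -> taylor3 (fun x => \sum_(i <- r) F i x).
Proof.
move=> tF; elim: r => [|i r IH].
  by under eq_fun do rewrite big_nil; exact: taylor3_cst.
by under eq_fun do rewrite big_cons; exact: taylor3D.
Qed.

Lemma taylor3_affine h c f : taylor3 f -> taylor3 (fun x => f (h * (x - c))).
Proof.
move=> [bf [C [a [b [aC bC fC]]]]]; split.
  by apply: (bmeas_comp bf) => /=; apply: measurable_funM => //; exact: measurable_funB.
(* The three bounds need the factors [|h|], [|h| ^+ 2] and [|h| ^+ 3]; their sum serves all of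
   them. *)
set H := 1 + `|h| + `|h| ^+ 2 + `|h| ^+ 3.
have h0 := normr_ge0 h; have h2 := exprn_ge0 2 h0; have h3 := exprn_ge0 3 h0.
have C0 : 0 <= C by apply: le_trans (aC 0).
exists (H * C), (fun x => h * a (h * (x - c))), (fun x => h ^+ 2 * b (h * (x - c))); split => x.
- by rewrite normrM ler_pM//; rewrite /H; lra.
- by rewrite normrM ler_pM// normrX /H; lra.
- move=> y.
  rewrite (_ : h * (x + y - c) = h * (x - c) + h * y); last by ring.
  have := fC (h * (x - c)) (h * y).
  rewrite [h * a _ * y]mulrAC [h ^+ 2 * _ * _]mulrAC -exprMn -[_ * a _]mulrC -[_ * b _]mulrC => /le_trans; apply.
  rewrite normrM exprMn mulrA ler_wpM2r ?exprn_ge0// mulrC ler_wpM2r// /H; lra.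
Qed.

Lemma taylor3_spline : taylor3 spline.
Proof.
split.
  split; first exact: measurable_spline.
  by exists 1 => x; rewrite ger0_norm ?spline_ge0 ?spline_le1.
pose m (x : R) := Num.max x 0.
(* The four cubic remainders carry the weights 1, 3, 3, 1 over 6, in total 4/3, which is below 2. *)
exists 2, (fun x => (m x ^+ 2 - 3 * m (x - 1) ^+ 2 + 3 * m (x - 2) ^+ 2 - m (x - 3) ^+ 2) / 2),
  (fun x => (m x - 3 * m (x - 1) + 3 * m (x - 2) - m (x - 3)) / 2); split => x.
- have [x0|x0] := leP x 0.
    by rewrite /m !max_r; try lra; rewrite expr0n /= ger0_norm; lra.
  have [x1|x1] := leP x 1.
    rewrite /m (@max_l _ _ x); last lra.
    by rewrite !max_r; try lra; rewrite ler_norml; apply/andP; split; nra.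
  have [x2|x2] := leP x 2.
    rewrite /m (@max_l _ _ x); last lra.
    rewrite (@max_l _ _ (x - 1)); last lra.
    by rewrite !max_r; try lra; rewrite ler_norml; apply/andP; split; nra.
  have [x3|x3] := leP x 3.
    rewrite /m (@max_l _ _ x); last lra.
    rewrite (@max_l _ _ (x - 1)); last lra.
    rewrite (@max_l _ _ (x - 2)); last lra.
    by rewrite !max_r; try lra; rewrite ler_norml; apply/andP; split; nra.
  rewrite /m !max_l; try lra.
  by rewrite ler_norml; apply/andP; split; nra.
- by rewrite /m !maxEle; case: (leP x 0) => ?; case: (leP (x - 1) 0) => ?;
    case: (leP (x - 2) 0) => ?; case: (leP (x - 3) 0) => ?; rewrite ler_norml; apply/andP; split; lra.
- move=> y.
  have T z : `|cubic_plus (z + y) - cubic_plus z - 3 * m z ^+ 2 * y - 3 * m z * y ^+ 2| <= `|y| ^+ 3.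
    exact: cubic_plus_taylor.
  have := T x; have := T (x - 1); have := T (x - 2); have := T (x - 3).
  have e c : x + y - c = x - c + y by ring.
  rewrite /spline !e.
  set u0 := cubic_plus x; set u1 := cubic_plus (x - 1); set u2 := cubic_plus (x - 2); set u3 := cubic_plus (x - 3).
  set v0 := cubic_plus (x + y); set v1 := cubic_plus (x - 1 + y); set v2 := cubic_plus (x - 2 + y); set v3 := cubic_plus (x - 3 + y).
  set m0 := m x; set m1 := m (x - 1); set m2 := m (x - 2); set m3 := m (x - 3).
  set N := `|y| ^+ 3; have N0 : 0 <= N by rewrite exprn_ge0.
  rewrite !ler_norml => /andP[? ?] /andP[? ?] /andP[? ?] /andP[? ?].
  apply/andP; split; lra.
Qed.

End taylor3.

Section cvg_zero.
Context {R : realType}.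
Implicit Types u v : nat -> R.

Lemma cvgr0D u v : u n @[n --> \oo] --> 0 -> v n @[n --> \oo] --> 0 ->
  u n + v n @[n --> \oo] --> 0.
Proof. by move=> u0 v0; have := cvgD u0 v0; rewrite addr0; exact. Qed.

Lemma cvgr0Ml c u : u n @[n --> \oo] --> 0 -> c * u n @[n --> \oo] --> 0.
Proof. by move=> u0; have := cvgM (cvg_cst c) u0; rewrite mulr0; exact. Qed.

Lemma cvgr0_norm u : u n @[n --> \oo] --> 0 -> `|u n| @[n --> \oo] --> 0.
Proof. by move=> u0; have := cvg_norm u0; rewrite normr0; exact. Qed.

Lemma cvgr0_le u v : (\forall n \near \oo, `|u n| <= v n) -> v n @[n --> \oo] --> 0 ->
  u n @[n --> \oo] --> 0.
Proof.
move=> uv v0; apply/cvgr0Pnorm_le => e e0.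
have /cvgr0Pnorm_le /(_ _ e0) := v0; apply: filterS2 uv => n un vn.
exact: le_trans un (le_trans (ler_norm _) vn).
Qed.

End cvg_zero.

(** * Lindeberg replacement for triangular arrays *)

Section clt_taylor3.
Context {R : realType}.
Notation RR := (measurableTypeR R).
Implicit Types (f : RR -> R) (nu mu : probability RR R).

Definition third_moment nu :=
  [/\ nu.-integrable setT (EFin \o (fun y : RR => y)),
      nu.-integrable setT (EFin \o (fun y : RR => y ^+ 2)) &
      nu.-integrable setT (EFin \o (fun y : RR => `|y| ^+ 3))].

Lemma conv_taylor f (C : R) (a b : R -> R) nu x : bmeas f -> third_moment nu ->
  (forall x y, `|f (x + y) - f x - a x * y - b x * y ^+ 2| <= C * `|y| ^+ 3) ->
  `|conv nu f x - f x - a x * \int[nu]_y y - b x * \int[nu]_y (y ^+ 2)|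
    <= C * \int[nu]_y (`|y| ^+ 3).
Proof.
move=> bf [i1 i2 i3] fT.
have ia : nu.-integrable setT (EFin \o (fun y : RR => a x * y)).
  by have := integrableZl measurableT (a x) i1.
have ib : nu.-integrable setT (EFin \o (fun y : RR => b x * y ^+ 2)).
  by have := integrableZl measurableT (b x) i2.
have ic : nu.-integrable setT (EFin \o (fun y : RR => C * `|y| ^+ 3)).
  by have := integrableZl measurableT C i3.
have if0 : nu.-integrable setT (EFin \o (fun y : RR => f (x + y))).
  exact: (bmeas_integrable nu (bmeas_addr x bf)).
have if1 : nu.-integrable setT (EFin \o (fun y : RR => f (x + y) - f x)).
  exact: (bmeas_integrable nu (bmeasB (bmeas_addr x bf) (bmeas_cst (f x)))).
have if2 : nu.-integrable setT (EFin \o (fun y : RR => f (x + y) - f x - a x * y)).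
  by have := integrableB measurableT if1 ia.
have if3 : nu.-integrable setT
    (EFin \o (fun y : RR => f (x + y) - f x - a x * y - b x * y ^+ 2)).
  by have := integrableB measurableT if2 ib.
rewrite -RintegralZl// -[X in _ - X]RintegralZl// -[X in _ <= X]RintegralZl//.
rewrite -[X in _ - X - _ - _](Rintegral_prob_cst nu) /conv -!RintegralB//; last first.
  exact: (bmeas_integrable nu (bmeas_cst (f x))).
apply: (le_trans (le_normr_Rintegral measurableT if3)).
apply: le_Rintegral => //=.
by have := integrable_norm if3.
Qed.

(** One exchange costs the differences of the first two moments plus both third absolute moments,
    uniformly in the starting point; [n] exchanges cost [n] times that. The summands need not be
    centred, since the means are compared as well. *)
Lemma clt_taylor3 f (nu mu : nat -> probability RR R) :
  taylor3 f -> (forall n, third_moment (nu n)) -> (forall n, third_moment (mu n)) ->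
  n%:R * (\int[nu n]_y y - \int[mu n]_y y) @[n --> \oo] --> 0 ->
  n%:R * (\int[nu n]_y (y ^+ 2) - \int[mu n]_y (y ^+ 2)) @[n --> \oo] --> 0 ->
  n%:R * \int[nu n]_y (`|y| ^+ 3) @[n --> \oo] --> 0 ->
  n%:R * \int[mu n]_y (`|y| ^+ 3) @[n --> \oo] --> 0 ->
  iter n (conv (nu n)) f 0 - iter n (conv (mu n)) f 0 @[n --> \oo] --> 0.
Proof.
move=> [bf [C [a [b [aC bC fT]]]]] i1 i2 h1 h2 h3 h4.
pose e n := C * (`|n%:R * (\int[nu n]_y y - \int[mu n]_y y)| +
  `|n%:R * (\int[nu n]_y (y ^+ 2) - \int[mu n]_y (y ^+ 2))| +
  n%:R * \int[nu n]_y (`|y| ^+ 3) + n%:R * \int[mu n]_y (`|y| ^+ 3)).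
have e0 : e n @[n --> \oo] --> 0.
  by apply: cvgr0Ml; do 2 (apply: cvgr0D => //); apply: cvgr0D; exact: cvgr0_norm.
apply: cvgr0_le e0; apply: nearW => n.
pose dl := C * (`|\int[nu n]_y y - \int[mu n]_y y| +
  `|\int[nu n]_y (y ^+ 2) - \int[mu n]_y (y ^+ 2)| +
  \int[nu n]_y (`|y| ^+ 3) + \int[mu n]_y (`|y| ^+ 3)).
rewrite (_ : e n = n%:R * dl); last first.
  by rewrite /e /dl !normrM normr_nat; ring.
apply: trotter => // x.
have := conv_taylor x bf (i1 n) fT; have := conv_taylor x bf (i2 n) fT.
move: (conv (mu n) f x) (conv (nu n) f x) => p q P Q.
rewrite /dl !mulrDr.
move: (aC x) (bC x) P Q; set ax := a x; set bx := b x; set fx := f x.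
set m1 := \int[nu n]_y y; set m1' := \int[mu n]_y y.
set m2 := \int[nu n]_y (y ^+ 2); set m2' := \int[mu n]_y (y ^+ 2).
set m3 := \int[nu n]_y _; set m3' := \int[mu n]_y _ => axC bxC P Q.
have A : `|ax * (m1 - m1')| <= C * `|m1 - m1'| by rewrite normrM ler_wpM2r.
have B : `|bx * (m2 - m2')| <= C * `|m2 - m2'| by rewrite normrM ler_wpM2r.
rewrite (_ : q - p = (ax * (m1 - m1') + bx * (m2 - m2') +
   (q - fx - ax * m1 - bx * m2)) - (p - fx - ax * m1' - bx * m2')); last by ring.
apply: (le_trans (ler_normB _ _)); apply: lerD => //.
apply: (le_trans (ler_normD _ _)); apply: lerD => //.
by apply: (le_trans (ler_normD _ _)); apply: lerD.
Qed.

End clt_taylor3.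

(** * From the restricted test functions to convergence in law *)

Section weak_convergence.
Context {R : realType}.
Notation RR := (measurableTypeR R).

(** Only [x] is confined to the segment; [y] may leave it. This is compactness of the segment in its
    near-covering form. *)
Lemma unif_continuous_segment (F : R -> R) (A e : R) : continuous F -> 0 < e ->
  exists2 h : R, 0 < h & forall x y, `|x| <= A -> `|x - y| < h -> `|F x - F y| < e.
Proof.
move=> cF e0.
have /compact_near_coveringP := @segment_compact R (- A) A.
move=> /(_ R (0^'+) (fun h x => forall y, `|x - y| < h -> `|F x - F y| < e) _).
move=> ncov; have e2 : 0 < e / 2 by rewrite divr_gt0.
have /ncov : forall x : R, `[- A, A]%classic x ->
    \forall x' \near x & h \near 0^'+, forall y, `|x' - y| < h -> `|F x' - F y| < e.
  move=> x _; have := cF x => /cvgrPdist_lt /(_ _ e2) /nbhs_ballP [d /= d0 dF].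
  exists (ball x (d / 2), [set h | 0 < h < d / 2]) => /=.
    split; first by apply: nbhsx_ballx; rewrite divr_gt0.
    near=> h; apply/andP; split; near: h; [exact: nbhs_right_gt|apply: nbhs_right_lt].
    by rewrite divr_gt0.
  move=> [z h] /= [xz /andP[h0 hd]] y zy.
  have Fz : `|F x - F z| < e / 2.
    by apply: dF; rewrite /ball/= in xz *; apply: lt_trans xz _; rewrite ltr_pdivrMr// ltr_pMr// ltr1n.
  have Fy : `|F x - F y| < e / 2.
    apply: dF; rewrite /ball/= in xz *.
    rewrite (_ : x - y = (x - z) + (z - y)); last by ring.
    rewrite (le_lt_trans (ler_normD _ _))// [d]splitr ltrD//; exact: lt_trans hd.
  rewrite (_ : F z - F y = - (F x - F z) + (F x - F y)); last by ring.
  by rewrite (le_lt_trans (ler_normD _ _))// normrN [e]splitr ltrD.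
move=> H; have : \forall h \near 0^'+, 0 < h /\
    (`[- A, A]%classic `<=` (fun x => forall y, `|x - y| < h -> `|F x - F y| < e)).
  by near=> h; split; near: h => //; exact: nbhs_right_gt.
move=> /filter_ex [h [h0 hF]]; exists h => // x y xA; apply: hF.
by rewrite /= in_itv/= -ler_norml.
Unshelve. all: by end_near. Qed.

(** Averaging the values of [F] at grid points with a partition of unity made of splines keeps the
    bound [M] on the whole line, not only on the segment. *)
Lemma taylor3_approx (F : R -> R) (M A e : R) : continuous F ->
  (forall x, `|F x| <= M) -> 0 < A -> 0 < e ->
  exists g : RR -> R, [/\ taylor3 g, forall x, `|g x| <= M &
    forall x, `|x| <= A -> `|F x - g x| <= e].
Proof.
move=> cF FM A0 e0; have [h0 h00 hF] := unif_continuous_segment A cF e0.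
(* This many cells make [3 * h] smaller than the modulus of continuity [h0]; three cells are the
   width over which a spline climbs. *)
have [N' hN'] : exists N' : nat, 6 * A / h0 < N'.+1%:R.
  exists (Num.truncn (6 * A / h0)); exact: truncnS_gt.
pose N := N'.+1; pose h := 2 * A / N%:R; pose X (j : nat) : R := - A + j%:R * h.
have N0 : 0 < N%:R :> R by rewrite ltr0n.
have hp : 0 < h by rewrite /h divr_gt0// mulr_gt0.
have h3 : 3 * h < h0.
  by rewrite /h mulrA ltr_pdivrMr//; move: hN'; rewrite ltr_pdivrMr// -/N; lra.
have XN : X N = A by rewrite /X /h mulrC divfK ?gt_eqF//; ring.
have XA j : (j <= N)%N -> `|X j| <= A.
  move=> jN; rewrite ler_norml; apply/andP; split.
    by rewrite lerDl mulr_ge0// ltW.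
  by rewrite -[leRHS]XN lerD2l ler_wpM2r ?ler_nat// ltW.
(* The conventions [sg 0 = 1] and [sg N.+1 = 0] make the weights sum to exactly 1 everywhere, the
   two end weights absorbing the half-lines. *)
pose sg (j : nat) (x : R) : R := if j is j'.+1 then
  (if (j' < N)%N then spline (h^-1 * (x - X j')) else 0) else 1.
pose W (j : nat) (x : R) : R := sg j x - sg j.+1 x.
have sg_mono x j : sg j.+1 x <= sg j x.
  rewrite /sg; case: j => [|j] /=; first exact: spline_le1.
  case: ltnP => jN; last by case: ifP => // _; exact: spline_ge0.
  rewrite (ltn_trans _ jN)//; apply: spline_homo; rewrite ler_wpM2l//.
    by rewrite invr_ge0 ltW.
  by rewrite lerD2l lerN2 lerD2l ler_wpM2r ?ler_nat// ltW.
have W0 j x : 0 <= W j x by rewrite subr_ge0.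
have WS x : \sum_(j < N.+1) W j x = 1.
  rewrite -(big_mkord xpredT (W^~ x)).
  under eq_bigr do rewrite /W -opprB.
  by rewrite sumrN (telescope_sumr (fun j => sg j x))//= ltnn sub0r opprK.
have sg01 j x : 0 <= sg j x <= 1.
  rewrite /sg; case: j => [|j] /=; first by rewrite ler01 lexx.
  by case: ifP => _; rewrite ?spline_ge0 ?spline_le1// lexx ler01.
(* Within the segment the weight [W j] vanishes farther than three cells from [X j]: either both
   steps are still 0 or both have reached 1, up to the sign already known. *)
have Wz (j : 'I_N.+1) x : `|x| <= A -> 3 * h < `|X j - x| -> W j x = 0.
  move=> xA xj; apply/eqP; rewrite eq_le W0 andbT /W.
  move: xA xj; rewrite ler_norml ltr_normr => /andP[xA1 xA2] /orP[xj|xj].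
    suff -> : sg j x = 0 by rewrite sub0r oppr_le0; case/andP: (sg01 j.+1 x).
    rewrite /sg; case: j xj => -[|j] /= jN xj.
      by move: xj; rewrite /X mul0r addr0; lra.
    rewrite ltnS in jN; rewrite jN spline_le0// mulr_ge0_le0 ?invr_ge0 ?ltW//.
    move: xj; rewrite /X -natr1 mulrDl mul1r; lra.
  have [jN|jN] := ltnP j N; last first.
    have jE : nat_of_ord j = N by apply/eqP; rewrite eqn_leq jN -ltnS ltn_ord.
    by move: xj; rewrite jE XN; lra.
  suff -> : sg j.+1 x = 1 by rewrite subr_le0; case/andP: (sg01 j x).
  rewrite /sg /= jN spline_ge3// -(@ler_pM2l _ h)// mulrA divff ?gt_eqF// mul1r; lra.
exists (fun x => \sum_(j < N.+1) F (X j) * W j x); split.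
- apply: taylor3_sum => j; apply: taylor3Z; rewrite /W.
  have tsg k : taylor3 (sg k).
    rewrite /sg; case: k => [|k] /=; first exact: taylor3_cst.
    by case: (k < N)%N; [exact: taylor3_affine taylor3_spline|exact: taylor3_cst].
  have := taylor3D (tsg j) (taylor3Z (-1) (tsg j.+1)).
  by under eq_fun do rewrite mulN1r.
- move=> x; rewrite -[M]mulr1 -[X in M * X](WS x) mulr_sumr.
  apply: (le_trans (ler_norm_sum _ _ _)); apply: ler_sum => j _.
  by rewrite normrM (ger0_norm (W0 _ _)) ler_wpM2r.
- move=> x xA; rewrite -[F x]mulr1 -(WS x) mulr_sumr -sumrB.
  rewrite -[e]mulr1 -[X in e * X](WS x) mulr_sumr.
  apply: (le_trans (ler_norm_sum _ _ _)); apply: ler_sum => j _.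
  rewrite -mulrBl normrM (ger0_norm (W0 _ _)).
  have [->|Wn0] := eqVneq (W j x) 0; first by rewrite !mulr0.
  rewrite ler_wpM2r// ltW// distrC hF//; first by rewrite XA// -ltnS.
  apply: le_lt_trans h3; rewrite leNgt; apply/negP => /(Wz _ _ xA) Wj0.
  by rewrite Wj0 eqxx in Wn0.
Qed.

Lemma expectation_bmeas d (T : measurableType d) (P : probability T R) (f : T -> R) :
  bmeas f -> 'E_P[f]%E = (\int[P]_w f w)%:E.
Proof.
move=> bf; rewrite unlock /Rintegral fineK//.
exact: (integrable_fin_num measurableT (bmeas_integrable P bf)).
Qed.

(** A smoothed indicator of large [|x|], equal to 0 up to [k] and to 1 from [k + 3] on. Being itself
    an admissible test function, it extracts tightness from the convergence hypothesis. *)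
Definition tail_bump (k : nat) (x : R) : R :=
  1 - (spline (1 * (x - (- (k%:R + 3)))) - spline (1 * (x - k%:R))).

Lemma taylor3_tail_bump k : taylor3 (tail_bump k).
Proof.
have a c := taylor3_affine 1 c (@taylor3_spline R).
have := taylor3D (taylor3_cst 1) (taylor3D (taylor3Z (-1) (a (- (k%:R + 3)))) (a k%:R)).
rewrite (_ : (fun x => _) = tail_bump k)//; apply/funext => x; rewrite /tail_bump/=; ring.
Qed.

Lemma tail_bump_eq0 k x : `|x| <= k%:R -> tail_bump k x = 0.
Proof.
rewrite ler_norml => /andP[x1 x2]; rewrite /tail_bump spline_ge3; last lra.
by rewrite spline_le0; [ring|lra].
Qed.

Lemma tail_bump_ge0 k x : 0 <= tail_bump k x.
Proof.
rewrite /tail_bump.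
have := spline_ge0 (1 * (x - k%:R)); have := spline_le1 (1 * (x - (- (k%:R + 3)))); lra.
Qed.

Lemma tail_bump_eq1 k x : k%:R + 3 <= `|x| -> tail_bump k x = 1.
Proof.
have k0 : 0 <= k%:R :> R by [].
rewrite ler_normr => /orP[x1|x1]; rewrite /tail_bump.
  by rewrite !spline_ge3; [ring|lra|lra].
by rewrite !spline_le0; [ring|lra|lra].
Qed.

Lemma tail_bump_le1 k x : tail_bump k x <= 1.
Proof.
rewrite /tail_bump lerBlDl lerDr subr_ge0; apply: spline_homo; rewrite !mul1r.
by rewrite lerD2l lerN2 lerNl; have : 0 <= k%:R :> R by []; lra.
Qed.

Lemma cvg_tail_bump d (T : measurableType d) (Q : probability T R) (Z : T -> R) :
  measurable_fun setT Z -> \int[Q]_w tail_bump k (Z w) @[k --> \oo] --> 0.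
Proof.
move=> mZ; have bt k : bmeas (fun w => tail_bump k (Z w)).
  exact: (bmeas_comp (taylor3_tail_bump k).1 mZ).
have : (\int[Q]_w (tail_bump k (Z w))%:E)%E @[k --> \oo] --> (\int[Q]_w (cst 0%E w))%E.
  apply: (@dominated_cvg _ _ _ Q setT _ _ _ (cst 1%E)) => //.
  - by move=> k; apply/measurable_EFinP; case: (bt k).
  - move=> w _; apply: cvg_near_cst; exists (Num.truncn `|Z w|).+1 => // k /= hk.
    rewrite tail_bump_eq0// ltW//; apply: lt_le_trans (truncnS_gt _) _; by rewrite ler_nat.
  - exact: (bmeas_integrable Q (bmeas_cst 1)).
  - move=> k w _ /=; rewrite ger0_norm ?tail_bump_ge0// lee_fin; exact: tail_bump_le1.
rewrite integral0 => h; rewrite /Rintegral.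
exact: (fine_cvg h).
Qed.

(** Beyond [k + 3] the bump equals 1 and pays for the trivial bound [2 * M] on the difference. *)
Lemma Rintegral_approx_tail d (T : measurableType d) (P : probability T R) (Y : T -> R)
  (F g : RR -> R) (M e : R) k :
  measurable_fun setT Y -> bmeas F -> bmeas g ->
  (forall x, `|F x| <= M) -> (forall x, `|g x| <= M) -> 0 <= e ->
  (forall x, `|x| <= k%:R + 3 -> `|F x - g x| <= e) ->
  `|\int[P]_w F (Y w) - \int[P]_w g (Y w)| <= e + 2 * M * \int[P]_w tail_bump k (Y w).
Proof.
move=> mY bF bg FM gM e0 Fg.
have bt : bmeas (fun w => tail_bump k (Y w)) := bmeas_comp (taylor3_tail_bump k).1 mY.
have iF := bmeas_integrable P (bmeas_comp bF mY).
have ig := bmeas_integrable P (bmeas_comp bg mY).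
have bFg := bmeasB (bmeas_comp bF mY) (bmeas_comp bg mY).
rewrite -RintegralB//.
apply: (le_trans (le_normr_Rintegral measurableT (bmeas_integrable P bFg))).
rewrite -(Rintegral_prob_cst P e) -RintegralZl//; last exact: (bmeas_integrable P bt).
have bZ := bmeasZ (2 * M) bt.
rewrite -RintegralD//; last 2 first.
- exact: (bmeas_integrable P (bmeas_cst e)).
- exact: (bmeas_integrable P bZ).
apply: le_Rintegral => //.
- exact: (integrable_norm (bmeas_integrable P bFg)).
- exact: (bmeas_integrable P (bmeasD (bmeas_cst e) bZ)).
move=> w _ /=; have M0 : 0 <= M by apply: le_trans (FM 0).
have [Yk|/ltW Yk] := leP `|Y w| (k%:R + 3).
  by rewrite (le_trans (Fg _ Yk))// lerDl !mulr_ge0// tail_bump_ge0.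
rewrite tail_bump_eq1// mulr1; apply: (le_trans (ler_normB _ _)).
by have := FM (Y w); have := gM (Y w); lra.
Qed.

(** Measurability of [Y n] is asked only eventually, because the perturbed parameters may be out of
    range for small [n]. *)
Lemma cvg_in_law_taylor3 d d' (T : measurableType d) (T' : measurableType d')
  (P : probability T R) (Q : probability T' R) (Y : nat -> T -> R) (Z : T' -> R) :
  (\forall n \near \oo, measurable_fun setT (Y n)) -> measurable_fun setT Z ->
  (forall f, taylor3 f -> \int[P]_w f (Y n w) @[n --> \oo] --> \int[Q]_w f (Z w)) ->
  cvg_in_law P Y Q Z.
Proof.
move=> mY mZ cvf F cF [M FM].
have bF : bmeas (F : RR -> R) by split; [exact: continuous_measurable_fun|exists M].
rewrite (expectation_bmeas Q (bmeas_comp bF mZ)).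
have nE : \forall n \near \oo, 'E_P[F \o Y n]%E = (\int[P]_w F (Y n w))%:E.
  by apply: filterS mY => n mYn; rewrite (expectation_bmeas P (bmeas_comp bF mYn)).
apply: cvg_EFin; first by apply: filterS nE => n ->.
apply: (@cvg_trans _ (\int[P]_w F (Y n w) @[n --> \oo])).
  by apply: near_eq_cvg; apply: filterS nE => n /= ->.
apply/cvgrPdist_le => e e0.
pose M' := `|M| + 1; have M'0 : 0 < M' by rewrite ltr_pwDr.
have FM' x : `|F x| <= M' by rewrite (le_trans (FM x))// (le_trans (ler_norm M))// lerDl.
(* Error budget: three terms [e / 6], plus [e / 12] for the tail of [Z] and [e / 6] for the tail of
   [Y n], which is eventually at most twice that of [Z]; the total is [3 * e / 4]. *)
pose e1 := e / 6; pose e2 := e / (24 * M').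
have e10 : 0 < e1 by rewrite divr_gt0.
have e20 : 0 < e2 by rewrite divr_gt0// mulr_gt0.
have Me2 : 2 * M' * e2 = e / 12 by rewrite /e2; field; rewrite gt_eqF.
have [k Zk] : exists k, \int[Q]_w tail_bump k (Z w) <= e2.
  have /cvgrPdist_le /(_ _ e20) := cvg_tail_bump Q mZ.
  move=> /filter_ex[k]; rewrite sub0r normrN => h; exists k; exact: le_trans (ler_norm _) h.
have k0 : 0 < k%:R + 3 :> R by rewrite ltr_pwDr.
have [g [tg gM gF]] := taylor3_approx cF FM' k0 e10.
have /cvgrPdist_le /(_ _ e10) cg := cvf _ tg.
have /cvgrPdist_le /(_ _ e20) ct := cvf _ (taylor3_tail_bump k).
apply: filterS3 mY cg ct => n mYn cgn ctn.
have aY := Rintegral_approx_tail P mYn bF tg.1 FM' gM (ltW e10) gF.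
have aZ := Rintegral_approx_tail Q mZ bF tg.1 FM' gM (ltW e10) gF.
have tY : \int[P]_w tail_bump k (Y n w) <= 2 * e2.
  move: ctn; rewrite ler_norml => /andP[+ _]; move: Zk; lra.
have M20 : 0 <= 2 * M' by rewrite mulr_ge0// ltW.
have tY' := ler_wpM2l M20 tY; have tZ' := ler_wpM2l M20 Zk.
rewrite (mulrCA _ 2) Me2 in tY'; rewrite Me2 in tZ'.
move: aY aZ cgn tY' tZ'; rewrite /e1.
set a1 := \int[P]_w F _; set a2 := \int[P]_w g _; set a3 := \int[P]_w _.
set a4 := \int[Q]_w F _; set a5 := \int[Q]_w g _; set a6 := \int[Q]_w _.
rewrite !ler_norml => /andP[? ?] /andP[? ?] /andP[? ?] ? ?.
apply/andP; split; lra.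
Qed.

End weak_convergence.

(** * Independence of increments *)

Section independence.
Context {d} {T : measurableType d} {R : realType} (P : probability T R).
Notation RR := (measurableTypeR R).
Local Open Scope ereal_scope.

Lemma measure_unique_prod {d1 d2} {T1 : measurableType d1} {T2 : measurableType d2}
  (m1 m2 : measure (T1 * T2)%type R) : m1 setT < +oo ->
  (forall A B, measurable A -> measurable B -> m1 (A `*` B) = m2 (A `*` B)) ->
  forall X, measurable X -> m1 X = m2 X.
Proof.
move=> m1fin m12.
apply: (@measure_unique _ _ _
  [set A `*` B | A in measurable & B in measurable] (fun=> setT)).
- by rewrite measurable_prod_measurableType.
- move=> _ _ [A1 mA1 [B1 mB1 <-]] [A2 mA2 [B2 mB2 <-]].
  exists (A1 `&` A2); first exact: measurableI.
  by exists (B1 `&` B2); [exact: measurableI|rewrite setXI].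
- by move=> _; exists setT => //; exists setT => //; rewrite setXTT.
- by rewrite bigcup_const//; exists 0%N.
- by move=> _ [A mA [B mB <-]]; exact: m12.
- by [].
Qed.

(** As functions of [X] both sides are finite measures: the image of [P] restricted to [E1], and [c]
    times the image of [P] restricted to [E2]. Agreement on rectangles therefore extends to every
    measurable set. *)
Lemma pair_rect_extend {d1 d2} {T1 : measurableType d1} {T2 : measurableType d2}
  (W1 : T -> T1) (W2 : T -> T2) (E1 E2 : set T) (c : \bar R) :
  measurable_fun setT W1 -> measurable_fun setT W2 -> measurable E1 -> measurable E2 ->
  0 <= c -> c \is a fin_num ->
  (forall A B, measurable A -> measurable B ->
    P (W1 @^-1` A `&` W2 @^-1` B `&` E1) = P (W1 @^-1` A `&` W2 @^-1` B `&` E2) * c) ->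
  forall X, measurable X ->
    P ((fun w => (W1 w, W2 w)) @^-1` X `&` E1) =
    P ((fun w => (W1 w, W2 w)) @^-1` X `&` E2) * c.
Proof.
move=> mW1 mW2 mE1 mE2 c0 cfin rect X mX.
have mW : measurable_fun setT (fun w => (W1 w, W2 w)) by exact: measurable_fun_pair.
pose r : {nonneg R} := NngNum (fine_ge0 c0).
pose W w := (W1 w, W2 w).
pose n1 : measure (T1 * T2)%type R := pushforward (mrestr P mE1) W.
pose n2 : measure (T1 * T2)%type R := mscale r (pushforward (mrestr P mE2) W).
have cE : c = r%:num%:E by rewrite /= fineK.
rewrite muleC cE.
apply: (@measure_unique_prod _ _ _ _ (n1 mW) (n2 mW)) mX.
  rewrite /n1 /= /pushforward /mrestr preimage_setT setTI.
  by apply: (le_lt_trans (probability_le1 P mE1)); rewrite ltry.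
move=> A B mA mB; have := rect _ _ mA mB; rewrite muleC cE.
by [].
Qed.

Variables (n : nat) (U V : nat -> T -> RR) (phi : RR * RR -> RR).
Hypotheses (mU : forall i, measurable_fun setT (U i))
  (mV : forall i, measurable_fun setT (V i)) (mphi : measurable_fun setT phi).
Let Y (j : ('I_n + 'I_n)%type) : T -> R :=
  match j with inl i => U i | inr i => V i end.
Hypothesis indY : mutually_independent P Y.
Let zeta (k : nat) (w : T) : R := phi (U k w, V k w).
Let S (k : nat) (w : T) : R := (\sum_(j < k) zeta j w)%R.
Let idx (j : ('I_n + 'I_n)%type) : nat := match j with inl i => i | inr i => i end.

Let mY j : measurable_fun setT (Y j). Proof. by case: j => j; [exact: mU|exact: mV]. Qed.
Let mz k : measurable_fun setT (zeta k).
Proof. by apply: (measurableT_comp mphi); exact: measurable_fun_pair. Qed.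
Let mS k : measurable_fun setT (S k).
Proof. by apply: measurable_sum => j; exact: mz. Qed.

Let E (A : ('I_n + 'I_n)%type -> set R) := \bigcap_(i in [set: 'I_n + 'I_n]) (Y i @^-1` A i).

Let mE A : (forall i, measurable (A i)) -> measurable (E A).
Proof.
by move=> mA; apply: fin_bigcap_measurable => // i _; rewrite -[X in measurable X]setTI; exact: mY.
Qed.

(** The induction statement: a partial sum is independent of every cylinder event that leaves the
    increments already summed unconstrained. Keeping all later increments in the event is what makes
    the induction pass. *)
Let past k := forall (D : set R) A, measurable D -> (forall i, measurable (A i)) ->
  (forall i, (idx i < k)%N -> A i = setT) ->
  P (S k @^-1` D `&` E A) = P (S k @^-1` D) * P (E A).

Let upd (k : 'I_n) (B C : set R) (A : ('I_n + 'I_n)%type -> set R) i :=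
  if i == inl k then B else if i == inr k then C else A i.

Let E_upd k B C A : A (inl k) = setT -> A (inr k) = setT ->
  E (upd k B C A) = U k @^-1` B `&` V k @^-1` C `&` E A.
Proof.
move=> Al Ar; apply/seteqP; split => w /=.
  move=> h; split; first split.
  - by have := h (inl k) I; rewrite /upd eqxx.
  - by have := h (inr k) I; rewrite /upd eqxx.
  - move=> i _ /=; have := h i I; rewrite /upd.
    by case: eqP => [->|_]; [rewrite Al|case: eqP => [->|_]; [rewrite Ar|]].
move=> [[hB hC] h] i _ /=; rewrite /upd.
by case: eqP => [->//|_]; case: eqP => [->//|_]; exact: h.
Qed.

Let P_upd k B C A : measurable B -> measurable C -> (forall i, measurable (A i)) ->
  A (inl k) = setT -> A (inr k) = setT ->
  P (E (upd k B C A)) = P (U k @^-1` B) * P (V k @^-1` C) * P (E A).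
Proof.
move=> mB mC mA Al Ar.
have mu i : measurable (upd k B C A i) by rewrite /upd; case: ifP => // _; case: ifP.
rewrite /E !indY// (bigD1 (inl k))//= (bigD1 (inr k))//= [X in _ = _ * X](bigD1 (inl k))//=.
rewrite [X in _ = _ * (_ * X)](bigD1 (inr k))//=.
rewrite {1 2}/upd !eqxx Al Ar !preimage_setT !probability_setT !mul1e.
rewrite -muleA; congr (_ * (_ * _)); apply: eq_bigr => i /andP[/negbTE il /negbTE ir].
by rewrite /upd il ir.
Qed.

Let pastP k : (k <= n)%N -> past k.
Proof.
elim: k => [_ D A mD mA _|k IH kn D A mD mA A0].
  have -> : S 0 = cst 0%R by apply/funext => w; rewrite /S big_ord0.
  rewrite preimage_cst; case: ifP => _; last by rewrite set0I measure0 mul0e.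
  by rewrite setTI probability_setT mul1e.
pose k' := Ordinal kn.
have Al : A (inl k') = setT by exact: A0.
have Ar : A (inr k') = setT by exact: A0.
have fE X : measurable X -> P X \is a fin_num by move=> mX; exact: fin_num_measure.
have mpre (f : T -> R) X : measurable_fun setT f -> measurable X -> measurable (f @^-1` X).
  by move=> mf mX; rewrite -[X in measurable X]setTI; exact: mf.
have mEA := mE mA.
have mSk D' : measurable D' -> measurable (S k @^-1` D') by exact: mpre.
have A0' i : (idx i < k)%N -> A i = setT by move=> ik; apply: A0; exact: ltnW.
have updk B C A' i : (forall i, (idx i < k)%N -> A' i = setT) ->
    (idx i < k)%N -> upd k' B C A' i = setT.
  move=> A'0 ik; rewrite /upd; case: eqP => [e|_]; first by move: ik; rewrite e /= ltnn.
  case: eqP => [e|_]; first by move: ik; rewrite e /= ltnn.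
  exact: A'0.
have mupd B C A' i : measurable B -> measurable C -> (forall i, measurable (A' i)) ->
    measurable (upd k' B C A' i).
  by move=> ? ? ?; rewrite /upd; case: ifP => // _; case: ifP.
pose AT (i : ('I_n + 'I_n)%type) : set R := setT.
have mAT i : measurable (AT i) := measurableT.
have EAT : E AT = setT by rewrite /E; apply/seteqP; split.
(* The induction hypothesis is used twice, for [A] and for the trivial cylinder, both with the
   [k]-th pair constrained; dividing out the common factors isolates [P (E A)]. *)
have step1 D' B C : measurable D' -> measurable B -> measurable C ->
    P (U k @^-1` B `&` V k @^-1` C `&` (S k @^-1` D' `&` E A)) =
    P (U k @^-1` B `&` V k @^-1` C `&` S k @^-1` D') * P (E A).
  move=> mD' mB mC.
  have := IH (ltnW kn) D' (upd k' B C A) mD' (fun i => mupd B C A i mB mC mA)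
    (fun i => updk B C A i A0').
  rewrite P_upd// E_upd// setICA => ->.
  have := IH (ltnW kn) D' (upd k' B C AT) mD'
    (fun i => mupd B C AT i mB mC (fun=> measurableT)) (fun i => updk B C AT i (fun _ _ => erefl)).
  rewrite (@P_upd k' _ _ AT)//; rewrite (@E_upd k' _ _ AT)//; rewrite EAT setIT probability_setT mule1 setIC => ->.
  by rewrite muleA.
(* First extension: from rectangles to arbitrary sets for the [k]-th pair. *)
have step2 D' X : measurable D' -> measurable X ->
    P (S k @^-1` D' `&` (fun w => (U k w, V k w)) @^-1` X `&` E A) =
    P (S k @^-1` D' `&` (fun w => (U k w, V k w)) @^-1` X `&` setT) * P (E A).
  move=> mD' mX; rewrite -setIA setICA setIT [in RHS]setIC.
  apply: pair_rect_extend => //; [exact: measurableI (mSk _ mD') mEA|exact: mSk|exact: fE|].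
  by move=> B C mB mC; exact: step1.
have mUV : measurable_fun setT (fun w => (U k w, V k w)) by exact: measurable_fun_pair.
pose Phi (z : RR * (RR * RR)) : RR := (z.1 + phi z.2)%R.
have mPhi : measurable_fun setT Phi.
  by apply: measurable_funD => //; apply: (measurableT_comp mphi).
have -> : S k.+1 @^-1` D = (fun w => (S k w, (U k w, V k w))) @^-1` (Phi @^-1` D).
  by apply/seteqP; split => w /=; rewrite /S big_ord_recr.
(* Second extension: from rectangles to arbitrary sets for the partial sum joined with the pair,
   hence to the next partial sum, which is a function of both. *)
have := @pair_rect_extend _ _ _ _ (S k) (fun w => (U k w, V k w)) (E A) setT (P (E A)) (mS k) mUV
  mEA measurableT (measure_ge0 _ _) (fE _ mEA) step2 (Phi @^-1` D).
rewrite setIT; apply; rewrite -[X in measurable X]setTI; exact: mPhi.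
Qed.

Lemma indep_pair_now k B C : (k < n)%N -> measurable B -> measurable C ->
  P (U k @^-1` B `&` V k @^-1` C) = P (U k @^-1` B) * P (V k @^-1` C).
Proof.
move=> kn mB mC; pose k' := Ordinal kn; pose AT (i : ('I_n + 'I_n)%type) : set R := setT.
have mAT i : measurable (AT i) := measurableT.
have EAT : E AT = setT by rewrite /E; apply/seteqP; split.
have := @P_upd k' B C AT mB mC (fun=> measurableT) erefl erefl.
by rewrite E_upd// EAT setIT probability_setT mule1.
Qed.

Lemma indep_partial_sum k D B : (k < n)%N -> measurable D -> measurable B ->
  P (S k @^-1` D `&` zeta k @^-1` B) = P (S k @^-1` D) * P (zeta k @^-1` B).
Proof.
move=> kn mD mB; pose k' := Ordinal kn; pose AT (i : ('I_n + 'I_n)%type) : set R := setT.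
have mAT i : measurable (AT i) := measurableT.
have EAT : E AT = setT by rewrite /E; apply/seteqP; split.
have mSD : measurable (S k @^-1` D) by rewrite -[X in measurable X]setTI; exact: mS.
have := @pair_rect_extend _ _ _ _ (U k) (V k) (S k @^-1` D) setT (P (S k @^-1` D)) (mU k) (mV k)
  mSD measurableT (measure_ge0 _ _) _ _ (phi @^-1` B).
rewrite setIT setIC muleC; apply; first exact: fin_num_measure.
  move=> X Y' mX mY'.
  have mu i : measurable (upd k' X Y' AT i) by rewrite /upd; case: ifP => // _; case: ifP.
  have up0 i : (idx i < k)%N -> upd k' X Y' AT i = setT.
    move=> ik; rewrite /upd; case: eqP => [e|_]; first by move: ik; rewrite e /= ltnn.
    by case: eqP => [e|//]; move: ik; rewrite e /= ltnn.
  have := pastP (ltnW kn) mD mu up0.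
  rewrite (@P_upd k' _ _ AT)//; rewrite (@E_upd k' _ _ AT)//.
  by rewrite EAT !setIT probability_setT mule1 setIC indep_pair_now// => ->; rewrite muleC.
by rewrite -[X in measurable X]setTI; exact: mphi.
Qed.

End independence.

(** * Normal and Poisson integrals *)

Section normal_law.
Context {R : realType}.
Notation RR := (measurableTypeR R).
Notation leb := (@lebesgue_measure R).
Local Open Scope ereal_scope.

(** The rescaled image measure has the right value on half-open intervals, and these characterise
    Lebesgue measure. *)
Lemma lebesgue_measure_affine (a b : R) (A : set RR) : (0 < a)%R -> measurable A ->
  leb A = a%:E * leb [set x | (a * x + b)%R \in A].
Proof.
move=> a0 mA; pose F (x : RR) : RR := (a * x + b)%R.
have mF : measurable_fun setT F by apply: measurable_funD => //; exact: measurable_funM.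
pose r : {nonneg R} := NngNum (ltW a0).
pose m : measure RR R := mscale r (pushforward leb F).
have -> : [set x | (a * x + b)%R \in A] = F @^-1` A.
  by apply/seteqP; split => x /=; rewrite ?inE// => /set_mem.
rewrite -[RHS]/(m mF A); apply: lebesgue_measure_unique mA.
move=> X [[x y] _ <-]; rewrite /m/= /mscale/= /pushforward.
have -> : F @^-1` `]x, y] = `]((x - b) / a)%R, ((y - b) / a)%R]%classic.
  apply/seteqP; split => z /=; rewrite !in_itv/= /F.
    by move=> /andP[h1 h2]; rewrite ltr_pdivrMr// ler_pdivlMr// (mulrC z); apply/andP; split; lra.
  by rewrite ltr_pdivrMr// ler_pdivlMr// (mulrC z) => /andP[h1 h2]; apply/andP; split; lra.
rewrite !lebesgue_measure_itv/= !lte_fin ltr_pM2r ?invr_gt0// ltrD2r.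
case: ifP => _; last by rewrite mule0.
by rewrite -!EFinD -EFinM; congr EFin; field; rewrite gt_eqF.
Qed.

Lemma ge0_integral_affine (a b : R) (f : RR -> \bar R) : (0 < a)%R ->
  measurable_fun setT f -> (forall x, 0 <= f x) ->
  \int[leb]_x f x = a%:E * \int[leb]_x f (a * x + b)%R.
Proof.
move=> a0 mf f0; pose F (x : RR) : RR := (a * x + b)%R.
have mF : measurable_fun setT F by apply: measurable_funD => //; exact: measurable_funM.
pose r : {nonneg R} := NngNum (ltW a0).
pose m : measure RR R := mscale r (pushforward leb F).
have -> : \int[leb]_x f x = \int[m mF]_x f x.
  apply: eq_measure_integral => A mA _.
  apply: (etrans (lebesgue_measure_affine b a0 mA)).
  congr (_ * _); congr (leb _).
  by apply/seteqP; split => x /=; rewrite ?inE// => /set_mem.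
rewrite ge0_integral_mscale//=; congr (_ * _).
by rewrite ge0_integral_pushforward.
Qed.

(** The Radon-Nikodym derivative of the normal law and [normal_pdf] have the same integral over
    every measurable set, so they agree almost everywhere. *)
Lemma ge0_integral_normal_prob (m s : R) (f : RR -> \bar R) :
  measurable_fun setT f -> (forall x, 0 <= f x) ->
  \int[normal_prob m s]_x f x = \int[leb]_x (f x * (normal_pdf m s x)%:E).
Proof.
move=> mf f0.
rewrite -(@Radon_Nikodym_SigmaFinite.change_of_variables _ _ _ (normal_prob m s) leb)//; last exact: normal_prob_dominates.
apply: ae_eq_integral => //.
- apply: emeasurable_funM => //; apply: (measurable_int leb).
  by apply: Radon_Nikodym_SigmaFinite.f_integrable; exact: normal_prob_dominates.
- apply: emeasurable_funM => //; apply/measurable_EFinP; exact: measurable_normal_pdf.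
- apply: ae_eqe_mul2l => /=; apply: integral_ae_eq => //=.
  + apply: Radon_Nikodym_SigmaFinite.f_integrable; exact: normal_prob_dominates.
  + by apply/measurable_EFinP; exact: measurable_normal_pdf.
  + by move=> E _ mE; rewrite -Radon_Nikodym_SigmaFinite.f_integral//; exact: normal_prob_dominates.
Qed.

Lemma normal_pdf_affine (m s x : R) : (0 < s)%R ->
  (s * normal_pdf m s (s * x + m) = normal_pdf 0 1 x)%R.
Proof.
move=> s0; rewrite !normal_pdfE ?gt_eqF ?oner_eq0// /normal_peak /normal_fun.
rewrite addrK subr0 expr1n mul1r mulrA; congr (_ * _)%R.
  rewrite -mulrnAr sqrtrM ?sqr_ge0// sqrtr_sqr gtr0_norm// invfM mulrA divff ?mul1r//.
  by rewrite gt_eqF.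
by congr expR; field; rewrite gt_eqF.
Qed.

Lemma ge0_integral_normal_affine (m s : R) (f : RR -> \bar R) : (0 < s)%R ->
  measurable_fun setT f -> (forall x, 0 <= f x) ->
  \int[normal_prob m s]_x f x = \int[normal_prob 0 1]_x f (s * x + m)%R.
Proof.
move=> s0 mf f0.
have mF : measurable_fun setT (fun x : RR => (s * x + m)%R : RR).
  by apply: measurable_funD => //; exact: measurable_funM.
have mfF : measurable_fun setT (fun x : RR => f (s * x + m)%R) by exact: (measurableT_comp mf mF).
rewrite (ge0_integral_normal_prob m s mf f0).
rewrite (ge0_integral_normal_prob 0 1 mfF (fun x => f0 _)).
rewrite (ge0_integral_affine m s0); last 2 first.
- apply: emeasurable_funM => //; apply/measurable_EFinP; exact: measurable_normal_pdf.
- by move=> x; rewrite mule_ge0// lee_fin normal_pdf_ge0.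
rewrite -ge0_integralZl//; last 3 first.
- apply: emeasurable_funM; first exact: mfF.
  by apply/measurable_EFinP; exact: (measurableT_comp (measurable_normal_pdf m s) mF).
- by move=> x _; rewrite mule_ge0// lee_fin normal_pdf_ge0.
- by rewrite lee_fin ltW.
by apply: eq_integral => x _; rewrite muleCA -EFinM normal_pdf_affine.
Qed.

Lemma normal_prob_affine (m s : R) (A : set RR) : (0 < s)%R -> measurable A ->
  normal_prob m s A = normal_prob 0 1 ((fun x : RR => (s * x + m)%R : RR) @^-1` A).
Proof.
move=> s0 mA.
have mF : measurable_fun setT (fun x : RR => (s * x + m)%R : RR).
  by apply: measurable_funD => //; exact: measurable_funM.
have mFA : measurable ((fun x : RR => (s * x + m)%R : RR) @^-1` A).
  by rewrite -[X in measurable X]setTI; exact: mF.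
have -> : normal_prob m s A = \int[normal_prob m s]_x (\1_A x)%:E by rewrite integral_indic// setIT.
rewrite (ge0_integral_normal_affine _ s0)//.
  by rewrite -[X in _ = normal_prob 0 1 X]setIT -integral_indic.
by apply/measurable_EFinP; exact: measurable_indic.
Qed.

End normal_law.

(** * The Poisson-Gaussian law of one step *)

Section one_step_law.
Context {R : realType}.
Notation RR := (measurableTypeR R).
Local Open Scope ereal_scope.

Lemma ge0_integral_poisson_prob (mu : R) (f : nat -> \bar R) : (0 < mu)%R ->
  (forall m, 0 <= f m) ->
  \int[poisson_prob mu 0]_m f m = \sum_(m <oo) ((poisson_pmf mu m)%:E * f m).
Proof.
move=> mu0 f0.
have e : [set: nat] = \bigcup_k [set k] by apply/seteqP; split => // k _; exists k.
rewrite e ge0_integral_bigcup//=; last first.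
  by move=> i j _ _ [x [/= -> ->]].
apply: eq_eseriesr => k _.
rewrite (eq_integral (cst (f k))); last by move=> x; rewrite inE /= => ->.
rewrite integral_cst//= muleC; congr (_ * _).
by rewrite /poisson_prob mu0 esum_set1// lee_fin poisson_pmf_ge0.
Qed.

Definition step_law (mu : R) : probability (nat * RR)%type R :=
  (poisson_prob mu 0 \x normal_prob 0 1).

Lemma step_law_rect (mu : R) (A : set nat) (B : set RR) : measurable B ->
  step_law mu (A `*` B) = poisson_prob mu 0 A * normal_prob 0 1 B.
Proof. by move=> mB; exact: product_measure1E. Qed.

Lemma ge0_integral_step_law (mu : R) (f : nat * RR -> \bar R) : (0 < mu)%R ->
  measurable_fun setT f -> (forall z, 0 <= f z) ->
  \int[step_law mu]_z f z =
  \sum_(m <oo) ((poisson_pmf mu m)%:E * \int[normal_prob 0 1]_x f (m, x)).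
Proof.
move=> mu0 mf f0; rewrite /step_law fubini_tonelli1// ge0_integral_poisson_prob//.
by move=> m; apply: integral_ge0.
Qed.

Lemma measurable_natr : measurable_fun setT (fun m : nat => m%:R%R : RR).
Proof. by []. Qed.

Context {d} {T : measurableType d} (P : probability T R).

(** The Poisson law is assumed on singletons only; since [V] takes natural values, countable
    additivity gives it on all sets. *)
Lemma poisson_law_setE (V : T -> R) (mu : R) (B : set R) : (0 < mu)%R ->
  measurable_fun setT V -> (forall w, exists k : nat, V w = k%:R%R) ->
  has_poisson_law P V mu ->
  P (V @^-1` B) = poisson_prob mu 0 ((fun m : nat => m%:R%R : R) @^-1` B).
Proof.
move=> mu0 mV natV lawV; set D := (fun m : nat => m%:R%R : R) @^-1` B.
have -> : V @^-1` B = \bigcup_(m in D) V @^-1` [set m%:R%R].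
  apply/seteqP; split => w /=.
    by move=> Bw; have [k Vk] := natV w; exists k => //; rewrite /D /= -Vk.
  by move=> [k Dk /= ->].
rewrite measure_bigcup//; last 2 first.
- by move=> i _; rewrite -[X in measurable X]setTI; exact: mV.
- by move=> i j _ _ [w [/= -> /eqP]]; rewrite eqr_nat => /eqP.
rewrite /poisson_prob mu0 nneseries_esum//.
rewrite set_mem_set.
by apply: eq_esum => m _; exact: lawV.
Qed.

(** Transports every one-step computation to the fixed space of pairs [(M, xi)], with [M] kept as a
    natural number and [xi] standardised. *)
Lemma step_lawE (U V : T -> RR) (D mu : R) (C : set (RR * RR)) : (0 < D)%R -> (0 < mu)%R ->
  measurable_fun setT U -> measurable_fun setT V ->
  (forall w, exists k : nat, V w = k%:R%R) ->
  has_normal_law P U 0 D -> has_poisson_law P V mu ->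
  (forall A B, measurable A -> measurable B ->
    P (U @^-1` A `&` V @^-1` B) = P (U @^-1` A) * P (V @^-1` B)) ->
  measurable C ->
  P ((fun w => (U w, V w)) @^-1` C) =
  step_law mu ((fun z : nat * RR => ((Num.sqrt D * z.2)%R : RR, z.1%:R%R : RR)) @^-1` C).
Proof.
move=> D0 mu0 mU mV natV lawU lawV ind mC.
have mUV : measurable_fun setT (fun w => (U w, V w)) by exact: measurable_fun_pair.
pose g (z : nat * RR) : RR * RR := ((Num.sqrt D * z.2)%R, z.1%:R%R).
have mg : measurable_fun setT g.
  apply: measurable_fun_pair; first exact: measurable_funM.
  exact: (measurableT_comp measurable_natr).
pose m1 : measure (RR * RR)%type R := pushforward P (fun w => (U w, V w)).
pose m2 : measure (RR * RR)%type R := pushforward (step_law mu) g.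
apply: (measure_unique_prod (m1 := m1 mUV) (m2 := m2 mg)) => //.
  by rewrite /m1 /= /pushforward preimage_setT probability_setT ltry.
move=> A B mA mB; rewrite /m1 /m2 /= /pushforward.
rewrite [X in P X](_ : _ = U @^-1` A `&` V @^-1` B)// ind//.
rewrite [X in step_law _ X](_ : _ = ((fun m : nat => m%:R%R : RR) @^-1` B) `*`
   ((fun x : RR => (Num.sqrt D * x)%R : RR) @^-1` A)); last first.
  by apply/seteqP; split => -[m x] /= [].
have mDA : measurable ((fun x : RR => (Num.sqrt D * x)%R : RR) @^-1` A).
  rewrite -[X in measurable X]setTI.
  by apply: (_ : measurable_fun setT (fun x : RR => (Num.sqrt D * x)%R : RR)) => //; exact: measurable_funM.
rewrite step_law_rect// muleC; congr (_ * _); last first.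
  rewrite lawU// gt_eqF// normal_prob_affine ?sqrtr_gt0//.
  by congr (normal_prob _ _ _); apply/seteqP; split => x /=; rewrite addr0.
exact: poisson_law_setE.
Qed.

End one_step_law.

(** * Integrability bundled with the value of the integral *)

Section has_int.
Context {d} {T : measurableType d} {R : realType} (mu : measure T R).
Implicit Types (f g : T -> R) (v w c : R).

(** With both facts in one predicate, the integral of a polynomial expression is assembled from
    known moments, and [has_int_ext] leaves two identities for [ring]. *)
Definition has_int f v := mu.-integrable setT (EFin \o f) /\ \int[mu]_x f x = v.

Lemma has_int_ext f g v w : has_int f v -> f =1 g -> v = w -> has_int g w.
Proof. by move=> fv /funext <- <-. Qed.

Lemma has_intD f g v w : has_int f v -> has_int g w ->
  has_int (fun x => f x + g x) (v + w).
Proof.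
move=> [fi fv] [gi gw]; split; last by rewrite RintegralD// fv gw.
by have := integrableD measurableT fi gi.
Qed.

Lemma has_intB f g v w : has_int f v -> has_int g w ->
  has_int (fun x => f x - g x) (v - w).
Proof.
move=> [fi fv] [gi gw]; split; last by rewrite RintegralB// fv gw.
by have := integrableB measurableT fi gi.
Qed.

Lemma has_intZ c f v : has_int f v -> has_int (fun x => c * f x) (c * v).
Proof.
move=> [fi fv]; split; last by rewrite RintegralZl// fv.
by have := integrableZl measurableT c fi.
Qed.

Lemma has_int_ge0 f v : measurable_fun setT f -> (forall x, 0 <= f x) ->
  (\int[mu]_x (f x)%:E)%E = v%:E -> has_int f v.
Proof.
move=> mf f0 fv; split; last by rewrite /Rintegral fv.
apply/integrableP; split; first exact/measurable_EFinP.
by under eq_integral do rewrite /= ger0_norm//; rewrite fv ltry.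
Qed.

Lemma has_int_lty f : measurable_fun setT f -> (forall x, 0 <= f x) ->
  (\int[mu]_x (f x)%:E < +oo)%E -> has_int f (\int[mu]_x f x).
Proof.
move=> mf f0 fv; apply: has_int_ge0 => //; rewrite /Rintegral fineK// ge0_fin_numE//.
by apply: integral_ge0 => x _; rewrite lee_fin.
Qed.

Lemma has_intE f v : has_int f v -> (\int[mu]_x (f x)%:E)%E = v%:E.
Proof.
by move=> [fi <-]; rewrite /Rintegral fineK//; exact: (integrable_fin_num measurableT fi).
Qed.

Lemma has_int_le f g v w : has_int f v -> has_int g w -> (forall x, f x <= g x) -> v <= w.
Proof. by move=> [fi <-] [gi <-] fg; apply: le_Rintegral => // x _; exact: fg. Qed.

Lemma has_int_dom f g w : measurable_fun setT f -> (forall x, `|f x| <= g x) ->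
  has_int g w -> has_int f (\int[mu]_x f x).
Proof.
move=> mf fg [gi _]; split => //; apply: (le_integrable measurableT _ _ gi).
  exact/measurable_EFinP.
by move=> x _ /=; rewrite lee_fin (le_trans (fg x))// ler_norm.
Qed.

End has_int.

Lemma has_int_cst {d} {T : measurableType d} {R : realType} (P : probability T R) (c : R) :
  has_int P (fun=> c) c.
Proof. by split; [exact: (bmeas_integrable P (bmeas_cst c))|exact: Rintegral_prob_cst]. Qed.

(** * Poisson moments and the Poisson likelihood ratio *)

Section poisson_moments.
Context {R : realType}.
Implicit Types (mu rho : R) (g : nat -> R).

Lemma poisson_pmf_shift mu m : 0 < mu ->
  poisson_pmf mu m.+1 * m.+1%:R = mu * poisson_pmf mu m.
Proof.
move=> mu0; rewrite /poisson_pmf mu0 factS natrM exprS.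
have : m`!%:R != 0 :> R by rewrite pnatr_eq0 -lt0n fact_gt0.
have : m.+1%:R != 0 :> R by rewrite pnatr_eq0.
by move: m.+1%:R m`!%:R => a b a0 b0; field; rewrite a0 b0.
Qed.

(** The Stein-Chen identity: the factor [m] lowers the factorial and shifts the series by one. It
    yields all moments recursively. *)
Lemma has_int_poisson_mul mu g v : 0 < mu -> (forall m, 0 <= g m) ->
  has_int (poisson_prob mu 0) (fun m => g m.+1) v ->
  has_int (poisson_prob mu 0) (fun m => m%:R * g m) (mu * v).
Proof.
move=> mu0 g0 gv; apply: has_int_ge0 => //; first by move=> m; rewrite mulr_ge0.
rewrite ge0_integral_poisson_prob//; last by move=> m; rewrite lee_fin mulr_ge0.
rewrite EFinM -(has_intE gv) ge0_integral_poisson_prob//; last by move=> m; rewrite lee_fin.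
rewrite nneseries_recl//; last first.
  by move=> m _; rewrite -EFinM lee_fin !mulr_ge0// poisson_pmf_ge0.
rewrite !mul0r mule0 add0e -nneseriesZl; last first.
  by move=> m _; rewrite -EFinM lee_fin mulr_ge0// poisson_pmf_ge0.
rewrite -nneseries_addn; last first.
  by move=> m; rewrite -EFinM lee_fin !mulr_ge0// poisson_pmf_ge0.
apply: eq_eseriesr => m _; rewrite addn1 -!EFinM.
by congr EFin; rewrite [LHS]mulrA [RHS]mulrA -poisson_pmf_shift.
Qed.

(** The factor in front of [g] is the likelihood ratio of the intensities [mu * rho] and [mu], so
    this is a change of measure. *)
Lemma has_int_poisson_expn mu rho g v : 0 < mu -> 0 < rho -> (forall m, 0 <= g m) ->
  has_int (poisson_prob (mu * rho) 0) g v ->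
  has_int (poisson_prob mu 0) (fun m => expR (- (mu * (rho - 1))) * rho ^+ m * g m) v.
Proof.
move=> mu0 r0 g0 gv.
have h0 m : 0 <= expR (- (mu * (rho - 1))) * rho ^+ m * g m.
  by rewrite !mulr_ge0 ?expR_ge0// exprn_ge0// ltW.
apply: has_int_ge0 => //.
rewrite ge0_integral_poisson_prob// -(has_intE gv).
rewrite ge0_integral_poisson_prob// ?mulr_gt0//.
apply: eq_eseriesr => m _; rewrite -!EFinM; congr EFin.
rewrite /poisson_pmf mu0 mulr_gt0//.
rewrite (_ : - (mu * rho) = - (mu * (rho - 1)) + - mu); last by ring.
rewrite expRD exprMn; ring.
Qed.

Lemma has_int_poisson1 mu : 0 < mu -> has_int (poisson_prob mu 0) (fun m => m%:R) mu.
Proof.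
move=> mu0; have := has_int_poisson_mul mu0 (fun=> ler01) (has_int_cst _ 1).
by move=> /has_int_ext; apply => [m|]; rewrite mulr1.
Qed.

Lemma has_int_poisson2 mu : 0 < mu ->
  has_int (poisson_prob mu 0) (fun m => m%:R ^+ 2) (mu * (mu + 1)).
Proof.
move=> mu0; have : has_int (poisson_prob mu 0) (fun m => m.+1%:R) (mu + 1).
  by apply: has_int_ext (has_intD (has_int_poisson1 mu0) (has_int_cst _ 1)) _ _ => // m; rewrite natr1.
move=> /(has_int_poisson_mul (g := fun m => m%:R) mu0 (fun m => ler0n _ m)).
by move=> /has_int_ext; apply.
Qed.

Lemma has_int_poisson3 mu : 0 < mu ->
  has_int (poisson_prob mu 0) (fun m => m%:R ^+ 3) (mu * (mu * (mu + 1) + 2 * mu + 1)).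
Proof.
move=> mu0.
have : has_int (poisson_prob mu 0) (fun m => m.+1%:R ^+ 2) (mu * (mu + 1) + 2 * mu + 1).
  apply: has_int_ext (has_intD (has_intD (has_int_poisson2 mu0)
    (has_intZ 2 (has_int_poisson1 mu0))) (has_int_cst _ 1)) _ _ => // m.
  by rewrite -natr1; ring.
move=> /(has_int_poisson_mul (g := fun m => m%:R ^+ 2) mu0 (fun m => sqr_ge0 _)).
by move=> /has_int_ext; apply => // m; rewrite [RHS]exprS.
Qed.

(* The Poisson likelihood ratio against its linear score. *)
Lemma has_int_poisson_lr mu c : 0 < mu -> 0 < 1 + c ->
  has_int (poisson_prob mu 0)
    (fun m => (expR (- (mu * c)) * (1 + c) ^+ m - 1 - c * (m%:R - mu)) ^+ 2)
    (expR (c ^+ 2 * mu) - 1 - c ^+ 2 * mu).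
Proof.
move=> mu0 c0.
have e : 1 + c - 1 = c by ring.
have mu'0 : 0 < mu * (1 + c) by rewrite mulr_gt0.
pose r m := expR (- (mu * c)) * (1 + c) ^+ m.
have r0 m : 0 <= r m by rewrite mulr_ge0 ?expR_ge0// exprn_ge0// ltW.
have cm g v : (forall m, 0 <= g m) -> has_int (poisson_prob (mu * (1 + c)) 0) g v ->
    has_int (poisson_prob mu 0) (fun m => r m * g m) v.
  by move=> g0 gv; have := has_int_poisson_expn mu0 c0 g0 gv; rewrite e.
have h1 := cm _ _ (fun=> ler01) (has_int_cst _ 1).
have hm := cm _ _ (fun m => ler0n _ m) (has_int_poisson1 mu'0).
(* The second moment of the ratio is its mean under the alternative; there [r] is again a tilt of
   the same form, up to the factor [expR (c ^+ 2 * mu)]. *)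
have h2 : has_int (poisson_prob mu 0) (fun m => r m * r m) (expR (c ^+ 2 * mu)).
  apply: cm => //.
  have := has_int_poisson_expn mu'0 c0 (fun=> ler01) (has_int_cst _ 1).
  rewrite e => /(has_intZ (expR (c ^+ 2 * mu))) /has_int_ext; apply => [m|]; last by rewrite mulr1.
  rewrite /r !mulrA -expRD mulr1; congr (expR _ * _); ring.
have H := has_intD (has_intD (has_intD h2 (has_intZ (- (2 * (1 - c * mu))) h1)) (has_intZ (- (2 * c)) hm))
  (has_intD (has_intD (has_int_cst _ ((1 - c * mu) ^+ 2)) (has_intZ (2 * (1 - c * mu) * c) (has_int_poisson1 mu0)))
  (has_intZ (c ^+ 2) (has_int_poisson2 mu0))).
apply: has_int_ext H _ _; last by ring.
by move=> m; rewrite /r; ring.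
Qed.

End poisson_moments.

(** * Gaussian moments by integration by parts *)

Section gauss_moments.
Context {R : realType}.
Notation RR := (measurableTypeR R).
Notation leb := (@lebesgue_measure R).

Definition mono_gauss (k : nat) (x : R) : R := x ^+ k * expR (- (x ^+ 2 / 2)).

Lemma is_derive_mono_gauss (k : nat) (x : R) :
  is_derive x 1 (mono_gauss k) (k%:R * mono_gauss k.-1 x - mono_gauss k.+1 x).
Proof.
have d1 : is_derive x 1 (fun y : R => - (y ^+ 2 / 2)) (- x).
  have h := is_deriveN (is_deriveZ 2^-1 (is_deriveX 2 (is_derive_id x 1))).
  have -> : (fun y : R => - (y ^+ 2 / 2)) = - (2^-1 \*: id ^+ 2).
    apply/funext => y; rewrite -[RHS]/(- (2^-1 * (y ^+ 2))); ring.
  rewrite (_ : - x = - (2^-1 *: (2 * x ^+ 2.-1)%:A)) //.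
  by rewrite /GRing.scale /=; field.
have d2 := @is_derive1_comp _ expR (fun y : R => - (y ^+ 2 / 2)) x _ _ (is_derive_expR _) d1.
have d3 := is_deriveM (is_deriveX k (is_derive_id x 1)) d2.
have -> : mono_gauss k = (id ^+ k) * (expR \o (fun y : R => - (y ^+ 2 / 2))).
  by apply/funext => y; rewrite !fctE.
have ek : (id ^+ k : R -> R) x = x ^+ k by rewrite exprfctE.
rewrite (_ : _ - _ = (id ^+ k : R -> R) x *: (expR (- (x ^+ 2 / 2)) * - x) +
  (expR \o (fun y : R => - (y ^+ 2 / 2))) x *: (k%:R * x ^+ k.-1)%:A)//.
by rewrite ek /GRing.scale /= /mono_gauss [x ^+ k.+1]exprS; ring.
Qed.

Lemma continuous_mono_gauss k : continuous (mono_gauss k).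
Proof.
move=> x; apply/differentiable_continuous/derivable1_diffP.
exact: (@ex_derive _ _ _ _ _ _ _ (is_derive_mono_gauss k x)).
Qed.

Lemma measurable_mono_gauss k : measurable_fun setT (mono_gauss k : RR -> RR).
Proof. by apply: continuous_measurable_fun; exact: continuous_mono_gauss. Qed.

(** Half of the exponent absorbs the power: one term of the exponential series at [x ^+ 2 / 4]
    bounds [(x ^+ 2) ^+ k.+1], which is where [4 ^+ k.+1] and the factorial come from. The summand 1
    covers [|x| <= 1]. *)
Lemma mono_gauss_le k : exists C : R, forall x, `|mono_gauss k x| <= C * expR (- (x ^+ 2 / 4)).
Proof.
exists (1 + 4 ^+ k.+1 * (k.+1)`!%:R) => x.
have h := @expR_ge1Dxn R (x ^+ 2 / 4) k (divr_ge0 (sqr_ge0 x) (ler0n _ _)).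
rewrite /mono_gauss normrM normrX (ger0_norm (expR_ge0 _)).
rewrite (_ : - (x ^+ 2 / 2) = - (x ^+ 2 / 4) + - (x ^+ 2 / 4)); last by field.
rewrite expRD mulrA ler_wpM2r ?expR_ge0// expRN ler_pdivrMr ?expR_gt0//.
have f0 : 0 < (k.+1)`!%:R :> R by rewrite ltr0n fact_gt0.
have y0 : 0 <= x ^+ 2 / 4 by rewrite divr_ge0// sqr_ge0.
have xk : `|x| ^+ k <= 1 + (x ^+ 2) ^+ k.+1.
  have [x1|x1] := leP `|x| 1.
    apply: (@le_trans _ _ 1); first exact: exprn_ile1.
    by rewrite lerDl exprn_ge0// sqr_ge0.
  apply: (@le_trans _ _ (`|x| ^+ (2 * k.+1))).
    by rewrite ler_eXn2l// (leq_trans (leqnSn k))// leq_pmull.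
  by rewrite exprM real_normK ?num_real// lerDr.
apply: (le_trans xk); set E := expR _.
have E1 : 1 <= E by apply: le_trans h; rewrite lerDl divr_ge0// exprn_ge0.
have E2 : (x ^+ 2) ^+ k.+1 <= 4 ^+ k.+1 * (k.+1)`!%:R * E.
  have -> : (x ^+ 2) ^+ k.+1 = 4 ^+ k.+1 * (k.+1)`!%:R * ((x ^+ 2 / 4) ^+ k.+1 / (k.+1)`!%:R).
    rewrite expr_div_n; have : 4 ^+ k.+1 != 0 :> R by rewrite expf_neq0.
    have : (k.+1)`!%:R != 0 :> R by rewrite gt_eqF.
    by move: (4 ^+ k.+1 : R) ((k.+1)`!%:R : R) ((x ^+ 2) ^+ k.+1) => a b c b0 a0; field; rewrite a0 b0.
  by rewrite ler_wpM2l// ?mulr_ge0 ?exprn_ge0//; apply: le_trans h; rewrite lerDr.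
by rewrite mulrDl mul1r lerD.
Qed.

Lemma normal_pdf_std x : normal_pdf 0 1 x = (Num.sqrt (pi *+ 2))^-1 * mono_gauss 0 x :> R.
Proof.
rewrite normal_pdfE ?oner_eq0// /normal_peak /normal_fun /mono_gauss subr0 expr1n mul1r expr0 mul1r.
by rewrite mulNr.
Qed.

Lemma integrable_mono_gauss k : leb.-integrable setT (EFin \o mono_gauss k).
Proof.
have [C hC] := mono_gauss_le k.
have s2 : Num.sqrt 2 != 0 :> R by rewrite gt_eqF// sqrtr_gt0.
have e x : expR (- (x ^+ 2 / 4)) = (normal_peak (Num.sqrt 2))^-1 * normal_pdf 0 (Num.sqrt 2) x :> R.
  rewrite normal_pdfE// mulrA mulVf ?gt_eqF ?normal_peak_gt0// mul1r /normal_fun subr0 sqr_sqrtr//.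
  by congr expR; field.
have i2 := integrableZl measurableT (C / normal_peak (Num.sqrt 2)) (integrable_normal_pdf 0 (Num.sqrt 2 : R)).
apply: (le_integrable measurableT _ _ i2).
  by apply/measurable_EFinP; exact: measurable_mono_gauss.
move=> x _ /=; rewrite lee_fin (le_trans (hC x))// e mulrA; exact: ler_norm.
Qed.

Lemma cvg_mono_gauss k (s : R) : `|s| = 1 -> mono_gauss k (s * n%:R) @[n --> \oo] --> 0.
Proof.
move=> s1; have [C hC] := mono_gauss_le k.
have h : harmonic n @[n --> \oo] --> (0 : R) := cvg_harmonic.
apply: cvgr0_le (cvgr0Ml (`|C| * 4) h); exists 1%N => // n /= n1.
have n0 : 1 <= n%:R :> R by rewrite ler1n.
apply: (le_trans (hC _)); apply: (@le_trans _ _ (`|C| * expR (- ((s * n%:R) ^+ 2 / 4)))).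
  by rewrite ler_wpM2r ?expR_ge0// ler_norm.
rewrite -[leRHS]mulrA ler_wpM2l// /harmonic -[n.+1%:R]natr1.
rewrite -(real_normK (num_real (s * n%:R))) normrM s1 mul1r normr_nat expRN.
move: n0; set t : R := n%:R => n0.
have y1 := expR_ge1Dx (t ^+ 2 / 4).
rewrite ler_pdivlMr; last lra.
rewrite mulrC ler_pdivrMr ?expR_gt0//.
have : 0 <= t ^+ 2 by exact: sqr_ge0.
have : 0 <= (t - 1) ^+ 2 by exact: sqr_ge0.
by move: y1; set E := expR _; lra.
Qed.

(** The integrand is the derivative of [mono_gauss k], whose values vanish at both ends. Symmetric
    segments combine the fundamental theorem of calculus with dominated convergence. *)
Lemma Rintegral_mono_gauss_rec k :
  \int[leb]_x (k%:R * mono_gauss k.-1 x - mono_gauss k.+1 x) = 0.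
Proof.
pose f x := k%:R * mono_gauss k.-1 x - mono_gauss k.+1 x.
have cf : continuous f.
  by move=> x; apply: cvgB; [apply: cvgM; [exact: cvg_cst|]|]; exact: continuous_mono_gauss.
have fi : leb.-integrable setT (EFin \o f).
  have := integrableB measurableT
    (integrableZl measurableT (k%:R : R) (integrable_mono_gauss k.-1)) (integrable_mono_gauss k.+1).
  by [].
have dF x : derivable (mono_gauss k) x 1.
  exact: (@ex_derive _ _ _ _ _ _ _ (is_derive_mono_gauss k x)).
(* The bound [n.+1] keeps the segment nondegenerate already for [n = 0]. *)
have E n : (\int[leb]_(x in `[(- n.+1%:R)%R, n.+1%:R%R]) (f x)%:E)%E =
    (mono_gauss k n.+1%:R - mono_gauss k (- n.+1%:R))%:E.
  rewrite (@continuous_FTC2 _ f (mono_gauss k)) ?EFinB//.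
  - by rewrite (@lt_trans _ _ 0) ?ltr0n// oppr_lt0 ltr0n.
  - exact: continuous_subspaceT.
  - split => [x _|//|]; first exact: dF.
      apply: cvg_at_right_filter; exact: continuous_mono_gauss.
    apply: cvg_at_left_filter; exact: continuous_mono_gauss.
  - move=> x _; rewrite derive1E; exact: (@derive_val _ _ _ _ _ _ _ (is_derive_mono_gauss k x)).
have L1 : (\int[leb]_(x in `[(- n.+1%:R)%R, n.+1%:R%R]) (f x)%:E)%E @[n --> \oo] -->
    (\int[leb]_x (f x)%:E)%E.
  under eq_cvg do rewrite integral_mkcond.
  apply: (@dominated_cvg _ _ _ leb setT _ _ _ (fun x => `|f x|%:E)) => //.
  - by move=> n; apply/(measurable_restrictT _ _).1 => //; apply/measurable_EFinP; apply: measurable_funTS; exact: continuous_measurable_fun.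
  - move=> x _; apply: cvg_near_cst; exists (Num.truncn `|x|) => // n /= hn.
    rewrite patchE mem_set//= in_itv/= -ler_norml.
    by rewrite (le_trans (ltW (truncnS_gt _)))// ler_nat.
  - exact: (integrable_norm fi).
  - by move=> n x _; rewrite patchE; case: ifP => //= _; rewrite ?normr0 lee_fin.
have L0 : (\int[leb]_(x in `[(- n.+1%:R)%R, n.+1%:R%R]) (f x)%:E)%E @[n --> \oo] --> 0%:E.
  under eq_cvg do rewrite E.
  apply: cvg_EFin; first exact: nearW.
  have c1 : mono_gauss k (1 * n.+1%:R) @[n --> \oo] --> 0.
    have := @cvg_mono_gauss k 1 (normr1 _).
    by move=> /(cvg_comp _ _ (@cvg_addnr 1)); under [X in X -> _]eq_cvg do rewrite /= addn1; exact.
  have c2 : mono_gauss k ((- 1) * n.+1%:R) @[n --> \oo] --> 0.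
    have := @cvg_mono_gauss k (- 1) (normrN1 _).
    by move=> /(cvg_comp _ _ (@cvg_addnr 1)); under [X in X -> _]eq_cvg do rewrite /= addn1; exact.
  have := cvgr0D c1 (cvgr0Ml (- 1) c2).
  by under eq_cvg do rewrite /= mul1r !mulN1r; exact.
by rewrite /Rintegral (cvg_unique _ L1 L0).
Qed.

(** The passage to the density is available for nonnegative functions; positive and negative parts,
    both dominated by [|g|], extend it. *)
Lemma has_int_normal_pdf (m s : R) (g : RR -> R) : measurable_fun setT g ->
  leb.-integrable setT (EFin \o (fun x => g x * normal_pdf m s x)) ->
  has_int (normal_prob m s) g (\int[leb]_x (g x * normal_pdf m s x)).
Proof.
move=> mg gi.
have p0 x : 0 <= normal_pdf m s x by exact: normal_pdf_ge0.
have mp : measurable_fun setT (normal_pdf m s : RR -> R) by exact: measurable_normal_pdf.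
have part (h : RR -> R) : measurable_fun setT h -> (forall x, 0 <= h x <= `|g x|) ->
    has_int (normal_prob m s) h (\int[leb]_x (h x * normal_pdf m s x)) /\
    leb.-integrable setT (EFin \o (fun x => h x * normal_pdf m s x)).
  move=> mh h0.
  have hi : leb.-integrable setT (EFin \o (fun x => h x * normal_pdf m s x)).
    apply: (le_integrable measurableT _ _ gi).
      by apply/measurable_EFinP; exact: measurable_funM.
    move=> x _ /=; rewrite lee_fin !normrM ler_wpM2r//.
    by have /andP[? ?] := h0 x; rewrite ger0_norm.
  split => //; apply: has_int_ge0 => // [x|]; first by case/andP: (h0 x).
  rewrite ge0_integral_normal_prob; last 2 first.
  - exact/measurable_EFinP.
  - by move=> x; rewrite lee_fin; case/andP: (h0 x).
  by rewrite -(has_intE (conj hi erefl)); apply: eq_integral => x _.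
have [] := part (fun x => Num.max (g x) 0).
- exact: measurable_maxr.
- by move=> x; rewrite le_max lexx orbT ge_max ler_norm/=.
move=> a1 a2; have [] := part (fun x => Num.max (- g x) 0).
- by apply: measurable_maxr => //; exact: measurable_funN.
- by move=> x; rewrite le_max lexx orbT ge_max normr_ge0 andbT -normrN ler_norm.
move=> b1 b2; have e (x : RR) : Num.max (g x) 0 - Num.max (- g x) 0 = g x.
  by rewrite !maxEle; case: (leP (g x) 0) => ?; case: (leP (- g x) 0) => ?; lra.
apply: has_int_ext (has_intB a1 b1) (fun x => e x) _; rewrite -RintegralB//.
by apply: eq_Rintegral => x _; rewrite -mulrBl e.
Qed.

Definition gauss_moment (k : nat) : R := \int[normal_prob 0 1]_x (x ^+ k).

Lemma has_int_gauss_mono k : has_int (normal_prob 0 1) (fun x : RR => x ^+ k) (gauss_moment k) /\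
  gauss_moment k = (Num.sqrt (pi *+ 2))^-1 * \int[leb]_x mono_gauss k x.
Proof.
have e (x : R) : x ^+ k * normal_pdf 0 1 x = (Num.sqrt (pi *+ 2))^-1 * mono_gauss k x.
  by rewrite normal_pdf_std /mono_gauss expr0 mul1r mulrCA.
have i : leb.-integrable setT (EFin \o (fun x => x ^+ k * normal_pdf 0 1 x)).
  have := integrableZl measurableT ((Num.sqrt (pi *+ 2))^-1 : R) (integrable_mono_gauss k).
  have -> // : EFin \o (fun x : R => x ^+ k * normal_pdf 0 1 x) =
      (fun x => ((Num.sqrt (pi *+ 2))^-1%:E * (EFin \o mono_gauss k) x)%E).
  by apply/funext => x /=; rewrite e EFinM.
have mx : measurable_fun setT (fun x : RR => x ^+ k) by exact: measurable_funX.
have [h1 h2] := has_int_normal_pdf mx i; split; first by split.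
rewrite /gauss_moment h2 -RintegralZl//; last exact: integrable_mono_gauss.
by apply: eq_Rintegral => x _; exact: e.
Qed.

Lemma has_int_gauss k : has_int (normal_prob 0 1) (fun x : RR => x ^+ k) (gauss_moment k).
Proof. exact: (has_int_gauss_mono k).1. Qed.

Lemma gauss_moment_rec k : gauss_moment k.+1 = k%:R * gauss_moment k.-1.
Proof.
have ik := integrable_mono_gauss k.-1.
have /eqP : k%:R * \int[leb]_x mono_gauss k.-1 x - \int[leb]_x mono_gauss k.+1 x = 0.
  rewrite -[RHS](Rintegral_mono_gauss_rec k) RintegralB//; last 2 first.
  - by have := integrableZl measurableT (k%:R : R) ik.
  - exact: integrable_mono_gauss.
  by rewrite RintegralZl.
by rewrite subr_eq0 => /eqP h; rewrite !(has_int_gauss_mono _).2 -h mulrCA.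
Qed.

Lemma gauss_moment0 : gauss_moment 0 = 1.
Proof. by have [_ <-] := has_int_cst (normal_prob 0 1) (1 : R); apply: eq_Rintegral. Qed.

Lemma gauss_moment1 : gauss_moment 1 = 0. Proof. by rewrite gauss_moment_rec mul0r. Qed.
Lemma gauss_moment2 : gauss_moment 2 = 1.
Proof. by rewrite gauss_moment_rec gauss_moment0 mulr1. Qed.
Lemma gauss_moment3 : gauss_moment 3 = 0.
Proof. by rewrite gauss_moment_rec gauss_moment1 mulr0. Qed.
Lemma gauss_moment4 : gauss_moment 4 = 3.
Proof. by rewrite gauss_moment_rec gauss_moment2 mulr1. Qed.

End gauss_moments.

(** * The Gaussian likelihood ratio and its linear score *)

Section gauss_likelihood_ratio.
Context {R : realType}.
Notation RR := (measurableTypeR R).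
Implicit Types (m t e : R) (g : RR -> R).

(** The density of the normal law with mean [m] and standard deviation [t] relative to the standard
    normal law. *)
Definition gauss_lr m t (x : R) : R := t^-1 * expR (x ^+ 2 / 2 - (x - m) ^+ 2 / (2 * t ^+ 2)).

Lemma measurable_gauss_lr m t : measurable_fun setT (gauss_lr m t : RR -> R).
Proof.
apply: measurable_funM => //; apply: measurableT_comp => //.
apply: measurable_funB; first by apply: measurable_funM => //; exact: measurable_funX.
by apply: measurable_funM => //; apply: measurable_funX; exact: measurable_funB.
Qed.

Lemma gauss_lr_ge0 m t x : 0 < t -> 0 <= gauss_lr m t x.
Proof. by move=> t0; rewrite mulr_ge0 ?expR_ge0// invr_ge0 ltW. Qed.

Lemma gauss_lr_pdf m t x : 0 < t -> gauss_lr m t x * normal_pdf 0 1 x = normal_pdf m t x.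
Proof.
move=> t0; rewrite normal_pdf_std normal_pdfE ?gt_eqF// /normal_peak /normal_fun.
rewrite -mulrnAr sqrtrM ?sqr_ge0// sqrtr_sqr gtr0_norm// invfM.
rewrite /gauss_lr /mono_gauss expr0 mul1r.
rewrite (_ : - (x - m) ^+ 2 / (t ^+ 2 *+ 2) = x ^+ 2 / 2 - (x - m) ^+ 2 / (2 * t ^+ 2) + - (x ^+ 2 / 2)).
  by rewrite [in RHS]expRD; ring.
by field; rewrite gt_eqF.
Qed.

Lemma has_int_gauss_lr m t g v : 0 < t -> measurable_fun setT g -> (forall x, 0 <= g x) ->
  has_int (normal_prob 0 1) (fun x : RR => g (t * x + m)) v ->
  has_int (normal_prob 0 1) (fun x : RR => gauss_lr m t x * g x) v.
Proof.
move=> t0 mg g0 gv.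
have mr := measurable_gauss_lr m t.
apply: has_int_ge0; first exact: measurable_funM.
- by move=> x; rewrite mulr_ge0// gauss_lr_ge0.
rewrite -(has_intE gv).
rewrite -(@ge0_integral_normal_affine R m t (fun x => (g x)%:E) t0); last 2 first.
- exact/measurable_EFinP.
- by move=> x; rewrite lee_fin.
rewrite !ge0_integral_normal_prob.
- by apply: eq_integral => x _; rewrite -!EFinM mulrAC gauss_lr_pdf// mulrC.
- by apply/measurable_EFinP; exact: measurable_funM.
- by move=> x; rewrite lee_fin mulr_ge0// gauss_lr_ge0.
- exact/measurable_EFinP.
- by move=> x; rewrite lee_fin.
Qed.

(** One factor of the ratio changes the measure, and the other is then integrated under the
    alternative. The condition [t ^+ 2 < 2] is exactly square integrability. *)
Lemma has_int_gauss_lr_sqr m t : 0 < t -> t ^+ 2 < 2 ->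
  has_int (normal_prob 0 1) (fun x : RR => gauss_lr m t x ^+ 2)
    (expR (m ^+ 2 / (2 - t ^+ 2)) / (t * Num.sqrt (2 - t ^+ 2))).
Proof.
move=> t0 t2; have mr := measurable_gauss_lr m t.
pose a := 2 - t ^+ 2; have a0 : 0 < a by rewrite subr_gt0.
have s0 : 0 < Num.sqrt a by rewrite sqrtr_gt0.
have sa : Num.sqrt a ^+ 2 = a by rewrite sqr_sqrtr// ltW.
apply: (@has_int_ext _ _ _ _ (fun x : RR => gauss_lr m t x * gauss_lr m t x)) => [|//|//].
apply: has_int_gauss_lr => //; first by move=> x; exact: gauss_lr_ge0.
have mr' : measurable_fun setT (fun x : RR => gauss_lr m t (t * x + m) : RR).
  by apply: (measurableT_comp mr); apply: measurable_funD => //; exact: measurable_funM.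
pose K := expR (m ^+ 2 / a) / (t * Num.sqrt a).
have K0 : 0 <= K by rewrite divr_ge0 ?expR_ge0// mulr_ge0// ltW.
apply: has_int_ge0 => //; first by move=> x; exact: gauss_lr_ge0.
rewrite ge0_integral_normal_prob; last 2 first.
- exact/measurable_EFinP.
- by move=> x; rewrite lee_fin gauss_lr_ge0.
(* Completing the square: the product is a multiple of a normal density with variance
   [1 / (2 - t ^+ 2)]. *)
have e (x : R) : gauss_lr m t (t * x + m) * normal_pdf 0 1 x =
    K * normal_pdf (t * m / a) (Num.sqrt a)^-1 x.
  rewrite normal_pdf_std normal_pdfE ?invr_eq0 ?gt_eqF// /normal_peak /normal_fun.
  rewrite -mulrnAr sqrtrM ?sqr_ge0// sqrtr_sqr gtr0_norm ?invr_gt0// invfM invrK.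
  rewrite /gauss_lr /mono_gauss expr0 mul1r /K exprVn sa.
  pose A := m ^+ 2 / a; pose B := - (x - t * m / a) ^+ 2 / (a^-1 *+ 2).
  have -> : (t * x + m) ^+ 2 / 2 - (t * x + m - m) ^+ 2 / (2 * t ^+ 2) = (A + B) + x ^+ 2 / 2.
    rewrite /A /B; have : a != 0 by rewrite gt_eqF.
    have : t != 0 by rewrite gt_eqF.
    by rewrite /a => tn an; field; rewrite an tn.
  rewrite -/A -/B (expRD (A + B)) (expRD A) (expRN (x ^+ 2 / 2)).
  have En : expR (x ^+ 2 / 2) != 0 :> R by rewrite gt_eqF ?expR_gt0.
  have sn : Num.sqrt a != 0 by rewrite gt_eqF.
  have tn : t != 0 by rewrite gt_eqF.
  have pn : Num.sqrt (pi *+ 2) != 0 :> R.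
    by rewrite gt_eqF// sqrtr_gt0 mulrn_wgt0// pi_gt0.
  move: (expR A) (expR B) (expR _) (Num.sqrt a) (Num.sqrt _) En sn pn => E1 E2 E3 s1 s2 En sn pn.
  by field; rewrite tn En sn pn.
have pm (s : R) : measurable_fun setT (EFin \o (normal_pdf (t * m / a) s : RR -> R)).
  by apply/measurable_EFinP; exact: measurable_normal_pdf.
transitivity (\int[lebesgue_measure]_x (K%:E * (normal_pdf (t * m / a) (Num.sqrt a)^-1 x)%:E))%E.
  by apply: eq_integral => x _; rewrite -!EFinM e.
rewrite ge0_integralZl//; last by move=> x _; rewrite lee_fin normal_pdf_ge0.
  by rewrite integral_normal_pdf mule1.
exact: pm.
Qed.

(* The squared L2(N(0, 1)) distance between the density ratio of N(m, (1 + e)^2) to N(0, 1)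
   and 1 plus its linear score; the first term is the second moment of the ratio. *)
Definition gauss_lr_err (m e : R) : R :=
  expR (m ^+ 2 / (2 - (1 + e) ^+ 2)) / ((1 + e) * Num.sqrt (2 - (1 + e) ^+ 2))
  - 1 - m ^+ 2 - 2 * e ^+ 2 - 2 * e ^+ 3 - 2 * e * m ^+ 2.

Lemma has_int_gauss_lr_score m e : 0 < 1 + e -> (1 + e) ^+ 2 < 2 ->
  has_int (normal_prob 0 1)
    (fun x : RR => (gauss_lr m (1 + e) x - 1 - (m * x + e * (x ^+ 2 - 1))) ^+ 2)
    (gauss_lr_err m e).
Proof.
move=> t0 t2; set t := 1 + e.
have sq1 : measurable_fun setT (fun x : RR => x ^+ 2 : RR) by exact: measurable_funX.
have M k := has_int_gauss (R := R) k.
have h0 : has_int (normal_prob 0 1) (fun x : RR => gauss_lr m t x * 1) 1.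
  by apply: has_int_gauss_lr => //; exact: has_int_cst.
(* The change of measure is stated for nonnegative [g]; shifted squares keep to that case. *)
have hsq (c : R) : has_int (normal_prob 0 1) (fun x : RR => gauss_lr m t x * (x + c) ^+ 2)
    (t ^+ 2 + (m + c) ^+ 2).
  apply: has_int_gauss_lr => //.
  - by apply: measurable_funX; exact: measurable_funD.
  - by move=> x; exact: sqr_ge0.
  apply: has_int_ext (has_intD (has_intD (has_intZ (t ^+ 2) (M 2%N)) (has_intZ (2 * t * (m + c)) (M 1%N)))
    (has_int_cst _ ((m + c) ^+ 2))) _ _ => [x|]; first by ring.
  by rewrite gauss_moment1 gauss_moment2; ring.
have H1 := has_intB (has_int_gauss_lr_sqr m t0 t2) (has_intZ (2 * (1 - e)) h0).
have H2 := has_intB H1 (has_intZ (2 * e) (hsq 0)).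
(* The linear cross term is recovered from squares, as [(x + 1) ^+ 2 - x ^+ 2 - 1 = 2 * x]. *)
have H3 := has_intB H2 (has_intZ m (has_intB (has_intB (hsq 1) (hsq 0)) h0)).
have H4 := has_intD H3 (has_intZ ((1 - e) ^+ 2) (M 0%N)).
have H5 := has_intD H4 (has_intZ (2 * m * (1 - e)) (M 1%N)).
have H6 := has_intD H5 (has_intZ (m ^+ 2 + 2 * (1 - e) * e) (M 2%N)).
have H7 := has_intD H6 (has_intZ (2 * m * e) (M 3%N)).
have H8 := has_intD H7 (has_intZ (e ^+ 2) (M 4%N)).
apply: has_int_ext H8 _ _ => [x|].
  by ring.
rewrite gauss_moment0 gauss_moment1 gauss_moment2 gauss_moment3 gauss_moment4 /gauss_lr_err -/t.
by rewrite /t; ring.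
Qed.

End gauss_likelihood_ratio.

(** * The Gaussian score error is of third order *)

Section small_parameter_bounds.
Context {R : realType}.
Implicit Types (k m e y q : R).

(** From [expR (- k) >= 1 - k], and [(1 + k + 2 * k ^+ 2) * (1 - k) >= 1] on the given range. *)
Lemma expR_le_quadratic k : 0 <= k -> k <= 1 / 2 -> expR k <= 1 + k + 2 * k ^+ 2.
Proof.
move=> k0 k1; have h := expR_ge1Dx (- k).
have E0 : 0 < expR k by exact: expR_gt0.
have h1 : expR k * (1 - k) <= 1.
  by rewrite -[leRHS](mulfV (lt0r_neq0 E0)) -expRN ler_wpM2l// ltW.
have h2 : 1 <= (1 + k + 2 * k ^+ 2) * (1 - k).
  have -> : (1 + k + 2 * k ^+ 2) * (1 - k) = 1 + k ^+ 2 * (1 - 2 * k) by ring.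
  by rewrite lerDl mulr_ge0 ?sqr_ge0//; lra.
have k2 : 0 < 1 - k by lra.
by rewrite -(ler_pM2r k2) (le_trans h1).
Qed.

(** All second-order terms cancel and only third-order ones survive. An upper bound suffices, since
    the quantity is the integral of a square; the constant 40 leaves room, the collected terms
    adding up to less than 20. *)
Lemma gauss_lr_err_le m e y : `|m| <= y -> `|e| <= y -> y <= 1 / 8 ->
  gauss_lr_err m e <= 40 * y ^+ 3.
Proof.
move=> my ey y8.
have y0 : 0 <= y := le_trans (normr_ge0 _) my.
(* With [(1 + e) ^+ 2 = 1 + p], the exponent has denominator [1 - p], and the square of the
   normalising factor [s] is [(1 + p) * (1 - p) = 1 - q]. *)
pose p := 2 * e + e ^+ 2; pose q := p ^+ 2.
have a1 : 2 - (1 + e) ^+ 2 = 1 - p by rewrite /p; ring.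
have m2 : m ^+ 2 <= y ^+ 2 by rewrite -(real_normK (num_real m)) ler_sqr ?nnegrE.
have e2 : e ^+ 2 <= y ^+ 2 by rewrite -(real_normK (num_real e)) ler_sqr ?nnegrE.
have yy : y ^+ 2 <= y / 8 by rewrite expr2 ler_wpM2l// (le_trans y8)//; lra.
have py : `|p| <= 3 * y.
  rewrite (le_trans (ler_normD _ _))// normrM (ger0_norm (_ : 0 <= 2))// (ger0_norm (sqr_ge0 e)).
  by move: ey e2 yy; lra.
have [p1 p2] : - (3 * y) <= p /\ p <= 3 * y by move: py; rewrite ler_norml => /andP[].
have q0 : 0 <= q := sqr_ge0 p.
have qy : q <= 9 * y ^+ 2.
  by rewrite /q -(real_normK (num_real p)) (_ : 9 * y ^+ 2 = (3 * y) ^+ 2) ?ler_sqr ?nnegrE ?mulr_ge0//; ring.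
have q1 : q <= 1 / 2 by move: qy yy y8; lra.
pose a := 1 - p; have a0 : 0 < a by rewrite /a; lra.
pose k := m ^+ 2 / a.
have k0 : 0 <= k by rewrite divr_ge0 ?sqr_ge0// ltW.
have mk : k * a = m ^+ 2 by rewrite divfK// gt_eqF.
have y3 : y ^+ 3 = y * y ^+ 2 by rewrite exprS.
have y20 : 0 <= y ^+ 2 := sqr_ge0 y.
have k16 : k <= 8 / 5 * y ^+ 2.
  rewrite /k ler_pdivrMr//; apply: (le_trans m2).
  have a58 : 5 / 8 <= a by rewrite /a; lra.
  by have := ler_wpM2l y20 a58; lra.
have km : k <= m ^+ 2 + 24 / 5 * y ^+ 3.
  have -> : k = m ^+ 2 + k * p by rewrite -mk /a; ring.
  rewrite lerD2l (le_trans (ler_wpM2l k0 p2))// y3.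
  have := ler_wpM2r y0 k16; lra.
have k1 : k <= 1 / 2 by move: k16 yy y8; lra.
have E1 := expR_le_quadratic k0 k1.
pose s := (1 + e) * Num.sqrt (2 - (1 + e) ^+ 2).
have [e1 e3] : - y <= e /\ e <= y by move: ey; rewrite ler_norml => /andP[].
have s0 : 0 < s by rewrite mulr_gt0 ?sqrtr_gt0 ?a1//; lra.
have s2 : s ^+ 2 = 1 - q.
  by rewrite /s exprMn sqr_sqrtr ?a1 ?ltW// /q /p; ring.
have S1 : 1 <= (1 + q / 2 + q ^+ 2) * s.
  have X0 : 0 <= 1 + q / 2 + q ^+ 2 by rewrite !addr_ge0 ?sqr_ge0// divr_ge0.
  suff : 1 ^+ 2 <= ((1 + q / 2 + q ^+ 2) * s) ^+ 2.
    have Xs : 0 <= (1 + q / 2 + q ^+ 2) * s by rewrite mulr_ge0// ltW.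
    by apply: contraLR; rewrite -!ltNge => Xs1; rewrite expr1n expr_lt1.
  rewrite expr1n exprMn s2.
  rewrite (_ : _ ^+ 2 * (1 - q) = 1 + q ^+ 2 * (5 / 4 * (1 - q) - q ^+ 3)); last by field.
  rewrite lerDl mulr_ge0 ?sqr_ge0//.
  have : q ^+ 3 <= q ^+ 1 * (1 / 2) ^+ 2.
    by rewrite exprS expr1 ler_wpM2l// ler_sqr ?nnegrE//; lra.
  by rewrite expr1; move: q1 q0; lra.
have S2 : s^-1 <= 1 + q / 2 + q ^+ 2 by rewrite -[s^-1]mul1r ler_pdivrMr.
have V : gauss_lr_err m e <= (1 + k + 2 * k ^+ 2) * (1 + q / 2 + q ^+ 2)
    - 1 - m ^+ 2 - 2 * e ^+ 2 - 2 * e ^+ 3 - 2 * e * m ^+ 2.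
  rewrite /gauss_lr_err -/s a1 -/a -/k !lerD2r.
  by apply: ler_pM => //; rewrite invr_ge0 ltW.
apply: (le_trans V).
(* This expansion cancels the subtracted [2 * e ^+ 2] and [2 * e ^+ 3]. *)
have qe : q / 2 = 2 * e ^+ 2 + 2 * e ^+ 3 + e ^+ 4 / 2 by rewrite /q /p; field.
have y4 : y ^+ 2 * y ^+ 2 <= y ^+ 3 / 8.
  by have := ler_wpM2r y20 yy; rewrite y3; lra.
have e4 : e ^+ 4 <= y ^+ 3 / 8.
  rewrite (_ : e ^+ 4 = e ^+ 2 * e ^+ 2); last by rewrite -exprD.
  by apply: le_trans y4; apply: ler_pM => //; exact: sqr_ge0.
have k2 : k ^+ 2 <= 64 / 25 * (y ^+ 3 / 8).
  rewrite expr2 (le_trans (ler_pM k0 k0 k16 k16))//.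
  by rewrite mulrACA; have := y4; lra.
have q2 : q ^+ 2 <= 81 * (y ^+ 3 / 8).
  rewrite expr2 (le_trans (ler_pM q0 q0 qy qy))//.
  by rewrite mulrACA; have := y4; lra.
have em : - (2 * e * m ^+ 2) <= 2 * y ^+ 3.
  have A1 : - e * m ^+ 2 <= y * m ^+ 2 by rewrite ler_wpM2r ?sqr_ge0//; lra.
  have A2 : y * m ^+ 2 <= y * y ^+ 2 by rewrite ler_wpM2l.
  by rewrite y3; lra.
have y30 : 0 <= y ^+ 3 by rewrite exprn_ge0.
have y31 : y ^+ 3 <= y ^+ 2 / 8 by have := ler_wpM2r y20 y8; rewrite y3; lra.
have cross : (k + 2 * k ^+ 2) * (q / 2 + q ^+ 2) <= 2 * y ^+ 3.
  have A : k + 2 * k ^+ 2 <= 2 * y ^+ 2 by move: k16 k2 y31; lra.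
  have B : q / 2 + q ^+ 2 <= 6 * y ^+ 2 by move: qy q2 y31; lra.
  have A0 : 0 <= k + 2 * k ^+ 2 by rewrite addr_ge0// mulr_ge0// sqr_ge0.
  have B0 : 0 <= q / 2 + q ^+ 2 by rewrite addr_ge0 ?sqr_ge0// divr_ge0.
  rewrite (le_trans (ler_pM A0 B0 A B))// mulrACA.
  by move: y4 y30; lra.
rewrite (_ : (1 + k + 2 * k ^+ 2) * _ = 1 + k + 2 * k ^+ 2 + q / 2 + q ^+ 2 +
  (k + 2 * k ^+ 2) * (q / 2 + q ^+ 2)); last by ring.
move: km k2 q2 em cross e4 y30; rewrite qe; set K2 := k ^+ 2.
move: (_ * (_ + q ^+ 2)) => CR.
lra.
Qed.

End small_parameter_bounds.

(** * The one-step score *)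

Section step_integrals.
Context {R : realType}.
Notation RR := (measurableTypeR R).
Variable mu : R.
Hypothesis mu0 : 0 < mu.
Notation J := (step_law mu).
Notation Pi := (poisson_prob mu 0).
Notation N01 := (normal_prob (0 : R) 1).

Lemma measurable_step_fst (f : nat -> R) : measurable_fun setT (fun z : nat * RR => f z.1).
Proof. by apply: (@measurableT_comp _ _ _ _ _ _ f). Qed.

Lemma measurable_step_snd (g : RR -> R) : measurable_fun setT g ->
  measurable_fun setT (fun z : nat * RR => g z.2).
Proof. by move=> mg; exact: (measurableT_comp mg). Qed.

Lemma has_int_step_prod_ge0 (f : nat -> R) (g : RR -> R) (a b : R) :
  measurable_fun setT g -> (forall m, 0 <= f m) -> (forall x, 0 <= g x) ->
  has_int Pi f a -> has_int N01 g b ->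
  has_int J (fun z : nat * RR => f z.1 * g z.2) (a * b).
Proof.
move=> mg f0 g0 fa gb.
have mfg : measurable_fun setT (fun z : nat * RR => f z.1 * g z.2).
  by apply: measurable_funM; [exact: measurable_step_fst|exact: measurable_step_snd].
apply: has_int_ge0 => //; first by move=> z; rewrite mulr_ge0.
rewrite ge0_integral_step_law//; last 2 first.
- exact/measurable_EFinP.
- by move=> z; rewrite lee_fin mulr_ge0.
rewrite EFinM -(has_intE fa) ge0_integral_poisson_prob//.
rewrite muleC -nneseriesZl; last first.
  by move=> m _; rewrite -EFinM lee_fin mulr_ge0// poisson_pmf_ge0.
apply: eq_eseriesr => m _.
rewrite [RHS]muleCA; congr (_ * _)%E => /=.
under eq_integral do rewrite EFinM.
rewrite ge0_integralZl//; last 3 first.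
- exact/measurable_EFinP.
- by move=> x _; rewrite lee_fin.
- by rewrite lee_fin.
by rewrite muleC (has_intE gb).
Qed.

Lemma has_int_posneg {d} {T : measurableType d} (m : measure T R) (f : T -> R) v :
  measurable_fun setT f -> has_int m f v ->
  exists a b, [/\ has_int m (fun x => Num.max (f x) 0) a,
    has_int m (fun x => Num.max (- f x) 0) b & v = a - b].
Proof.
move=> mf [fi fv].
have ni := integrable_norm fi.
have h1 : has_int m (fun x => Num.max (f x) 0) (\int[m]_x Num.max (f x) 0).
  apply: (has_int_dom _ _ (conj ni erefl)); first exact: measurable_maxr.
  by move=> x /=; rewrite ger0_norm ?le_max ?lexx ?orbT// ge_max ler_norm/=.
have h2 : has_int m (fun x => Num.max (- f x) 0) (\int[m]_x Num.max (- f x) 0).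
  apply: (has_int_dom _ _ (conj ni erefl)).
    by apply: measurable_maxr => //; exact: measurable_funN.
  by move=> x /=; rewrite ger0_norm ?le_max ?lexx ?orbT// ge_max normr_ge0 andbT -normrN ler_norm.
exists (\int[m]_x Num.max (f x) 0), (\int[m]_x Num.max (- f x) 0); split => //.
have [_ <-] := has_intB h1 h2; rewrite -fv; apply: eq_Rintegral => x _.
by rewrite !maxEle; case: (leP (f x) 0) => ?; case: (leP (- f x) 0) => ?; lra.
Qed.

(** Splitting both factors into positive and negative parts reduces to four nonnegative products. *)
Lemma has_int_step_prod (f : nat -> R) (g : RR -> R) (a b : R) :
  measurable_fun setT g -> has_int Pi f a -> has_int N01 g b ->
  has_int J (fun z : nat * RR => f z.1 * g z.2) (a * b).
Proof.
move=> mg fa gb.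
have [a1 [a2 [fa1 fa2 ->]]] := has_int_posneg (m := Pi) (f := f) (fun _ _ _ => I) fa.
have [b1 [b2 [gb1 gb2 ->]]] := has_int_posneg mg gb.
have max0 (x : R) : 0 <= Num.max x 0 by rewrite le_max lexx orbT.
have mg1 : measurable_fun setT (fun x : RR => Num.max (g x) 0) by exact: measurable_maxr.
have mg2 : measurable_fun setT (fun x : RR => Num.max (- g x) 0).
  by apply: measurable_maxr => //; exact: measurable_funN.
have P f' g' a' b' mg' f0' g0' fa' gb' := @has_int_step_prod_ge0 f' g' a' b' mg' f0' g0' fa' gb'.
have h11 := P _ _ _ _ mg1 (fun=> max0 _) (fun=> max0 _) fa1 gb1.
have h12 := P _ _ _ _ mg2 (fun=> max0 _) (fun=> max0 _) fa1 gb2.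
have h21 := P _ _ _ _ mg1 (fun=> max0 _) (fun=> max0 _) fa2 gb1.
have h22 := P _ _ _ _ mg2 (fun=> max0 _) (fun=> max0 _) fa2 gb2.
apply: has_int_ext (has_intD (has_intB (has_intB h11 h12) h21) h22) _ _ => [z|]; last by ring.
have e (x : R) : x = Num.max x 0 - Num.max (- x) 0.
  by rewrite !maxEle; case: (leP x 0) => ?; case: (leP (- x) 0) => ?; lra.
by rewrite [in RHS](e (f z.1)) [in RHS](e (g z.2)); ring.
Qed.

Lemma has_int_step_fst (f : nat -> R) a : has_int Pi f a ->
  has_int J (fun z : nat * RR => f z.1) a.
Proof.
move=> fa; apply: has_int_ext (has_int_step_prod (g := fun=> 1) _ fa (has_int_cst _ 1)) _ _ => //.
  by move=> z; rewrite mulr1.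
by rewrite mulr1.
Qed.

Lemma has_int_step_snd (g : RR -> R) b : measurable_fun setT g -> has_int N01 g b ->
  has_int J (fun z : nat * RR => g z.2) b.
Proof.
move=> mg gb; apply: has_int_ext (has_int_step_prod mg (has_int_cst _ 1) gb) _ _ => //.
  by move=> z; rewrite mul1r.
by rewrite mul1r.
Qed.

Variables m e c : R.

Definition score (z : nat * RR) : R := m * z.2 + e * (z.2 ^+ 2 - 1) + c * (z.1%:R - mu).

Definition full_lr (z : nat * RR) : R :=
  expR (- (mu * c)) * (1 + c) ^+ z.1 * gauss_lr m (1 + e) z.2.

Lemma measurable_score : measurable_fun setT score.
Proof.
apply: measurable_funD; first apply: measurable_funD.
- exact: measurable_funM.
- by apply: measurable_funM => //; apply: measurable_funB => //; exact: measurable_funX.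
- by apply: (measurable_step_fst (fun k => c * (k%:R - mu))).
Qed.

Lemma measurable_full_lr : measurable_fun setT full_lr.
Proof.
apply: measurable_funM; first exact: (measurable_step_fst (fun k => expR (- (mu * c)) * (1 + c) ^+ k)).
by apply: measurable_step_snd; exact: measurable_gauss_lr.
Qed.

Let gscore (x : RR) : R := m * x + e * (x ^+ 2 - 1).
Let mgscore : measurable_fun setT gscore.
Proof.
by apply: measurable_funD; apply: measurable_funM => //; exact: measurable_funB.
Qed.
Let pscore (k : nat) : R := c * (k%:R - mu).

Let has_int_gscore : has_int N01 gscore 0.
Proof.
have M k := has_int_gauss (R := R) k.
apply: has_int_ext (has_intD (has_intZ m (M 1%N)) (has_intZ e (has_intB (M 2%N) (has_int_cst _ 1)))) _ _ => //.
by rewrite gauss_moment1 gauss_moment2; ring.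
Qed.

Let has_int_gscore_sqr : has_int N01 (fun x => gscore x ^+ 2) (m ^+ 2 + 2 * e ^+ 2).
Proof.
have M k := has_int_gauss (R := R) k.
have H1 := has_intD (has_intZ (e ^+ 2) (M 0%N)) (has_intZ (- (2 * m * e)) (M 1%N)).
have H2 := has_intD H1 (has_intZ (m ^+ 2 - 2 * e ^+ 2) (M 2%N)).
have H3 := has_intD H2 (has_intD (has_intZ (2 * m * e) (M 3%N)) (has_intZ (e ^+ 2) (M 4%N))).
apply: has_int_ext H3 _ _ => [x|]; first by rewrite /gscore; ring.
by rewrite gauss_moment0 gauss_moment1 gauss_moment2 gauss_moment3 gauss_moment4; ring.
Qed.

Let has_int_pscore : has_int Pi pscore 0.
Proof.
apply: has_int_ext (has_intZ c (has_intB (has_int_poisson1 mu0) (has_int_cst _ mu))) _ _ => //.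
by rewrite subrr mulr0.
Qed.

Let has_int_pscore_sqr : has_int Pi (fun k => pscore k ^+ 2) (c ^+ 2 * mu).
Proof.
have H := has_intD (has_intD (has_int_poisson2 mu0) (has_intZ (- (2 * mu)) (has_int_poisson1 mu0)))
  (has_int_cst _ (mu ^+ 2)).
by apply: has_int_ext (has_intZ (c ^+ 2) H) _ _ => [k|]; rewrite /pscore; ring.
Qed.

(** The three components of the score are centred and mutually orthogonal, with variances 1, 2 and
    [mu]; no cross terms remain. *)
Lemma has_int_score_sqr : has_int J (fun z => score z ^+ 2) (m ^+ 2 + 2 * e ^+ 2 + c ^+ 2 * mu).
Proof.
have msq : measurable_fun setT (fun x : RR => gscore x ^+ 2) by exact: measurable_funX.
have H := has_intD (has_intD (has_int_step_snd msq has_int_gscore_sqr)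
  (has_int_step_fst has_int_pscore_sqr)) (has_intZ 2 (has_int_step_prod mgscore has_int_pscore has_int_gscore)).
by apply: has_int_ext H _ _ => [z|]; rewrite /score /gscore /pscore; ring.
Qed.

Lemma cube_addn_le (a b d : R) : 0 <= a -> 0 <= b -> 0 <= d ->
  (a + b + d) ^+ 3 <= 9 * (a ^+ 3 + b ^+ 3 + d ^+ 3).
Proof.
move=> a0 b0 d0.
suff H (x y : R) : 0 <= x -> 0 <= y -> (x - y) ^+ 2 * (x + y) >= 0.
  have := H a b a0 b0; have := H a d a0 d0; have := H b d b0 d0.
  have := mulr_ge0 a0 (sqr_ge0 (b - d)); have := mulr_ge0 b0 (sqr_ge0 (a - d)).
  have := mulr_ge0 d0 (sqr_ge0 (a - b)).
  lra.
by move=> x0 y0; rewrite mulr_ge0 ?sqr_ge0 ?addr_ge0.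
Qed.

Lemma cube_subn_le (a b : R) : 0 <= a -> 0 <= b -> `|a - b| ^+ 3 <= a ^+ 3 + b ^+ 3.
Proof.
move=> a0 b0; have [ab|/ltW ab] := leP a b.
  rewrite (@le_trans _ _ (b ^+ 3))//; last by rewrite lerDr exprn_ge0.
  by rewrite lerXn2r ?nnegrE// ler0_norm; lra.
rewrite (@le_trans _ _ (a ^+ 3))//; last by rewrite lerDl exprn_ge0.
by rewrite lerXn2r ?nnegrE// ger0_norm; lra.
Qed.

(** Built from [|x| ^+ 3 <= 1 + x ^+ 4], [|x ^+ 2 - 1| ^+ 3 <= 1 + x ^+ 6] and
    [|k - mu| ^+ 3 <= k ^+ 3 + mu ^+ 3], which avoid odd absolute moments; 9 is the power-mean
    constant for three summands. The sixth moment stays symbolic, since only its finiteness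
    matters. *)
Definition score_cube_bound : R :=
  9 * (4 * `|m| ^+ 3 + (1 + gauss_moment 6) * `|e| ^+ 3 +
    `|c| ^+ 3 * (mu * (mu * (mu + 1) + 2 * mu + 1) + mu ^+ 3)).

Lemma score_cube_le : exists2 g : nat * RR -> R,
  has_int J g score_cube_bound & forall z, `|score z| ^+ 3 <= g z.
Proof.
have M k := has_int_gauss (R := R) k.
have mX k : measurable_fun setT (fun x : RR => x ^+ k : R) by exact: measurable_funX.
have S k := has_int_step_snd (mX k) (M k).
have P3 := has_int_step_fst (has_intD (has_int_poisson3 mu0) (has_int_cst _ (mu ^+ 3))).
have H := has_intZ 9 (has_intD (has_intD (has_intZ (`|m| ^+ 3) (has_intD (S 0%N) (S 4%N)))
  (has_intZ (`|e| ^+ 3) (has_intD (S 0%N) (S 6%N)))) (has_intZ (`|c| ^+ 3) P3)).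
exists (fun z => 9 * (`|m| ^+ 3 * (1 + z.2 ^+ 4) + `|e| ^+ 3 * (1 + z.2 ^+ 6) +
    `|c| ^+ 3 * (z.1%:R ^+ 3 + mu ^+ 3))).
  apply: has_int_ext H _ _ => [z|]; first by rewrite expr0.
  by rewrite gauss_moment0 gauss_moment4 /score_cube_bound; ring.
move=> z; rewrite /score.
have tri : `|m * z.2 + e * (z.2 ^+ 2 - 1) + c * (z.1%:R - mu)| <=
    `|m| * `|z.2| + `|e| * `|z.2 ^+ 2 - 1| + `|c| * `|z.1%:R - mu|.
  by rewrite -!normrM !(le_trans (ler_normD _ _))// lerD2r ler_normD.
have r0 : 0 <= `|m| * `|z.2| + `|e| * `|z.2 ^+ 2 - 1| + `|c| * `|z.1%:R - mu|.
  exact: le_trans tri.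
apply: (@le_trans _ _ ((`|m| * `|z.2| + `|e| * `|z.2 ^+ 2 - 1| + `|c| * `|z.1%:R - mu|) ^+ 3)).
  by rewrite lerXn2r ?nnegrE.
apply: (le_trans (cube_addn_le _ _ _)); rewrite ?mulr_ge0// ler_wpM2l// !exprMn.
apply: lerD; last by rewrite ler_wpM2l ?exprn_ge0// cube_subn_le// ltW.
apply: lerD; rewrite ler_wpM2l ?exprn_ge0//.
  have := sqr_ge0 (`|z.2| ^+ 2 - `|z.2|); have := sqr_ge0 (`|z.2| ^+ 2 - 1).
  rewrite -[z.2 ^+ 4]/(z.2 ^+ (2 * 2)) exprM -(real_normK (num_real z.2)).
  by set a := `|z.2|; have := sqr_ge0 (a ^+ 2); lra.
rewrite (le_trans (cube_subn_le _ _))// ?sqr_ge0// expr1n addrC lerD2l -exprM//.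
Qed.

Definition full_lr_bound : R :=
  let kp := expR (c ^+ 2 * mu) - 1 - c ^+ 2 * mu in
  3 * (kp + gauss_lr_err m e +
    (2 * kp + 2 * (c ^+ 2 * mu)) * (2 * gauss_lr_err m e + 2 * (m ^+ 2 + 2 * e ^+ 2))).

Lemma sqr_addn_le2 (a b : R) : (a + b) ^+ 2 <= 2 * a ^+ 2 + 2 * b ^+ 2.
Proof. by have := sqr_ge0 (a - b); lra. Qed.

Lemma sqr_addn_le3 (a b d : R) : (a + b + d) ^+ 2 <= 3 * (a ^+ 2 + b ^+ 2 + d ^+ 2).
Proof.
by have := sqr_ge0 (a - b); have := sqr_ge0 (a - d); have := sqr_ge0 (b - d); lra.
Qed.

Lemma full_lr_score_le : 0 < 1 + c -> 0 < 1 + e -> (1 + e) ^+ 2 < 2 ->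
  exists2 g : nat * RR -> R, has_int J g full_lr_bound &
    forall z, (full_lr z - 1 - score z) ^+ 2 <= g z.
Proof.
move=> c0 e0 e2.
have HP := has_int_poisson_lr mu0 c0.
have HG := has_int_gauss_lr_score m e0 e2.
pose fP k : R := (expR (- (mu * c)) * (1 + c) ^+ k - 1 - pscore k) ^+ 2.
pose fG x : R := (gauss_lr m (1 + e) x - 1 - gscore x) ^+ 2.
have mfG : measurable_fun setT (fG : RR -> R).
  apply: measurable_funX; apply: measurable_funB => //; apply: measurable_funB => //.
  exact: measurable_gauss_lr.
have HP' := has_intD (has_intZ 2 HP) (has_intZ 2 has_int_pscore_sqr).
have HG' := has_intD (has_intZ 2 HG) (has_intZ 2 has_int_gscore_sqr).
have mG' : measurable_fun setT (fun x : RR => 2 * fG x + 2 * gscore x ^+ 2).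
  by apply: measurable_funD; apply: measurable_funM => //; exact: measurable_funX.
have H := has_intZ 3 (has_intD (has_intD (has_int_step_fst HP) (has_int_step_snd mfG HG))
  (has_int_step_prod mG' HP' HG')).
exists (fun z => 3 * (fP z.1 + fG z.2 +
    (2 * fP z.1 + 2 * pscore z.1 ^+ 2) * (2 * fG z.2 + 2 * gscore z.2 ^+ 2))).
  exact: has_int_ext H _ _.
move=> z; rewrite /full_lr.
set rP := expR _ * _ ^+ _; set rG := gauss_lr _ _ _.
(* Two marginal errors and a product of independent deviations; the second moment of the product
   factors and is of higher order. *)
have -> : rP * rG - 1 - score z = (rP - 1 - pscore z.1) + (rG - 1 - gscore z.2) + (rP - 1) * (rG - 1).
  by rewrite /score /pscore /gscore; ring.
apply: (le_trans (sqr_addn_le3 _ _ _)); rewrite ler_wpM2l// lerD2l exprMn.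
have A : (rP - 1) ^+ 2 <= 2 * fP z.1 + 2 * pscore z.1 ^+ 2.
  by rewrite -[rP - 1](subrK (pscore z.1)) sqr_addn_le2.
have B : (rG - 1) ^+ 2 <= 2 * fG z.2 + 2 * gscore z.2 ^+ 2.
  by rewrite -[rG - 1](subrK (gscore z.2)) sqr_addn_le2.
by apply: ler_pM => //; exact: sqr_ge0.
Qed.

Definition round (y : R) : R := (Num.floor (y + 1 / 2))%:~R.

(* [y] is the centered observed increment [s * xi + M]: rounding recovers [M] unless
   [|s * xi| >= 1 / 2]. *)
Definition score_est (s y : R) : R :=
  m * ((y - round y) / s) + e * (((y - round y) / s) ^+ 2 - 1) + c * (round y - mu).

Lemma measurable_round : measurable_fun setT (round : RR -> R).
Proof.
apply: nondecreasing_measurable => // x y xy; rewrite /round ler_int.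
by apply: le_floor; rewrite lerD2r.
Qed.

Lemma measurable_score_est s : measurable_fun setT (score_est s : RR -> R).
Proof.
have mr := measurable_round.
have mb : measurable_fun setT (fun y : RR => (y - round y) / s).
  by apply: measurable_funM => //; exact: measurable_funB.
apply: measurable_funD; first apply: measurable_funD; apply: measurable_funM => //.
  by apply: measurable_funB => //; exact: measurable_funX.
exact: measurable_funB.
Qed.

Lemma round_itv (y : R) : - (1 / 2) <= y - round y /\ y - round y < 1 / 2.
Proof.
rewrite /round; have /andP[] := floor_itv (y + 1 / 2).
by rewrite intrD; lra.
Qed.

Lemma roundDn (y : R) (k : nat) : round (y + k%:R) = round y + k%:R.
Proof.
rewrite /round (_ : y + k%:R + 1 / 2 = (y + 1 / 2) + (k%:Z)%:~R); last by rewrite -pmulrn; ring.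
rewrite floorDrz; last exact: intr_int.
by rewrite intrD (floorK (intr_int _ _)) -pmulrn.
Qed.

Lemma round_eq0 (y : R) : `|y| < 1 / 2 -> round y = 0.
Proof.
rewrite ltr_norml => /andP[y1 y2]; rewrite /round (_ : Num.floor _ = 0)//.
by apply/floor_def; rewrite /= ; apply/andP; split; lra.
Qed.

(** Six is the least even exponent that works: dividing [(s * x) ^+ 6] by the [s ^+ 4] of the
    quadratic component still leaves [s ^+ 2], whereas a fourth power would leave nothing to make
    that term vanish. *)
Definition score_est_bound (s : R) : R :=
  3 * (64 * m ^+ 2 * s ^+ 4 + 4 * e ^+ 2 * s ^+ 2 + 64 * c ^+ 2 * s ^+ 6) * gauss_moment 6.

Lemma score_est_le s : 0 < s -> exists2 g : nat * RR -> R, has_int J g (score_est_bound s) &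
  forall z, (score z - score_est s (s * z.2 + z.1%:R)) ^+ 2 <= g z.
Proof.
move=> s0; pose C := 3 * (64 * m ^+ 2 * s ^+ 4 + 4 * e ^+ 2 * s ^+ 2 + 64 * c ^+ 2 * s ^+ 6).
have m6 : measurable_fun setT (fun x : RR => x ^+ 6 : R) by exact: measurable_funX.
exists (fun z => C * z.2 ^+ 6).
  exact: has_intZ (has_int_step_snd m6 (has_int_gauss 6)).
move=> [k x] /=; rewrite /score /score_est /= roundDn.
set b := s * x; set r := round b.
have sn : s != 0 by rewrite gt_eqF.
have -> : m * x + e * (x ^+ 2 - 1) + c * (k%:R - mu) -
    (m * ((b + k%:R - (r + k%:R)) / s) + e * (((b + k%:R - (r + k%:R)) / s) ^+ 2 - 1) +
    c * (r + k%:R - mu)) = m * (r / s) + e * ((b ^+ 2 - (b - r) ^+ 2) / s ^+ 2) + - c * r.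
  by rewrite /b; field.
have x6 : 0 <= x ^+ 6 by rewrite -[6%N]/(2 * 3)%N exprM exprn_ge0 ?sqr_ge0.
have C0 : 0 <= C.
  have sk k' : 0 <= s ^+ k' by rewrite exprn_ge0// ltW.
  rewrite /C; apply: mulr_ge0 => //.
  by apply: addr_ge0; first apply: addr_ge0;
    (apply: mulr_ge0; [apply: mulr_ge0 => //; exact: sqr_ge0|exact: sk]).
(* If the Gaussian part is below one half, rounding recovers [M] and the error is zero. *)
have [b12|b12] := ltP `|b| (1 / 2).
  rewrite /r round_eq0// !mul0r subr0 subrr mul0r !mulr0 !addr0 expr0n /=.
  by rewrite mulr_ge0.
have [r1 r2] := round_itv b; rewrite -/r in r1 r2.
set a := `|b| in b12; have a0 : 0 <= a by exact: normr_ge0.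
have bE : b ^+ 2 = a ^+ 2 by rewrite /a real_normK ?num_real.
have [ba1 ba2] : - a <= b /\ b <= a by have := lexx a; rewrite {1}/a ler_norml => /andP[].
(* The rounded value satisfies [|r| <= |b| + 1 / 2 <= 2 * a], as [a >= 1 / 2] in this case. *)
have A1 : r ^+ 2 <= 4 * a ^+ 2.
  rewrite (_ : 4 * a ^+ 2 = (2 * a) ^+ 2); last by ring.
  rewrite -(real_normK (num_real r)) ler_sqr ?nnegrE ?mulr_ge0// ler_norml; lra.
have A2 : (b - r) ^+ 2 <= a ^+ 2.
  rewrite -(real_normK (num_real (b - r))) ler_sqr ?nnegrE// ler_norml; lra.
have A3 : (b ^+ 2 - (b - r) ^+ 2) ^+ 2 <= a ^+ 4.
  rewrite (_ : a ^+ 4 = (a ^+ 2) ^+ 2); last by rewrite -exprM.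
  rewrite ler_sqr ?nnegrE ?sqr_ge0//.
    by rewrite bE lerBlDr lerDl sqr_ge0.
  by rewrite subr_ge0 bE.
have a2 : 1 / 4 <= a ^+ 2 by rewrite (_ : 1 / 4 = (1 / 2) ^+ 2) ?ler_sqr ?nnegrE//; lra.
have a6 : a ^+ 6 = s ^+ 6 * x ^+ 6.
  by rewrite -exprMn -/b -[6%N]/(2 * 3)%N !exprM bE.
(* The Chebyshev step: [a ^+ 2 >= 1 / 4] raises lower powers to the sixth. *)
have B1 : a ^+ 4 <= 4 * a ^+ 6.
  rewrite (_ : a ^+ 6 = a ^+ 4 * a ^+ 2); last by rewrite -exprD.
  by have := ler_wpM2l (exprn_ge0 4 a0) a2; lra.
have B2 : a ^+ 2 <= 16 * a ^+ 6.
  have : a ^+ 2 <= 4 * a ^+ 4.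
    rewrite (_ : a ^+ 4 = a ^+ 2 * a ^+ 2); last by rewrite -exprD.
    by have := ler_wpM2l (exprn_ge0 2 a0) a2; lra.
  by move: B1; lra.
apply: (le_trans (sqr_addn_le3 _ _ _)).
rewrite /C -mulrA ler_wpM2l//.
rewrite [leRHS](_ : _ = 64 * m ^+ 2 * s ^+ 4 * x ^+ 6 + 4 * e ^+ 2 * s ^+ 2 * x ^+ 6
  + 64 * c ^+ 2 * s ^+ 6 * x ^+ 6); last by ring.
have si (j : nat) : 0 <= s^-1 ^+ j by rewrite exprn_ge0// invr_ge0 ltW.
apply: lerD; first apply: lerD.
- apply: (@le_trans _ _ (m ^+ 2 * (64 * a ^+ 6 * s^-1 ^+ 2))).
    rewrite exprMn (exprMn _ r) ler_wpM2l ?sqr_ge0// ler_wpM2r//; move: A1 B2; lra.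
  by rewrite a6 le_eqVlt; apply/orP; left; apply/eqP; field.
- apply: (@le_trans _ _ (e ^+ 2 * (4 * a ^+ 6 * (s ^+ 2)^-1 ^+ 2))).
    rewrite exprMn (exprMn _ (b ^+ 2 - _)) ler_wpM2l ?sqr_ge0// ler_wpM2r ?sqr_ge0//.
    exact: le_trans A3 B1.
  by rewrite a6 le_eqVlt; apply/orP; left; apply/eqP; field.
- apply: (@le_trans _ _ (c ^+ 2 * (64 * a ^+ 6))).
    rewrite exprMn sqrrN ler_wpM2l ?sqr_ge0//; move: A1 B2; lra.
  by rewrite a6 le_eqVlt; apply/orP; left; apply/eqP; ring.
Qed.

End step_integrals.

(** * The observed likelihood ratio *)

Lemma measurable_nat_prod {d d'} {T : measurableType d} {T' : measurableType d'}
  (f : nat * T -> T') : (forall k, measurable_fun setT (fun x => f (k, x))) ->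
  measurable_fun setT f.
Proof.
move=> mf _ B mB; rewrite setTI.
have -> : f @^-1` B = \bigcup_k ([set k] `*` ((fun x => f (k, x)) @^-1` B)).
  apply/seteqP; split => [[k x] fB|[k x] [j _ [/= -> //]]]; by exists k.
apply: bigcup_measurable => k _; apply: measurableX => //.
by rewrite -[X in measurable X]setTI; exact: mf.
Qed.

Section mixture_density.
Context {R : realType}.
Notation RR := (measurableTypeR R).
Notation leb := (@lebesgue_measure R).
Implicit Types (mu a s z : R).

(** The joint density of [M] and of the increment at [(k, z)]; summing over [k] gives the marginal
    density [mix_dens]. *)
Definition mix_term mu a s z (k : nat) : R := poisson_pmf mu k * normal_pdf (a + k%:R) s z.

Definition mix_dens mu a s z : R := limn (series (mix_term mu a s z)).

Lemma mix_term_ge0 mu a s z k : 0 <= mix_term mu a s z k.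
Proof. by rewrite mulr_ge0 ?poisson_pmf_ge0 ?normal_pdf_ge0. Qed.

Lemma poisson_pmf_gt0 mu k : 0 < mu -> 0 < poisson_pmf mu k.
Proof. by move=> mu0; rewrite /poisson_pmf mu0 !mulr_gt0 ?exprn_gt0 ?invr_gt0 ?ltr0n ?fact_gt0 ?expR_gt0. Qed.

Lemma normal_pdf_gt0 a s z : 0 < s -> 0 < normal_pdf a s z.
Proof.
by move=> s0; rewrite normal_pdfE ?gt_eqF// mulr_gt0 ?expR_gt0// normal_peak_gt0 ?gt_eqF.
Qed.

Lemma mix_term_gt0 mu a s z k : 0 < mu -> 0 < s -> 0 < mix_term mu a s z k.
Proof. by move=> mu0 s0; rewrite mulr_gt0 ?poisson_pmf_gt0 ?normal_pdf_gt0. Qed.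

Lemma is_cvg_mix_term mu a s z : 0 < mu -> 0 < s -> cvgn (series (mix_term mu a s z)).
Proof.
move=> mu0 s0.
apply: (@series_le_cvg _ _ (fun k => (expR (- mu) * normal_peak s) * exp_coeff mu k)).
- exact: mix_term_ge0.
- move=> k; apply: mulr_ge0; first by rewrite mulr_ge0 ?expR_ge0 ?normal_peak_ge0.
  by rewrite exp_coeff_ge0// ltW.
- move=> k; rewrite /mix_term /poisson_pmf mu0.
  have := @normal_pdf_ub R (a + k%:R) s z; rewrite gt_eqF// => /(_ isT) ub.
  rewrite (le_trans (ler_wpM2l _ ub))//.
    by rewrite !mulr_ge0 ?expR_ge0 ?exprn_ge0 ?ltW// invr_gt0 ltr0n fact_gt0.
  by rewrite /exp_coeff /= le_eqVlt; apply/orP; left; apply/eqP; ring.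
- have -> : series (fun k => expR (- mu) * normal_peak s * exp_coeff mu k) =
    (fun n => (expR (- mu) * normal_peak s) * series (exp_coeff mu) n).
    by apply/funext => n; rewrite /series /= mulr_sumr.
  by apply: is_cvgM; [exact: is_cvg_cst|exact: is_cvg_series_exp_coeff].
Qed.

Lemma nneseries_mix_term mu a s z : 0 < mu -> 0 < s ->
  (\sum_(k <oo) (mix_term mu a s z k)%:E)%E = (mix_dens mu a s z)%:E.
Proof.
move=> mu0 s0; rewrite /mix_dens -EFin_lim; last exact: is_cvg_mix_term.
by apply/congr_lim/funext => n /=; rewrite /series /= -sumEFin.
Qed.

Lemma mix_dens_gt0 mu a s z : 0 < mu -> 0 < s -> 0 < mix_dens mu a s z.
Proof.
move=> mu0 s0; apply: (lt_le_trans (mix_term_gt0 a z 0 mu0 s0)).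
have := nondecreasing_cvgn_le _ (is_cvg_mix_term (a := a) (z := z) mu0 s0) 1%N.
rewrite /series /= big_nat1; apply.
apply/nondecreasing_seqP => n; rewrite big_nat_recr//= lerDl.
exact: mix_term_ge0.
Qed.

Lemma measurable_mix_term mu a s k : measurable_fun setT (fun z : RR => mix_term mu a s z k).
Proof. by apply: measurable_funM => //; exact: measurable_normal_pdf. Qed.

Lemma measurable_mix_dens mu a s : 0 < mu -> 0 < s ->
  measurable_fun setT (mix_dens mu a s : RR -> R).
Proof.
move=> mu0 s0; apply/measurable_EFinP.
apply: (eq_measurable_fun (fun z : RR => \sum_(k <oo) (mix_term mu a s z k)%:E)%E).
  by move=> z _; rewrite nneseries_mix_term.
apply: ge0_emeasurable_sum => [k z _ _|k _]; first by rewrite lee_fin mix_term_ge0.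
by apply/measurable_EFinP; exact: measurable_mix_term.
Qed.

Variables (mu a s : R).
Hypotheses (mu0 : 0 < mu) (s0 : 0 < s).
Notation J := (step_law mu).

Definition obs (w : nat * RR) : RR := s * w.2 + (a + w.1%:R).

Lemma measurable_obs : measurable_fun setT obs.
Proof.
apply: measurable_funD; last exact: (measurable_step_fst (fun k => a + k%:R)).
by apply: measurable_funM.
Qed.

Lemma ge0_integral_obs (F : nat -> RR -> \bar R) :
  (forall k, measurable_fun setT (F k)) -> (forall k z, 0 <= F k z)%E ->
  measurable_fun setT (fun w : nat * RR => F w.1 (obs w)) ->
  (\int[J]_w F w.1 (obs w) =
   \int[leb]_z \sum_(k <oo) (F k z * (mix_term mu a s z k)%:E))%E.
Proof.
move=> mF F0 mF'.
rewrite ge0_integral_step_law//.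
rewrite integral_nneseries//; last 2 first.
- move=> k; apply: emeasurable_funM => //; apply/measurable_EFinP; exact: measurable_mix_term.
- by move=> k z _; rewrite mule_ge0// lee_fin mix_term_ge0.
apply: eq_eseriesr => k _ /=.
rewrite /obs /= -(@ge0_integral_normal_affine R (a + k%:R) s (F k) s0 (mF k) (F0 k)).
rewrite ge0_integral_normal_prob// -ge0_integralZl//; last 3 first.
- apply: emeasurable_funM => //; apply/measurable_EFinP; exact: measurable_normal_pdf.
- by move=> z _; rewrite mule_ge0// lee_fin normal_pdf_ge0.
- by rewrite lee_fin poisson_pmf_ge0.
by apply: eq_integral => z _; rewrite /mix_term muleCA -EFinM.
Qed.

Variables (mu' a' s' : R).
Hypotheses (mu'0 : 0 < mu') (s'0 : 0 < s').

Definition obs_lr (z : R) : R := mix_dens mu' a' s' z / mix_dens mu a s z.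

Lemma measurable_obs_lr : measurable_fun setT (obs_lr : RR -> R).
Proof.
apply: measurable_funM; first exact: measurable_mix_dens.
have m := measurable_mix_dens a mu0 s0.
rewrite (_ : (fun z : RR => _) = (fun x : R => x `^ (-1)) \o mix_dens mu a s).
  by apply: (measurableT_comp _ m); exact: measurable_powR.
by apply/funext => z /=; rewrite powR_inv1// ltW// mix_dens_gt0.
Qed.

Lemma obs_lr_gt0 z : 0 < obs_lr z. Proof. by rewrite divr_gt0 ?mix_dens_gt0. Qed.

(* Both sides are the total mass of the alternative density. *)
Lemma has_int_obs_lr : has_int J (fun w => obs_lr (obs w)) 1.
Proof.
have mo := measurable_obs_lr.
have mof : measurable_fun setT (fun w => obs_lr (obs w)) := measurableT_comp mo measurable_obs.
apply: has_int_ge0 => //; first by move=> w; exact/ltW/obs_lr_gt0.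
rewrite (@ge0_integral_obs (fun _ z => (obs_lr z)%:E)); last 3 first.
- by move=> _; exact/measurable_EFinP.
- by move=> _ z; rewrite lee_fin; exact/ltW/obs_lr_gt0.
- exact/measurable_EFinP.
transitivity (\int[leb]_z \sum_(k <oo) (mix_term mu' a' s' z k)%:E)%E.
  apply: eq_integral => z _; rewrite nneseries_mix_term//.
  rewrite nneseriesZl; last by move=> k _; rewrite lee_fin mix_term_ge0.
  by rewrite nneseries_mix_term// -EFinM /obs_lr divfK// gt_eqF// mix_dens_gt0.
rewrite integral_nneseries//; last 2 first.
- by move=> k; apply/measurable_EFinP; exact: measurable_mix_term.
- by move=> k z _; rewrite lee_fin mix_term_ge0.
rewrite -[RHS](has_intE (has_int_cst (poisson_prob mu' 0) (1 : R))).
rewrite ge0_integral_poisson_prob//.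
apply: eq_eseriesr => k _; rewrite mule1 /mix_term.
under eq_integral do rewrite EFinM.
rewrite ge0_integralZl//; last 3 first.
- by apply/measurable_EFinP; exact: measurable_normal_pdf.
- by move=> z _; rewrite lee_fin normal_pdf_ge0.
- by rewrite lee_fin poisson_pmf_ge0.
by rewrite integral_normal_pdf mule1.
Qed.

(** At a fixed observation [obs_lr] is the average of the ratios of joint densities, with the
    conditional law of [M] as weights; this is Jensen for the square under that law. *)
Lemma mix_term_jensen z (t : R) :
  (((obs_lr z - t) ^+ 2 * mix_dens mu a s z)%:E <= \sum_(k <oo)
     ((mix_term mu' a' s' z k / mix_term mu a s z k - t) ^+ 2 * mix_term mu a s z k)%:E)%E.
Proof.
set p := mix_dens mu a s z; set p' := mix_dens mu' a' s' z.
have p0 : 0 < p by exact: mix_dens_gt0.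
pose c := obs_lr z - t.
pose q := mix_term mu a s z; pose q' := mix_term mu' a' s' z.
pose g k := (q' k / q k - t) ^+ 2 * q k.
have q0 k : 0 < q k by exact: mix_term_gt0.
have g0 k : 0 <= g k by rewrite mulr_ge0 ?sqr_ge0// ltW.
(* termwise [x^2 >= 2 c x - c^2] *)
pose l k := 2 * c * (q' k - t * q k) - c ^+ 2 * q k.
have gl k : l k <= g k.
  rewrite -subr_ge0 (_ : g k - l k = (q' k / q k - t - c) ^+ 2 * q k).
    by rewrite mulr_ge0 ?sqr_ge0// ltW.
  by rewrite /g /l; field; rewrite gt_eqF.
have cl : series l n @[n --> \oo] --> 2 * c * (p' - t * p) - c ^+ 2 * p.
  have cq : series q n @[n --> \oo] --> p by exact: is_cvg_mix_term.
  have cq' : series q' n @[n --> \oo] --> p' by exact: is_cvg_mix_term.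
  have -> : series l = (fun n => 2 * c * (series q' n - t * series q n) - c ^+ 2 * series q n).
    apply/funext => n; rewrite /series /l /= big_split/= sumrN -!mulr_sumr big_split/= sumrN.
    by rewrite -mulr_sumr.
  apply: cvgB; last by apply: cvgM; [exact: cvg_cst|exact: cq].
  apply: cvgM; first exact: cvg_cst.
  by apply: cvgB; [exact: cq'|apply: cvgM; [exact: cvg_cst|exact: cq]].
have -> : c ^+ 2 * p = 2 * c * (p' - t * p) - c ^+ 2 * p.
  have -> : p' - t * p = c * p by rewrite /c /obs_lr mulrBl divfK// gt_eqF.
  by ring.
rewrite -(cvg_lim _ cl)//.
rewrite -EFin_lim; last by apply/cvg_ex; eexists; exact: cl.
apply: lee_lim.
- have cle : (series l n)%:E @[n --> \oo] --> (2 * c * (p' - t * p) - c ^+ 2 * p)%:E.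
    by apply: cvg_EFin; [exact: nearW|exact: cl].
  by apply/cvg_ex; eexists; exact: cle.
- by apply: is_cvg_nneseries => k _ _; rewrite lee_fin g0.
- apply: nearW => n; rewrite /series /= sumEFin lee_fin.
  by apply: ler_sum => k _; exact: gl.
Qed.

(** The L2 contraction of conditional expectation, without constructing one. The comparison function
    [h] sees only the observation. *)
Lemma obs_lr_jensen (h : RR -> R) : measurable_fun setT h ->
  (\int[J]_w ((obs_lr (obs w) - h (obs w)) ^+ 2)%:E <=
   \int[J]_w ((mix_term mu' a' s' (obs w) w.1 / mix_term mu a s (obs w) w.1 - h (obs w)) ^+ 2)%:E)%E.
Proof.
move=> mh; have mo := measurable_obs_lr; have mob := measurable_obs.
have minv k : measurable_fun setT (fun z : RR => mix_term mu' a' s' z k / mix_term mu a s z k).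
  apply: measurable_funM; first exact: measurable_mix_term.
  have m := measurable_mix_term mu a s k.
  rewrite (_ : (fun z : RR => _) = (fun x : R => x `^ (-1)) \o (fun z => mix_term mu a s z k)).
    by apply: (measurableT_comp _ m); exact: measurable_powR.
  by apply/funext => z /=; rewrite powR_inv1// mix_term_ge0.
have m1 k : measurable_fun setT (fun z : RR =>
    (mix_term mu' a' s' z k / mix_term mu a s z k - h z) ^+ 2).
  by apply: measurable_funX; exact: measurable_funB.
have m2 : measurable_fun setT (fun z : RR => (obs_lr z - h z) ^+ 2).
  by apply: measurable_funX; exact: measurable_funB.
rewrite (@ge0_integral_obs (fun _ z => ((obs_lr z - h z) ^+ 2)%:E)); last 3 first.
- by move=> _; exact/measurable_EFinP.
- by move=> _ z; rewrite lee_fin sqr_ge0.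
- by apply/measurable_EFinP; exact: (measurableT_comp m2 mob).
rewrite (@ge0_integral_obs (fun k z =>
  ((mix_term mu' a' s' z k / mix_term mu a s z k - h z) ^+ 2)%:E)); last 3 first.
- by move=> k; exact/measurable_EFinP.
- by move=> k z; rewrite lee_fin sqr_ge0.
- apply/measurable_EFinP; apply: measurable_nat_prod => k /=.
  have mk : measurable_fun setT (fun x : RR => s * x + (a + k%:R) : RR).
    by apply: measurable_funD => //; exact: measurable_funM.
  exact: (measurableT_comp (m1 k) mk).
apply: ge0_le_integral => //.
- by move=> z _; apply: nneseries_ge0 => k _ _; rewrite -EFinM lee_fin mulr_ge0 ?sqr_ge0 ?mix_term_ge0.
- apply: ge0_emeasurable_sum => [k z _ _|k _].
    by rewrite -EFinM lee_fin mulr_ge0 ?sqr_ge0 ?mix_term_ge0.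
  apply: emeasurable_funM; apply/measurable_EFinP => //; exact: measurable_mix_term.
- apply: ge0_emeasurable_sum => [k z _ _|k _].
    by rewrite -EFinM lee_fin mulr_ge0 ?sqr_ge0 ?mix_term_ge0.
  apply: emeasurable_funM; apply/measurable_EFinP => //; exact: measurable_mix_term.
- move=> z _; rewrite nneseriesZl; last by move=> k _; rewrite lee_fin mix_term_ge0.
  rewrite nneseries_mix_term// -EFinM; apply: (le_trans (mix_term_jensen z (h z))).
  by under [leRHS]eq_eseriesr do rewrite -EFinM.
Qed.

End mixture_density.

(** * The observed one-step ratio against the score *)

Section one_step_expansion.
Context {R : realType}.
Notation RR := (measurableTypeR R).
Variables (mu a s m e c : R).
Hypotheses (mu0 : 0 < mu) (s0 : 0 < s) (c0 : 0 < 1 + c) (e0 : 0 < 1 + e).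
Notation J := (step_law mu).

(** The alternative is described relatively: location in units of [s], scale and intensity by
    factors. In the coordinates [(M, xi)] the ratio then splits into a Poisson and a standard
    Gaussian one. *)
Lemma mix_term_ratio (w : nat * RR) :
  mix_term (mu * (1 + c)) (a + s * m) (s * (1 + e)) (obs a s w) w.1 /
  mix_term mu a s (obs a s w) w.1 = full_lr mu m e c w.
Proof.
case: w => k x; rewrite /full_lr /obs /=.
set z := s * x + (a + k%:R).
apply: (@mulIf _ (mix_term mu a s z k)); first by rewrite gt_eqF// mix_term_gt0.
rewrite divfK; last by rewrite gt_eqF// mix_term_gt0.
have sn : s != 0 by rewrite gt_eqF.
have en : 1 + e != 0 by rewrite gt_eqF.
have P : poisson_pmf (mu * (1 + c)) k = expR (- (mu * c)) * (1 + c) ^+ k * poisson_pmf mu k.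
  rewrite /poisson_pmf mulr_gt0// mu0 exprMn.
  rewrite (_ : - (mu * (1 + c)) = - (mu * c) + - mu); last by ring.
  by rewrite expRD; ring.
have G : normal_pdf (a + s * m + k%:R) (s * (1 + e)) z = gauss_lr m (1 + e) x * normal_pdf (a + k%:R) s z.
  have := normal_pdf_affine (a + k%:R) x s0; rewrite -/z => pz.
  have := normal_pdf_affine (a + s * m + k%:R) ((x - m) / (1 + e)) (mulr_gt0 s0 e0).
  rewrite (_ : s * (1 + e) * ((x - m) / (1 + e)) + (a + s * m + k%:R) = z); last first.
    by rewrite /z; field.
  move=> pz'; apply: (@mulfI _ (s * (1 + e))); first by rewrite mulf_neq0.
  rewrite pz' (_ : s * (1 + e) * _ = (1 + e) * (gauss_lr m (1 + e) x * (s * normal_pdf (a + k%:R) s z))); last by ring.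
  rewrite pz gauss_lr_pdf//.
  have := normal_pdf_affine m ((x - m) / (1 + e)) e0.
  by rewrite [(1 + e) * (_ / _)]mulrC divfK// subrK => <-.
by rewrite /mix_term P G; ring.
Qed.

(** The rounded score replaces the score before the contraction and is undone after it. Each
    triangle inequality doubles, giving [2 * 2 = 4] for the full ratio and [2 * 2 + 2 = 6] for the
    rounding. *)
Lemma obs_lr_score_le : (1 + e) ^+ 2 < 2 ->
  exists2 v, v <= 4 * full_lr_bound mu m e c + 6 * score_est_bound m e c s &
    has_int J (fun w => (obs_lr mu a s (mu * (1 + c)) (a + s * m) (s * (1 + e)) (obs a s w)
       - 1 - score mu m e c w) ^+ 2) v.
Proof.
move=> e2; set lr := obs_lr _ _ _ _ _ _.
have mu'0 : 0 < mu * (1 + c) by rewrite mulr_gt0.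
have s'0 : 0 < s * (1 + e) by rewrite mulr_gt0.
have mlr : measurable_fun setT (lr : RR -> R) by exact: measurable_obs_lr.
have mob := measurable_obs a s.
have msc := measurable_score mu m e c.
have [g1 g1v g1le] := full_lr_score_le mu0 m c0 e0 e2.
have [g2 g2v g2le] := score_est_le mu0 m e c s0.
pose h z := 1 + score_est mu m e c s (z - a).
have mh : measurable_fun setT (h : RR -> R).
  apply: measurable_funD => //; apply: (measurableT_comp (measurable_score_est mu m e c s)).
  exact: measurable_funB.
have mho : measurable_fun setT (fun w => h (obs a s w)) := measurableT_comp mh mob.
have mlro : measurable_fun setT (fun w => lr (obs a s w)) := measurableT_comp mlr mob.
have hE w : h (obs a s w) - 1 - score mu m e c w =
    - (score mu m e c w - score_est mu m e c s (s * w.2 + w.1%:R)).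
  rewrite /h (_ : obs a s w - a = s * w.2 + w.1%:R); first by ring.
  by rewrite /obs; ring.
pose f w := (full_lr mu m e c w - h (obs a s w)) ^+ 2.
have mf : measurable_fun setT f.
  by apply: measurable_funX; apply: measurable_funB => //; exact: measurable_full_lr.
have fle w : f w <= 2 * g1 w + 2 * g2 w.
  rewrite /f (_ : _ - _ = (full_lr mu m e c w - 1 - score mu m e c w) +
    - (h (obs a s w) - 1 - score mu m e c w)); last by ring.
  rewrite (le_trans (sqr_addn_le2 _ _))// lerD// ler_wpM2l//.
  by rewrite hE opprK.
have G := has_intD (has_intZ 2 g1v) (has_intZ 2 g2v).
have fi : has_int J f (\int[J]_w f w).
  by apply: (has_int_dom mf _ G) => w; rewrite ger0_norm ?sqr_ge0.
have fv := has_int_le fi G fle.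
pose k w := (lr (obs a s w) - h (obs a s w)) ^+ 2.
have mk : measurable_fun setT k by apply: measurable_funX; exact: measurable_funB.
have kle : (\int[J]_w (k w)%:E <= (\int[J]_w f w)%:E)%E.
  rewrite -(has_intE fi); have := obs_lr_jensen a mu0 s0 (a + s * m) mu'0 s'0 mh.
  by under [X in (_ <= X)%E]eq_integral do rewrite mix_term_ratio.
have ki : has_int J k (\int[J]_w k w).
  apply: has_int_lty => //; first by move=> w; exact: sqr_ge0.
  by rewrite (le_lt_trans kle)// ltry.
have kv : \int[J]_w k w <= \int[J]_w f w by move: kle; rewrite (has_intE ki) lee_fin.
have H := has_intD (has_intZ 2 ki) (has_intZ 2 g2v).
have le2 w : (lr (obs a s w) - 1 - score mu m e c w) ^+ 2 <= 2 * k w + 2 * g2 w.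
  rewrite (_ : _ - _ = (lr (obs a s w) - h (obs a s w)) + (h (obs a s w) - 1 - score mu m e c w)); last by ring.
  by rewrite (le_trans (sqr_addn_le2 _ _))// lerD// ler_wpM2l// hE sqrrN.
have mt : measurable_fun setT (fun w => (lr (obs a s w) - 1 - score mu m e c w) ^+ 2).
  by apply: measurable_funX; apply: measurable_funB => //; exact: measurable_funB.
have ti : has_int J (fun w => (lr (obs a s w) - 1 - score mu m e c w) ^+ 2)
    (\int[J]_w (lr (obs a s w) - 1 - score mu m e c w) ^+ 2).
  by apply: (has_int_dom mt _ H) => w; rewrite ger0_norm ?sqr_ge0.
exists (\int[J]_w (lr (obs a s w) - 1 - score mu m e c w) ^+ 2) => //.
apply: (le_trans (has_int_le ti H le2)).
by move: kv fv; set A := \int[J]_w k w; set B := \int[J]_w f w; lra.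
Qed.

End one_step_expansion.

(** * The clipped logarithm *)

Section clipped_log.
Context {R : realType}.
Implicit Types y : R.

(** The derivative of the remainder is [t ^+ 2 / (1 + t)], at most [2 * t ^+ 2] on the range; the
    mean value theorem concludes. *)
Lemma ln1p_taylor y : `|y| <= 1 / 2 -> `|ln (1 + y) - y + y ^+ 2 / 2| <= 2 * `|y| ^+ 3.
Proof.
move=> y12; pose g t : R := ln (1 + t) - t + t ^+ 2 / 2.
have /ler_normlP[yl yr] := y12.
have dg (t : R) : -1 < t -> is_derive t 1 g (t ^+ 2 / (1 + t)).
  move=> t1; have t0 : 0 < 1 + t by lra.
  have d1 : is_derive t 1 (fun x : R => 1 + x) 1.
    have h := is_deriveD (is_derive_cst (1 : R) t 1) (is_derive_id t 1).
    by rewrite add0r in h.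
  have d2 := @is_derive1_comp _ (@ln R) (fun x : R => 1 + x) t _ _ (is_derive1_ln t0) d1.
  have d3 := is_deriveD (is_deriveB d2 (is_derive_id t 1)) (is_deriveZ 2^-1 (is_deriveX 2 (is_derive_id t 1))).
  have -> : g = (@ln R \o (fun x => 1 + x)) - id + 2^-1 \*: id ^+ 2.
    apply/funext => r; rewrite /g -[RHS]/(ln (1 + r) - r + 2^-1 * r ^+ 2); ring.
  suff <- : (1 + t)^-1 * 1 - 1 + 2^-1 *: (2 * t ^+ 2.-1)%:A = t ^+ 2 / (1 + t) :> R by exact: d3.
  rewrite /GRing.scale /=; field; lra.
have cg (a b : R) : -1 < a -> {within `[a, b], continuous g}.
  move=> a1; apply: derivable_within_continuous => r; rewrite in_itv /= => /andP[ar _].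
  exact: (@ex_derive _ _ _ _ _ _ _ (dg r (lt_le_trans a1 ar))).
have g0 : g 0 = 0 by rewrite /g addr0 ln1 expr2; ring.
have [c c12 gy] : exists2 c : R, `|c| <= `|y| & g y = c ^+ 2 / (1 + c) * y.
  have [y0|y0] := leP 0 y.
    have dg' r : r \in `]0, y[%R -> is_derive r 1 g (r ^+ 2 / (1 + r)).
      by rewrite in_itv /= => /andP[r0 _]; apply: dg; lra.
    have [|c] := MVT_segment y0 dg'; first by apply: cg; lra.
    rewrite in_itv /= => /andP[c0 cy]; rewrite g0 !subr0 => ->; exists c => //.
    by rewrite !ger0_norm.
  have dg' r : r \in `]y, 0[%R -> is_derive r 1 g (r ^+ 2 / (1 + r)).
    by rewrite in_itv /= => /andP[r0 _]; apply: dg; lra.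
  have [|c] := MVT_segment (ltW y0) dg'; first by apply: cg; lra.
  rewrite in_itv /= => /andP[c0 cy]; rewrite g0 !sub0r => h; exists c.
    by rewrite !ler0_norm// ?lerN2// ltW.
  by rewrite -[g y]opprK h mulrN opprK.
have /ler_normlP[cl cr] := le_trans c12 y12.
have c1 : (1 + c)^-1 <= 2 by rewrite -[leRHS]invrK lef_pV2 ?posrE; lra.
have c10 : 0 <= (1 + c)^-1 by rewrite invr_ge0; lra.
rewrite -/(g y) gy normrM [X in X * _]normrM normrX (ger0_norm c10) [`|y| ^+ 3]exprSr mulrA ler_wpM2r// mulrC.
by apply: ler_pM => //; rewrite ?exprn_ge0// lerXn2r// nnegrE.
Qed.

Definition clip y := Num.max (- (1 / 2)) (Num.min y (1 / 2)).

(** The logarithm is taken only on [[1 / 2, 3 / 2]], so [ell] is bounded and all its moments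
    exist. *)
Definition ell y := ln (1 + clip y).

Lemma clip_id y : `|y| <= 1 / 2 -> clip y = y.
Proof. by move=> /ler_normlP[yl yr]; rewrite /clip (min_idPl yr) (max_idPr _)//; lra. Qed.

Lemma ler_norm_clip y : `|clip y| <= 1 / 2.
Proof.
rewrite ler_norml /clip le_max lexx /= ge_max ge_min lexx orbT andbT; lra.
Qed.

Lemma ell_id y : `|y| <= 1 / 2 -> ell y = ln (1 + y).
Proof. by move=> /clip_id; rewrite /ell => ->. Qed.

Lemma measurable_ell : measurable_fun setT (ell : measurableTypeR R -> measurableTypeR R).
Proof.
apply: measurableT_comp; first exact: measurable_ln.
apply: measurable_funD => //; apply: measurable_maxr => //.
exact: measurable_minr.
Qed.

(** The errors are all at most 13 times [psi], the minimum of [|y| ^+ 3] and [|y| ^+ 2]: the cube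
    serves small [y], the square large [y]. The approximation [L] enters only through [psi <= K]. *)
Lemma ell_error y L : let K := 8 * `|L| ^+ 3 + 4 * (y - L) ^+ 2 in
  [/\ `|ell y - (y - y ^+ 2 / 2)| <= 13 * K, `|ell y ^+ 2 - y ^+ 2| <= 13 * K,
      `|ell y| ^+ 3 <= 13 * K & \1_[set x : R | 1 / 2 < `|x|] y <= 13 * K].
Proof.
move=> K.
pose psi := Num.min (`|y| ^+ 3) (`|y| ^+ 2).
have y0 := normr_ge0 y.
have psiK : psi <= K.
  rewrite /psi ge_min /K; have := ler_normD L (y - L); rewrite addrC subrK => yLD.
  have := normr_ge0 L; have := normr_ge0 (y - L); rewrite -(real_normK (num_real (y - L))).
  move: `|L| `|y - L| `|y| yLD y0 => a b x yab x0 b0 a0.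
  have a30 : 0 <= a ^+ 3 by rewrite exprn_ge0.
  have b20 : 0 <= b ^+ 2 by rewrite exprn_ge0.
  (* The larger of [a = |L|] and [b = |y - L|] is at least half of [|y|]. *)
  have [ba|ab] := leP b a.
    apply/orP; left; apply: (@le_trans _ _ ((2 * a) ^+ 3)); first by rewrite lerXn2r ?nnegrE; lra.
    by rewrite exprMn; lra.
  apply/orP; right; apply: (@le_trans _ _ ((2 * b) ^+ 2)); first by rewrite lerXn2r ?nnegrE; lra.
  by rewrite exprMn; lra.
have K0 : 0 <= K by apply: addr_ge0; apply: mulr_ge0 => //; first [exact: exprn_ge0|exact: sqr_ge0].
have sml (x : R) : `|x| <= 1 / 2 -> [/\ `|ln (1 + x)| <= 7 / 4 * `|x| ,
    `|ln (1 + x) - x| <= 3 / 2 * `|x| ^+ 2 & `|ln (1 + x) - (x - x ^+ 2 / 2)| <= 2 * `|x| ^+ 3].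
  move=> x12; have h := ln1p_taylor x12; have x0 := normr_ge0 x.
  have x3 : `|x| ^+ 3 <= 1 / 2 * `|x| ^+ 2 by rewrite exprS ler_wpM2r// exprn_ge0.
  have h2 : `|ln (1 + x) - x| <= 3 / 2 * `|x| ^+ 2.
    have := ler_normB (ln (1 + x) - x + x ^+ 2 / 2) (x ^+ 2 / 2).
    rewrite addrK (ger0_norm (divr_ge0 (sqr_ge0 x) (ler0n _ _))); have := real_normK (num_real x); lra.
  split=> //; last by rewrite (_ : ln (1 + x) - (x - x ^+ 2 / 2) = ln (1 + x) - x + x ^+ 2 / 2)//; ring.
  have := ler_normD (ln (1 + x) - x) x; rewrite subrK.
  have : `|x| ^+ 2 <= 1 / 2 * `|x| by rewrite expr2 ler_wpM2r.
  lra.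
rewrite indicE; have [y12|y12] := leP `|y| (1 / 2).
  have psiE : psi = `|y| ^+ 3.
    by rewrite /psi; apply/min_idPl; rewrite exprS ler_piMl// ?exprn_ge0//; lra.
  have y30 : 0 <= `|y| ^+ 3 by rewrite exprn_ge0.
  have [h1 h2 h3] := sml y y12.
  rewrite psiE in psiK; rewrite (ell_id y12) memNset /=; last by apply/negP; rewrite -leNgt.
  split; [lra| | |lra].
    have -> : ln (1 + y) ^+ 2 - y ^+ 2 = (ln (1 + y) - y) * (ln (1 + y) + y) by ring.
    rewrite normrM; have h4 : `|ln (1 + y) + y| <= 11 / 4 * `|y|.
      by apply: le_trans (ler_normD _ _) _; lra.
    have := ler_pM (normr_ge0 _) (normr_ge0 _) h2 h4; rewrite mulrACA -exprSr; lra.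
  have : `|ln (1 + y)| ^+ 3 <= (7 / 4 * `|y|) ^+ 3 by rewrite lerXn2r// ?nnegrE//; lra.
  rewrite exprMn; lra.
have y2 : `|y| <= 2 * `|y| ^+ 2.
  by rewrite expr2 mulrA ler_peMl//; lra.
have y21 : 1 <= 4 * `|y| ^+ 2 by lra.
(* For [|y| > 1 / 2] this gives [1 <= 8 * psi], [|y| <= 4 * psi] and [|y| ^+ 2 / 2 <= psi]; their
   sum is the constant 13. *)
have psi2 : `|y| ^+ 2 <= 2 * psi.
  rewrite /psi -ler_pdivrMl// le_min; apply/andP; split; last by lra.
  by rewrite [leRHS]exprS ler_wpM2r ?exprn_ge0//; lra.
have [h1 _ _] := sml _ (ler_norm_clip y); have h0 := ler_norm_clip y.
have e1 : `|ell y| <= 1 by rewrite /ell; lra.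
have e0 := normr_ge0 (ell y).
have e21 : `|ell y| ^+ 2 <= 1 by rewrite exprn_ile1.
have e31 : `|ell y| ^+ 3 <= 1 by rewrite exprn_ile1.
have yy : `|y ^+ 2| = `|y| ^+ 2 by rewrite normrX.
rewrite mem_set//=; split.
- have := ler_normB (ell y) (y - y ^+ 2 / 2); have := ler_normB y (y ^+ 2 / 2).
  rewrite [`|y ^+ 2 / 2|]normrM yy (ger0_norm (_ : 0 <= 2^-1)) ?invr_ge0//; lra.
- have := ler_normB (ell y ^+ 2) (y ^+ 2); rewrite yy normrX; lra.
- lra.
- lra.
Qed.

End clipped_log.

(** * Moments of the clipped logarithm *)

Section ell_moments.
Context {d} {T : measurableType d} {R : realType} (P : probability T R).
Variables (Y L g : T -> R) (V2 V3 vD t : R).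
Hypothesis mY : measurable_fun setT Y.
Hypotheses (hY : has_int P Y 0) (h2 : has_int P (fun w => L w ^+ 2) V2).
Hypotheses (h3 : has_int P g V3) (gL : forall w, `|L w| ^+ 3 <= g w).
Hypotheses (hD : has_int P (fun w => (Y w - L w) ^+ 2) vD) (t0 : 0 < t).

(** The first term integrates the pointwise error; the others compare second moments of [Y] and [L]
    with a free weight [t], sent to 0 only after [n] has gone to infinity. *)
Definition ell_err : R := 13 * (8 * V3 + 4 * vD) + (1 + t^-1) * vD + t * V2.

Lemma ler_norm_ell (y : R) : `|ell y| <= 1.
Proof.
have c := ler_norm_clip y; have := ln1p_taylor c; rewrite -/(ell y) => e.
have := ler_normD (ell y - clip y + clip y ^+ 2 / 2) (clip y - clip y ^+ 2 / 2).
rewrite (_ : ell y - clip y + clip y ^+ 2 / 2 + (clip y - clip y ^+ 2 / 2) = ell y); last by ring.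
have := ler_normB (clip y) (clip y ^+ 2 / 2); rewrite [`|clip y ^+ 2 / 2|]normrM normrX.
rewrite (ger0_norm (_ : 0 <= 2^-1)) ?invr_ge0//.
have c0 := normr_ge0 (clip y).
have c2 : `|clip y| ^+ 2 <= 1 / 2 * (1 / 2) by rewrite expr2 ler_pM.
have c3 : `|clip y| ^+ 3 <= 1 / 2 * (1 / 2 * (1 / 2)).
  by rewrite exprS ler_pM// ?exprn_ge0// expr2 ler_pM.
lra.
Qed.

Lemma bmeas_ell : bmeas (fun w => ell (Y w)).
Proof.
split; first exact: (measurableT_comp (@measurable_ell R) mY).
by exists 1 => w; exact: ler_norm_ell.
Qed.

(** Since [Y] has mean zero, the mean of its logarithm is minus half its second moment: this is the
    source of the drift [- I / 2]. *)
Lemma ell_moments :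
  [/\ `|\int[P]_w ell (Y w) + V2 / 2| <= ell_err,
      `|\int[P]_w (ell (Y w) ^+ 2) - V2| <= ell_err,
      \int[P]_w (`|ell (Y w)| ^+ 3) <= ell_err &
      (P [set w | (1 / 2 < `|Y w|)%R] <= ell_err%:E)%E].
Proof.
pose K w := 8 * g w + 4 * (Y w - L w) ^+ 2.
have hK : has_int P (fun w => 13 * K w) (13 * (8 * V3 + 4 * vD)).
  exact: has_intZ (has_intD (has_intZ 8 h3) (has_intZ 4 hD)).
have KE w : 13 * (8 * `|L w| ^+ 3 + 4 * (Y w - L w) ^+ 2) <= 13 * K w.
  by rewrite /K; have := gL w; lra.
have vD0 : 0 <= vD by apply: (has_int_le (has_int_cst P 0) hD) => w; exact: sqr_ge0.
have V20 : 0 <= V2 by apply: (has_int_le (has_int_cst P 0) h2) => w; exact: sqr_ge0.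
have E0 : 0 <= (1 + t^-1) * vD + t * V2.
  by rewrite addr_ge0// mulr_ge0// ?ltW// ltr_wpDr// invr_ge0 ltW.
pose D2 w := (1 + t^-1) * (Y w - L w) ^+ 2 + t * L w ^+ 2.
have hD2 : has_int P D2 ((1 + t^-1) * vD + t * V2).
  exact: has_intD (has_intZ _ hD) (has_intZ _ h2).
(* Weighted arithmetic-geometric mean for the cross term [2 * a * b]. *)
have amgm (a b : R) : `|(a + b) ^+ 2 - a ^+ 2| <= (1 + t^-1) * b ^+ 2 + t * a ^+ 2.
  have h1 : 0 <= t^-1 * (b - t * a) ^+ 2 by rewrite mulr_ge0 ?sqr_ge0// invr_ge0 ltW.
  have h4 : 0 <= t^-1 * (b + t * a) ^+ 2 by rewrite mulr_ge0 ?sqr_ge0// invr_ge0 ltW.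
  have e1 : t^-1 * (b - t * a) ^+ 2 = t^-1 * b ^+ 2 - 2 * (a * b) + t * a ^+ 2 by field; rewrite gt_eqF.
  have e2 : t^-1 * (b + t * a) ^+ 2 = t^-1 * b ^+ 2 + 2 * (a * b) + t * a ^+ 2 by field; rewrite gt_eqF.
  have := sqr_ge0 b; rewrite ler_norml; nra.
have D2E w : `|Y w ^+ 2 - L w ^+ 2| <= D2 w by have := amgm (L w) (Y w - L w); rewrite [L w + _]addrC subrK.
have hY2 : has_int P (fun w => Y w ^+ 2) (\int[P]_w (Y w ^+ 2)).
  apply: (has_int_dom _ _ (has_intD h2 hD2)); first exact: measurable_funX.
  move=> w; rewrite ger0_norm ?sqr_ge0//; have := D2E w; rewrite ler_norml; lra.
set vY := \int[P]_w _ in hY2.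
have vYE : `|vY - V2| <= (1 + t^-1) * vD + t * V2.
  rewrite ler_norml; apply/andP; split.
    rewrite lerNl opprB; apply: (has_int_le (has_intB h2 hY2) hD2) => w.
    by have := D2E w; rewrite ler_norml; lra.
  apply: (has_int_le (has_intB hY2 h2) hD2) => w; have := D2E w; rewrite ler_norml; lra.
have hl : has_int P (fun w => ell (Y w)) (\int[P]_w ell (Y w)).
  by split => //; exact: bmeas_integrable bmeas_ell.
have hX k : has_int P (fun w => `|ell (Y w)| ^+ k) (\int[P]_w (`|ell (Y w)| ^+ k)).
  split=> //; apply: (bmeas_integrable P (f := fun w => `|ell (Y w)| ^+ k)); split.
    by apply: measurable_funX; apply: measurableT_comp => //; case: bmeas_ell.
  by exists 1 => w; rewrite normrX normr_id exprn_ile1// ler_norm_ell.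
have hl2 : has_int P (fun w => ell (Y w) ^+ 2) (\int[P]_w (ell (Y w) ^+ 2)).
  have e w : `|ell (Y w)| ^+ 2 = ell (Y w) ^+ 2 by rewrite real_normK// num_real.
  apply: (has_int_ext (hX 2)) => //.
  by under eq_Rintegral do rewrite e.
split.
- set I := \int[P]_w _ in hl *.
  have : `|I - (0 - 2^-1 * vY)| <= 13 * (8 * V3 + 4 * vD).
    have hz := has_intB hY (has_intZ 2^-1 hY2).
    rewrite ler_norml; apply/andP; split.
      rewrite lerNl opprB; apply: (has_int_le (has_intB hz hl) hK) => w.
      have [+ _ _ _] := ell_error (Y w) (L w); have := KE w; rewrite ler_norml; lra.
    apply: (has_int_le (has_intB hl hz) hK) => w.
    have [+ _ _ _] := ell_error (Y w) (L w); have := KE w; rewrite ler_norml; lra.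
  move: vYE; rewrite /ell_err !ler_norml; lra.
- set I := \int[P]_w _ in hl2 *.
  have : `|I - vY| <= 13 * (8 * V3 + 4 * vD).
    rewrite ler_norml; apply/andP; split.
      rewrite lerNl opprB; apply: (has_int_le (has_intB hY2 hl2) hK) => w.
      have [_ + _ _] := ell_error (Y w) (L w); have := KE w; rewrite ler_norml; lra.
    apply: (has_int_le (has_intB hl2 hY2) hK) => w.
    have [_ + _ _] := ell_error (Y w) (L w); have := KE w; rewrite ler_norml; lra.
  move: vYE; rewrite /ell_err !ler_norml; lra.
- apply: (@le_trans _ _ (13 * (8 * V3 + 4 * vD))); last by rewrite /ell_err; lra.
  apply: (has_int_le (hX 3%N) hK) => w.
  by have [_ _ + _] := ell_error (Y w) (L w); have := KE w; lra.
- have mA : measurable [set w | 1 / 2 < `|Y w|].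
    rewrite (_ : [set w | _] = [set: T] `&` (fun w => `|Y w|) @^-1` `]1 / 2, +oo[%classic).
      by exact: (measurableT_comp _ mY).
    by rewrite setTI; apply/seteqP; split => w /=; rewrite in_itv /= andbT.
  apply: (@le_trans _ _ (13 * (8 * V3 + 4 * vD))%:E); last by rewrite lee_fin /ell_err; lra.
  rewrite -(has_intE hK) -(setIT [set w | _]) -integral_indic//.
  apply: ge0_le_integral => //.
  + by apply/measurable_EFinP; exact: measurable_indic.
  + by case: hK => /integrableP[].
  + move=> w _; rewrite lee_fin; apply: le_trans (KE w).
    by have [_ _ _] := ell_error (Y w) (L w); rewrite !indicE.
Qed.

End ell_moments.

Lemma has_int_law {d d'} {T : measurableType d} {T' : measurableType d'} {R : realType}
  (P : probability T R) (U : T -> T') (mU : measurable_fun setT U) (f : T' -> R) v :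
  measurable_fun setT f -> has_int P (fun w => f (U w)) v -> has_int (law P mU) f v.
Proof.
move=> mf [fi <-]; have mf' : measurable_fun setT (EFin \o f) by exact/measurable_EFinP.
split; first exact: (integrable_pushforward mU mf' fi measurableT).
by rewrite /Rintegral; congr fine; rewrite (integral_pushforward mU mf').
Qed.

(** * The law of the clipped one-step log-ratio *)

Section one_step_log_lr.
Context {R : realType}.
Notation RR := (measurableTypeR R).
Variables (mu a s m e c : R).
Hypotheses (mu0 : 0 < mu) (s0 : 0 < s) (c0 : 0 < 1 + c) (e0 : 0 < 1 + e).
Notation J := (step_law mu).

Definition step_lr (z : R) : R := obs_lr mu a s (mu * (1 + c)) (a + s * m) (s * (1 + e)) z.

Definition step_ell (z : R) : R := ell (step_lr z - 1).

Lemma measurable_step_lr : measurable_fun setT (step_lr : RR -> R).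
Proof. by apply: measurable_obs_lr => //; rewrite mulr_gt0. Qed.

Lemma measurable_step_ell : measurable_fun setT (step_ell : RR -> RR).
Proof.
apply: (measurableT_comp (@measurable_ell R)); apply: measurable_funB => //.
exact: measurable_step_lr.
Qed.

Lemma measurable_step_ell_obs : measurable_fun setT (fun w => step_ell (obs a s w) : RR).
Proof. exact: (measurableT_comp measurable_step_ell (measurable_obs a s)). Qed.

Definition ell_law : probability RR R := law J measurable_step_ell_obs.

Definition step_err (t : R) : R :=
  let vD := 4 * full_lr_bound mu m e c + 6 * score_est_bound m e c s in
  ell_err (m ^+ 2 + 2 * e ^+ 2 + c ^+ 2 * mu) (score_cube_bound mu m e c) vD t.

Lemma third_moment_ell_law : third_moment ell_law.
Proof.
have h (f : RR -> R) : measurable_fun setT f -> (forall y, `|f (ell y)| <= 1) ->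
    ell_law.-integrable setT (EFin \o f).
  move=> mf f1; apply: (proj1 (@has_int_law _ _ _ _ _ _ _ _ f _ mf _)).
  split; last exact: erefl.
  apply: (bmeas_integrable J (f := fun w => f (step_ell (obs a s w)))).
  split; first exact: (measurableT_comp mf measurable_step_ell_obs).
  by exists 1 => w; exact: f1.
have l1 (y : R) := @ler_norm_ell R y.
split; apply: h => //.
- by move=> y; rewrite normrX exprn_ile1.
- by apply: measurable_funX; exact: normr_measurable.
- by move=> y; rewrite normrX normr_id exprn_ile1.
Qed.

Lemma ell_law_moments (t : R) : (1 + e) ^+ 2 < 2 -> 0 < t ->
  let V2 := m ^+ 2 + 2 * e ^+ 2 + c ^+ 2 * mu in
  [/\ `|\int[ell_law]_y y + V2 / 2| <= step_err t,
      `|\int[ell_law]_y (y ^+ 2) - V2| <= step_err t,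
      \int[ell_law]_y (`|y| ^+ 3) <= step_err t &
      (J [set w | (1 / 2 < `|step_lr (obs a s w) - 1|)%R] <= (step_err t)%:E)%E].
Proof.
move=> e2 t0 V2.
have [v vle hv] := obs_lr_score_le a m mu0 s0 c0 e0 e2.
have [g hg gle] := score_cube_le mu0 m e c.
have mlr : measurable_fun setT (fun w => step_lr (obs a s w) - 1).
  apply: measurable_funB => //.
  exact: (measurableT_comp measurable_step_lr (measurable_obs a s)).
have hY : has_int J (fun w => step_lr (obs a s w) - 1) 0.
  have h : has_int J (fun w => step_lr (obs a s w)) 1 by apply: has_int_obs_lr => //; rewrite mulr_gt0.
  by apply: (has_int_ext (has_intB h (has_int_cst J 1))) => //; rewrite subrr.
have [h1 h2 h3 h4] := ell_moments mlr hY (has_int_score_sqr mu0 m e c) hg gle hv t0.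
have le : ell_err V2 (score_cube_bound mu m e c) v t <= step_err t.
  have t1 : 0 <= t^-1 by rewrite invr_ge0 ltW.
  rewrite /step_err /ell_err lerD2r lerD//; first by lra.
  by rewrite ler_wpM2l// addr_ge0.
have E (f : RR -> R) : measurable_fun setT f -> (forall y, `|f (ell y)| <= 1) ->
    \int[ell_law]_y f y = \int[J]_w f (ell (step_lr (obs a s w) - 1)).
  move=> mf f1; apply: (proj2 (@has_int_law _ _ _ _ _ _ _ _ f _ mf _)).
  split; last exact: erefl.
  apply: (bmeas_integrable J (f := fun w => f (step_ell (obs a s w)))).
  split; first exact: (measurableT_comp mf measurable_step_ell_obs).
  by exists 1 => w; exact: f1.
have l1 (y : R) := @ler_norm_ell R y.
rewrite (E id)// (E (fun y => y ^+ 2)); last 2 first.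
- exact: measurable_funX.
- by move=> y; rewrite normrX exprn_ile1.
rewrite (E (fun y => `|y| ^+ 3)); last 2 first.
- by apply: measurable_funX; exact: normr_measurable.
- by move=> y; rewrite normrX normr_id exprn_ile1.
split; [exact: le_trans h1 le|exact: le_trans h2 le|exact: le_trans h3 le|].
by apply: le_trans h4 _; rewrite lee_fin.
Qed.

End one_step_log_lr.

(** * Rates *)

Section step_err_rate.
Context {R : realType}.
Variables (A B W lam sg : R).
Hypothesis lam0 : 0 < lam.

Let K : R := W ^+ 2 * lam.
Let Y : R := `|A| + `|B|.

(** A bound for [n] times the squared L2 error, with [r] for [1 / sqrt n] and [D] for the time step;
    every monomial contains [r] or [D]. *)
Definition lr_rate (r D : R) : R :=
  4 * (3 * (2 * K ^+ 2 * r ^+ 2 + 40 * Y ^+ 3 * r + (4 * K ^+ 2 * r ^+ 2 + 2 * K) *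
    (80 * Y ^+ 3 * r ^+ 3 + 2 * (A ^+ 2 + 2 * B ^+ 2) * r ^+ 2))) +
  6 * (3 * (64 * A ^+ 2 * sg ^+ 4 * D ^+ 2 + 4 * B ^+ 2 * sg ^+ 2 * D +
    64 * W ^+ 2 * sg ^+ 6 * D ^+ 2) * gauss_moment 6).

Definition cube_rate (r q : R) : R :=
  9 * (4 * `|A| ^+ 3 * r + (1 + gauss_moment 6) * `|B| ^+ 3 * r +
    `|W| ^+ 3 * lam * (lam * (lam + 1) + 2 * lam + 1 + lam ^+ 2) * q).

Variables (n r q D : R).
Hypotheses (n0 : 0 < n) (r0 : 0 <= r) (q0 : 0 <= q) (D0 : 0 < D) (D1 : D <= 1).
Hypotheses (nr : n * r ^+ 2 = 1) (nq : n * D * q ^+ 2 = 1).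

Let mu : R := lam * D.
Let s : R := sg * Num.sqrt D.

Let s2 : s ^+ 2 = sg ^+ 2 * D.
Proof. by rewrite exprMn sqr_sqrtr// ltW. Qed.

Let kappaE : (W * q) ^+ 2 * mu = K * r ^+ 2.
Proof.
apply: (@mulfI _ n); first by rewrite gt_eqF.
by rewrite /K (_ : n * ((W * q) ^+ 2 * mu) = W ^+ 2 * lam * (n * D * q ^+ 2)) /mu; [rewrite nq -nr|]; ring.
Qed.

Lemma score_sqr_rate : n * ((A * r) ^+ 2 + 2 * (B * r) ^+ 2 + (W * q) ^+ 2 * mu) =
  A ^+ 2 + 2 * B ^+ 2 + K.
Proof.
rewrite kappaE (_ : n * _ = (A ^+ 2 + 2 * B ^+ 2 + K) * (n * r ^+ 2)); last by ring.
by rewrite nr mulr1.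
Qed.

(** The third Poisson moment bound carries a factor [mu]; together with [n * D * q ^+ 2 = 1] this
    leaves one power of [q]. *)
Lemma score_cube_rate : n * score_cube_bound mu (A * r) (B * r) (W * q) <= cube_rate r q.
Proof.
have mul : mu <= lam by rewrite /mu ler_piMr// ltW.
have mu0 : 0 <= mu by rewrite mulr_ge0// ltW.
rewrite /score_cube_bound /cube_rate !normrM (ger0_norm r0) (ger0_norm q0).
set g := gauss_moment 6; set a := `|A|; set b := `|B|; set w := `|W|.
have -> : n * (9 * (4 * (a * r) ^+ 3 + (1 + g) * (b * r) ^+ 3 +
  (w * q) ^+ 3 * (mu * (mu * (mu + 1) + 2 * mu + 1) + mu ^+ 3))) =
  9 * (4 * a ^+ 3 * r * (n * r ^+ 2) + (1 + g) * b ^+ 3 * r * (n * r ^+ 2) +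
   w ^+ 3 * lam * q * (n * D * q ^+ 2) * (mu * (mu + 1) + 2 * mu + 1 + mu ^+ 2)).
  by rewrite /mu; ring.
rewrite nr nq !mulr1 ler_wpM2l// lerD2l mulrAC ler_wpM2r// ler_wpM2l//.
  by rewrite mulr_ge0 ?exprn_ge0 ?normr_ge0// ltW.
have : mu ^+ 2 <= lam ^+ 2 by rewrite lerXn2r// nnegrE// ltW.
lra.
Qed.

Lemma full_lr_rate : Y * r <= 1 / 8 -> K * r ^+ 2 <= 1 / 2 ->
  n * full_lr_bound mu (A * r) (B * r) (W * q) <=
  3 * (2 * K ^+ 2 * r ^+ 2 + 40 * Y ^+ 3 * r + (4 * K ^+ 2 * r ^+ 2 + 2 * K) *
    (80 * Y ^+ 3 * r ^+ 3 + 2 * (A ^+ 2 + 2 * B ^+ 2) * r ^+ 2)).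
Proof.
move=> Yr Kr; rewrite /full_lr_bound kappaE.
have K0 : 0 <= K by rewrite mulr_ge0 ?sqr_ge0// ltW.
have Kr0 : 0 <= K * r ^+ 2 by rewrite mulr_ge0// sqr_ge0.
have kp := expR_le_quadratic Kr0 Kr.
have kp0 := expR_ge1Dx (K * r ^+ 2).
set k := expR (K * r ^+ 2) - 1 - K * r ^+ 2.
have k2 : k <= 2 * (K * r ^+ 2) ^+ 2 by rewrite /k; lra.
have k0 : 0 <= k by rewrite /k; lra.
have G : gauss_lr_err (A * r) (B * r) <= 40 * (Y * r) ^+ 3.
  apply: gauss_lr_err_le Yr; rewrite normrM (ger0_norm r0) ler_wpM2r// /Y ?lerDl ?lerDr//.
set g := gauss_lr_err _ _ in G *.
have Y3 : 0 <= (Y * r) ^+ 3 by rewrite exprn_ge0// mulr_ge0// addr_ge0.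
have AB : 0 <= A ^+ 2 + 2 * B ^+ 2 by have := sqr_ge0 A; have := sqr_ge0 B; lra.
pose H := 80 * (Y * r) ^+ 3 + 2 * (A ^+ 2 + 2 * B ^+ 2) * r ^+ 2.
have H0 : 0 <= H.
  have h := mulr_ge0 AB (sqr_ge0 r); rewrite /H; lra.
have h1 : (2 * k + 2 * (K * r ^+ 2)) * (2 * g + 2 * ((A * r) ^+ 2 + 2 * (B * r) ^+ 2)) <=
   (4 * (K * r ^+ 2) ^+ 2 + 2 * (K * r ^+ 2)) * H.
  apply: (@le_trans _ _ ((2 * k + 2 * (K * r ^+ 2)) * H)).
    by apply: ler_wpM2l; [lra|rewrite /H; lra].
  by apply: ler_wpM2r => //; lra.
apply: (@le_trans _ _ (n * (3 * (2 * (K * r ^+ 2) ^+ 2 + 40 * (Y * r) ^+ 3 +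
  (4 * (K * r ^+ 2) ^+ 2 + 2 * (K * r ^+ 2)) * H)))).
  by apply: ler_wpM2l; [exact: ltW|lra].
rewrite le_eqVlt; apply/orP; left; apply/eqP.
transitivity (3 * (2 * K ^+ 2 * r ^+ 2 + 40 * Y ^+ 3 * r +
  (4 * K ^+ 2 * r ^+ 2 + 2 * K) * H) * (n * r ^+ 2)); first by ring.
by rewrite nr mulr1 /H; ring.
Qed.

Lemma score_est_rate : n * score_est_bound (A * r) (B * r) (W * q) s =
  3 * (64 * A ^+ 2 * sg ^+ 4 * D ^+ 2 + 4 * B ^+ 2 * sg ^+ 2 * D +
    64 * W ^+ 2 * sg ^+ 6 * D ^+ 2) * gauss_moment 6.
Proof.
rewrite /score_est_bound; set g := gauss_moment 6.
have -> : s ^+ 4 = (sg ^+ 2 * D) ^+ 2 by rewrite -s2; ring.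
have -> : s ^+ 6 = (sg ^+ 2 * D) ^+ 3 by rewrite -s2; ring.
rewrite s2.
transitivity (3 * ((64 * A ^+ 2 * sg ^+ 4 * D ^+ 2 + 4 * B ^+ 2 * sg ^+ 2 * D) * (n * r ^+ 2) +
    64 * W ^+ 2 * sg ^+ 6 * D ^+ 2 * (n * D * q ^+ 2)) * g); first by ring.
by rewrite nr nq !mulr1.
Qed.

Lemma step_err_rate t : 0 < t -> Y * r <= 1 / 8 -> K * r ^+ 2 <= 1 / 2 ->
  n * step_err mu s (A * r) (B * r) (W * q) t <=
  13 * (8 * cube_rate r q + 4 * lr_rate r D) + (1 + t^-1) * lr_rate r D +
  t * (A ^+ 2 + 2 * B ^+ 2 + K).
Proof.
move=> t0 Yr Kr; rewrite /step_err /ell_err.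
have h1 := score_sqr_rate; have h2 := score_cube_rate; have h3 := full_lr_rate Yr Kr.
have h4 := score_est_rate.
set V2 := _ + _ + _ in h1 *; set V3 := score_cube_bound _ _ _ _ in h2 *.
set F := full_lr_bound _ _ _ _ in h3 *; set E := score_est_bound _ _ _ _ in h4 *.
have hv : n * (4 * F + 6 * E) <= lr_rate r D.
  rewrite /lr_rate -h4; lra.
have -> : n * (13 * (8 * V3 + 4 * (4 * F + 6 * E)) + (1 + t^-1) * (4 * F + 6 * E) + t * V2) =
  13 * (8 * (n * V3) + 4 * (n * (4 * F + 6 * E))) + (1 + t^-1) * (n * (4 * F + 6 * E)) + t * (n * V2).
  by ring.
rewrite h1 lerD2r lerD//; first lra.
by rewrite ler_wpM2l// addr_ge0// invr_ge0 ltW.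
Qed.

End step_err_rate.

Lemma cvgr0_sqrt {R : realType} (u : nat -> R) :
  u n @[n --> \oo] --> 0 -> Num.sqrt (u n) @[n --> \oo] --> 0.
Proof.
move=> u0; rewrite -[X in _ --> X](sqrtr0 R).
exact: (cvg_comp _ _ u0 (@sqrt_continuous R 0)).
Qed.

Lemma cvgr0X {R : realType} (u : nat -> R) k :
  u n @[n --> \oo] --> 0 -> u n ^+ k.+1 @[n --> \oo] --> 0.
Proof.
move=> u0; rewrite -[X in _ --> X](expr0n R k.+1).
exact: (cvg_comp _ _ u0 (@exprn_continuous R k.+1 0)).
Qed.

Lemma cvgr0_cube_rate {R : realType} (A B W lam : R) (r q : nat -> R) :
  r n @[n --> \oo] --> 0 -> q n @[n --> \oo] --> 0 ->
  cube_rate A B W lam (r n) (q n) @[n --> \oo] --> 0.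
Proof.
move=> r0 q0; apply: cvgr0Ml; apply: cvgr0D; last exact: cvgr0Ml.
by apply: cvgr0D; exact: cvgr0Ml.
Qed.

Lemma cvgr0_lr_rate {R : realType} (A B W lam sg : R) (r D : nat -> R) :
  r n @[n --> \oo] --> 0 -> D n @[n --> \oo] --> 0 ->
  lr_rate A B W lam sg (r n) (D n) @[n --> \oo] --> 0.
Proof.
move=> r0 D0; pose K := W ^+ 2 * lam; pose Y3 := (`|A| + `|B|) ^+ 3.
pose V := A ^+ 2 + 2 * B ^+ 2; pose g : R := gauss_moment 6.
(* Expanded into monomials, none of them constant. *)
have E n : lr_rate A B W lam sg (r n) (D n) = 480 * Y3 * r n +
    (24 * K ^+ 2 + 48 * (K * V)) * r n ^+ 2 + 1920 * (K * Y3) * r n ^+ 3 +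
    96 * (K ^+ 2 * V) * r n ^+ 4 + 3840 * (K ^+ 2 * Y3) * r n ^+ 5 +
    72 * g * B ^+ 2 * sg ^+ 2 * D n +
    1152 * g * (A ^+ 2 * sg ^+ 4 + W ^+ 2 * sg ^+ 6) * D n ^+ 2.
  by rewrite /lr_rate -/g -/K /Y3 /V; ring.
under eq_fun do rewrite E.
by repeat apply: cvgr0D; apply: cvgr0Ml => //; exact: cvgr0X.
Qed.

(** * Rates along the sequence of experiments *)

Section step_sequence.
Context {R : realType}.
Notation RR := (measurableTypeR R).
Variables (Delta : nat -> R) (A B W th lam sg : R).
Hypotheses (hD : forall n, 0 < Delta n <= 1) (hD0 : Delta n @[n --> \oo] --> 0).
Hypothesis hDinf : (n%:R * Delta n) @[n --> \oo] --> +oo.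
Hypotheses (lam0 : 0 < lam) (sg0 : 0 < sg).

Let rt (n : nat) : R := (Num.sqrt n%:R)^-1.
Let qt (n : nat) : R := (Num.sqrt (n%:R * Delta n))^-1.

(** The thresholds are those of the cubic Gaussian bound, of the quadratic bound on the exponential,
    and of positivity of the perturbed intensity. *)
Definition small_step n := [&& (0 < n)%N, (`|A| + `|B|) * rt n <= 1 / 8,
  W ^+ 2 * lam * rt n ^+ 2 <= 1 / 2 & `|W| * qt n <= 1 / 2].

(* For small [n] the perturbed parameters may be negative; the perturbation is then switched
   off, so that the one-step laws below are defined for every [n]. *)
Definition rate_r n : R := if small_step n then rt n else 0.
Definition rate_q n : R := if small_step n then qt n else 0.

Lemma cvg_rt : rt n @[n --> \oo] --> 0.
Proof.
have /cvgr0_sqrt : (n%:R : R)^-1 @[n --> \oo] --> 0.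
  by apply/gtr0_cvgV0; [exists 1%N => // n /= n0; rewrite ltr0n|exact: cvgr_idn].
by under eq_fun do rewrite sqrtrV//.
Qed.

Lemma cvg_qt : qt n @[n --> \oo] --> 0.
Proof.
have /cvgr0_sqrt : (n%:R * Delta n)^-1 @[n --> \oo] --> 0.
  apply/gtr0_cvgV0 => //; exists 1%N => // n /= n0; rewrite mulr_gt0 ?ltr0n//.
  by have /andP[] := hD n.
have nD n : 0 <= n%:R * Delta n by rewrite mulr_ge0// ltW//; have /andP[] := hD n.
by under eq_fun do rewrite sqrtrV//.
Qed.

Lemma near_small_step : \forall n \near \oo, small_step n.
Proof.
have near_le (u : nat -> R) (e : R) : u n @[n --> \oo] --> 0 -> 0 < e -> \forall n \near \oo, u n <= e.
  move=> u0 e0; have /cvgr0Pnorm_le /(_ _ e0) := u0.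
  by apply: filterS => n; apply: le_trans (ler_norm _).
have r2 : rt n ^+ 2 @[n --> \oo] --> 0 by exact: cvgr0X cvg_rt.
have n0 : \forall n \near \oo, (0 < n)%N by exists 1%N.
have e8 : 0 < 1 / 8 :> R by lra.
have e2 : 0 < 1 / 2 :> R by lra.
have h1 := near_le _ _ (cvgr0Ml (`|A| + `|B|) cvg_rt) e8.
have h2 := near_le _ _ (cvgr0Ml (W ^+ 2 * lam) r2) e2.
have h3 := near_le _ _ (cvgr0Ml `|W| cvg_qt) e2.
near=> n; apply/and4P; split; near: n => //.
Unshelve. all: by end_near. Qed.

Lemma rate_r_ge0 n : 0 <= rate_r n.
Proof. by rewrite /rate_r; case: ifP => // _; rewrite invr_ge0 sqrtr_ge0. Qed.

Lemma rate_q_ge0 n : 0 <= rate_q n.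
Proof. by rewrite /rate_q; case: ifP => // _; rewrite invr_ge0 sqrtr_ge0. Qed.

Lemma cvg_rate_r : rate_r n @[n --> \oo] --> 0.
Proof.
apply: cvgr0_le cvg_rt; near=> n; rewrite /rate_r; case: ifP => _.
  by rewrite ger0_norm// invr_ge0 sqrtr_ge0.
by rewrite normr0 invr_ge0 sqrtr_ge0.
Unshelve. all: by end_near. Qed.

Lemma cvg_rate_q : rate_q n @[n --> \oo] --> 0.
Proof.
apply: cvgr0_le cvg_qt; near=> n; rewrite /rate_q; case: ifP => _.
  by rewrite ger0_norm// invr_ge0 sqrtr_ge0.
by rewrite normr0 invr_ge0 sqrtr_ge0.
Unshelve. all: by end_near. Qed.

Lemma small_rate_r n : (`|A| + `|B|) * rate_r n <= 1 / 8 /\ W ^+ 2 * lam * rate_r n ^+ 2 <= 1 / 2.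
Proof.
by rewrite /rate_r; case: ifPn => [/and4P[]//|_]; rewrite expr0n /= !mulr0; split; lra.
Qed.

Lemma pmuln n : 0 < lam * Delta n.
Proof. by rewrite mulr_gt0//; have /andP[] := hD n. Qed.

Lemma step_sd_gt0 n : 0 < sg * Num.sqrt (Delta n).
Proof. by rewrite mulr_gt0// sqrtr_gt0; have /andP[] := hD n. Qed.

Lemma rate_c_gt n : 0 < 1 + W * rate_q n.
Proof.
have : `|W * rate_q n| <= 1 / 2.
  rewrite normrM (ger0_norm (rate_q_ge0 n)) /rate_q.
  by case: ifPn => [/and4P[]//|_]; rewrite mulr0; lra.
by rewrite ler_norml; lra.
Qed.

Let Br8 n : `|B * rate_r n| <= 1 / 8.
Proof.
have [h _] := small_rate_r n; rewrite normrM (ger0_norm (rate_r_ge0 n)).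
by apply: le_trans h; rewrite ler_wpM2r ?rate_r_ge0// lerDr.
Qed.

Lemma rate_e_gt n : 0 < 1 + B * rate_r n.
Proof. by have := Br8 n; rewrite ler_norml; lra. Qed.

Lemma rate_e_lt n : (1 + B * rate_r n) ^+ 2 < 2.
Proof. by have := Br8 n; rewrite ler_norml; nra. Qed.

Definition ell_law_seq n : probability RR R :=
  @ell_law R (lam * Delta n) ((th - lam) * Delta n) (sg * Num.sqrt (Delta n))
    (A * rate_r n) (B * rate_r n) (W * rate_q n)
    (pmuln n) (step_sd_gt0 n) (rate_c_gt n) (rate_e_gt n).

Definition step_lr_seq n : R -> R :=
  @step_lr R (lam * Delta n) ((th - lam) * Delta n) (sg * Num.sqrt (Delta n))
    (A * rate_r n) (B * rate_r n) (W * rate_q n).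

(** The form [z^T Gamma z] in coordinates that diagonalise it, equal to [n] times the variance of
    the one-step score. *)
Definition lan_info : R := A ^+ 2 + 2 * B ^+ 2 + W ^+ 2 * lam.

Lemma lan_info_ge0 : 0 <= lan_info.
Proof.
have := sqr_ge0 A; have := sqr_ge0 B; have := mulr_ge0 (sqr_ge0 W) (ltW lam0).
by rewrite /lan_info; lra.
Qed.

Lemma lan_info_eq0 : lan_info = 0 -> [/\ A = 0, B = 0 & W = 0].
Proof.
rewrite /lan_info => h; have a0 := sqr_ge0 A; have b0 := sqr_ge0 B.
have w0 := mulr_ge0 (sqr_ge0 W) (ltW lam0).
have sq0 (x : R) : x ^+ 2 = 0 -> x = 0 by move=> /eqP; rewrite sqrf_eq0 => /eqP.
split; apply: sq0; [lra|lra|].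
by apply: (mulIf (lt0r_neq0 lam0)); rewrite mul0r; lra.
Qed.

Let err n t := step_err (lam * Delta n) (sg * Num.sqrt (Delta n))
    (A * rate_r n) (B * rate_r n) (W * rate_q n) t.

Let rate t n := 13 * (8 * cube_rate A B W lam (rate_r n) (rate_q n) +
  4 * lr_rate A B W lam sg (rate_r n) (Delta n)) +
  (1 + t^-1) * lr_rate A B W lam sg (rate_r n) (Delta n).

Lemma rate_r_sqr n : small_step n -> n%:R * rate_r n ^+ 2 = 1.
Proof.
move=> sn; rewrite /rate_r sn /rt; have /and4P[n0 _ _ _] := sn.
by rewrite exprVn sqr_sqrtr ?ler0n// divff// pnatr_eq0 -lt0n.
Qed.

Lemma rate_q_sqr n : small_step n -> n%:R * Delta n * rate_q n ^+ 2 = 1.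
Proof.
move=> sn; rewrite /rate_q sn /qt; have /and4P[n0 _ _ _] := sn.
have Dn : 0 < n%:R * Delta n by rewrite mulr_gt0 ?ltr0n//; have /andP[] := hD n.
by rewrite exprVn sqr_sqrtr ?ltW// divff// gt_eqF.
Qed.

Let err_rate t n : 0 < t -> small_step n -> n%:R * err n t <= rate t n + t * lan_info.
Proof.
move=> t0 sn; have [Yr Kr] := small_rate_r n; have /andP[D0 D1] := hD n.
have nR : 0 < n%:R :> R by rewrite ltr0n; have /and4P[] := sn.
exact: (step_err_rate sg lam0 nR (rate_r_ge0 n) (rate_q_ge0 n) D0 D1
  (rate_r_sqr sn) (rate_q_sqr sn) t0 Yr Kr).
Qed.

Let cvg_rate t : rate t n @[n --> \oo] --> 0.
Proof.
have hr := cvg_rate_r; have hl := cvgr0_lr_rate A B W lam sg hr hD0.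
apply: cvgr0D; last exact: cvgr0Ml.
apply: cvgr0Ml; apply: cvgr0D; apply: cvgr0Ml => //.
exact: cvgr0_cube_rate hr cvg_rate_q.
Qed.

Let cvgr0_rate (u : nat -> R) :
  (forall t n, 0 < t -> small_step n -> `|u n| <= n%:R * err n t) -> u n @[n --> \oo] --> 0.
Proof.
move=> ue; apply/cvgr0Pnorm_le => e e0.
have s20 := lan_info_ge0.
(* The weight [t] is fixed before [n]; the summand 1 keeps the denominator positive when [lan_info]
   is 0. *)
pose t := e / 2 / (1 + lan_info).
have t0 : 0 < t by rewrite /t divr_gt0//; lra.
have te : t * lan_info <= e / 2.
  by rewrite /t mulrAC ler_pdivrMr; [rewrite ler_wpM2l//; lra|lra].
have e20 : 0 < e / 2 by lra.
have /cvgr0Pnorm_le /(_ _ e20) := cvg_rate t.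
apply: filterS2 near_small_step => n sn rn.
apply: le_trans (ue t n t0 sn) _; apply: le_trans (err_rate t0 sn) _.
by have := ler_norm (rate t n); lra.
Qed.

Lemma third_moment_ell_law_seq n : third_moment (ell_law_seq n).
Proof. exact: third_moment_ell_law. Qed.

Let moments n t (t0 : 0 < t) := @ell_law_moments R (lam * Delta n) ((th - lam) * Delta n)
  (sg * Num.sqrt (Delta n)) (A * rate_r n) (B * rate_r n) (W * rate_q n)
    (pmuln n) (step_sd_gt0 n) (rate_c_gt n) (rate_e_gt n) t (rate_e_lt n) t0.

Let infoE n : small_step n -> n%:R * ((A * rate_r n) ^+ 2 + 2 * (B * rate_r n) ^+ 2 +
  (W * rate_q n) ^+ 2 * (lam * Delta n)) = lan_info.
Proof.
move=> sn; have /andP[D0 D1] := hD n.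
have nR : 0 < n%:R :> R by rewrite ltr0n; have /and4P[] := sn.
exact: (score_sqr_rate A B W lam nR (rate_r_sqr sn) (rate_q_sqr sn)).
Qed.

Lemma cvg_ell_law_mean : n%:R * \int[ell_law_seq n]_y y + lan_info / 2 @[n --> \oo] --> 0.
Proof.
apply: cvgr0_rate => t n t0 sn; rewrite -(infoE sn) -mulrA -mulrDr normrM ger0_norm ?ler0n//.
by rewrite ler_wpM2l ?ler0n//; have [] := moments n t0.
Qed.

Lemma cvg_ell_law_sqr : n%:R * \int[ell_law_seq n]_y (y ^+ 2) - lan_info @[n --> \oo] --> 0.
Proof.
apply: cvgr0_rate => t n t0 sn; rewrite -(infoE sn) -mulrBr normrM ger0_norm ?ler0n//.
by rewrite ler_wpM2l ?ler0n//; have [] := moments n t0.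
Qed.

Lemma cvg_ell_law_cube : n%:R * \int[ell_law_seq n]_y (`|y| ^+ 3) @[n --> \oo] --> 0.
Proof.
apply: cvgr0_rate => t n t0 sn; rewrite normrM ger0_norm ?ler0n//.
rewrite ler_wpM2l ?ler0n// ger0_norm; first by have [] := moments n t0.
by apply: Rintegral_ge0 => y _; rewrite exprn_ge0.
Qed.

Definition step_bad n := step_law (lam * Delta n)
  [set w | (1 / 2 < `|step_lr_seq n (obs ((th - lam) * Delta n) (sg * Num.sqrt (Delta n)) w) - 1|)%R].

Lemma cvg_step_bad : n%:R * fine (step_bad n) @[n --> \oo] --> 0.
Proof.
apply: cvgr0_rate => t n t0 sn; rewrite normrM ger0_norm ?ler0n//.
rewrite ler_wpM2l ?ler0n// ger0_norm ?fine_ge0//.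
have [_ _ _ h] := moments n t0.
by rewrite -lee_fin fineK//; rewrite ge0_fin_numE//; apply: le_lt_trans h _; rewrite ltry.
Qed.

End step_sequence.

(** * Gaussian comparison *)

Section gaussian_steps.
Context {R : realType}.
Notation RR := (measurableTypeR R).
Notation N01 := (normal_prob (0 : R) 1).
Variable I : R.
Hypothesis I0 : 0 <= I.

Let r (n : nat) : R := (Num.sqrt n%:R)^-1.

(** Under the standard normal law, this is the increment of a Brownian motion with drift [- 1 / 2]
    over a cell of length [I / n]. *)
Definition gauss_step n (x : RR) : RR := Num.sqrt I * r n * x + - (I / 2 * r n ^+ 2).

Lemma measurable_gauss_step n : measurable_fun setT (gauss_step n).
Proof. by apply: measurable_funD => //; exact: measurable_funM. Qed.

Definition gauss_seq n : probability RR R := law N01 (measurable_gauss_step n).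

Let x1 := has_int_gauss (R := R) 1.
Let x2 := has_int_gauss (R := R) 2.
Let x6 := has_int_gauss (R := R) 6.
Let one := has_int_cst N01.

Lemma has_int_gauss_seq n : has_int (gauss_seq n) id (- (I / 2 * r n ^+ 2)).
Proof.
apply: has_int_law => //.
apply: (has_int_ext (has_intD (has_intZ (Num.sqrt I * r n) x1) (one (- (I / 2 * r n ^+ 2))))) => //.
by rewrite gauss_moment1 mulr0 add0r.
Qed.

Lemma has_int_gauss_seq_sqr n :
  has_int (gauss_seq n) (fun y => y ^+ 2) (I * r n ^+ 2 + I ^+ 2 / 4 * r n ^+ 4).
Proof.
apply: has_int_law; first exact: measurable_funX.
pose c := I / 2 * r n ^+ 2; pose b := Num.sqrt I * r n.
have h := has_intD (has_intD (has_intZ (b ^+ 2) x2) (has_intZ (- 2 * b * c) x1)) (one (c ^+ 2)).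
apply: (has_int_ext h) => [x|]; first by rewrite /gauss_step -/c -/b; ring.
by rewrite gauss_moment1 gauss_moment2 /c /b exprMn sqr_sqrtr//; field.
Qed.

Lemma has_int_gauss_seq_cube n : exists2 v, has_int (gauss_seq n) (fun y => `|y| ^+ 3) v &
  0 <= v <= 4 * (Num.sqrt I ^+ 3 * (1 + gauss_moment 6) * r n ^+ 3 + (I / 2) ^+ 3 * r n ^+ 6).
Proof.
pose c := I / 2 * r n ^+ 2; pose b := Num.sqrt I * r n.
have b0 : 0 <= b by rewrite mulr_ge0 ?sqrtr_ge0// invr_ge0 sqrtr_ge0.
have c0 : 0 <= c by rewrite mulr_ge0 ?sqr_ge0// divr_ge0.
have h := has_intZ 4 (has_intD (has_intZ (b ^+ 3) (has_intD (one 1) x6)) (one (c ^+ 3))).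
have le (x : R) : `|gauss_step n x| ^+ 3 <= 4 * (b ^+ 3 * (1 + x ^+ 6) + c ^+ 3).
  have y0 : 0 <= `|x| by [].
  have -> : x ^+ 6 = (`|x| ^+ 3) ^+ 2 by rewrite -exprM -[6%N]/(2 * 3)%N exprM -(real_normK (num_real x)) -exprM.
  have x3 : `|x| ^+ 3 <= 1 + (`|x| ^+ 3) ^+ 2 by have := sqr_ge0 (`|x| ^+ 3 - 1); have := exprn_ge0 3 y0; nra.
  have bx : b ^+ 3 * `|x| ^+ 3 <= b ^+ 3 * (1 + (`|x| ^+ 3) ^+ 2) by rewrite ler_wpM2l// exprn_ge0.
  have gx : `|gauss_step n x| <= b * `|x| + c.
    by apply: le_trans (ler_normD _ _) _; rewrite normrN (ger0_norm c0) normrM (ger0_norm b0).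
  have d0 : 0 <= b * `|x| by rewrite mulr_ge0.
  have g3 : `|gauss_step n x| ^+ 3 <= (b * `|x| + c) ^+ 3 by rewrite lerXn2r// nnegrE// addr_ge0.
  have : (b * `|x| + c) ^+ 3 <= 4 * ((b * `|x|) ^+ 3 + c ^+ 3).
    by set d := b * `|x| in d0 *; have := mulr_ge0 (addr_ge0 d0 c0) (sqr_ge0 (d - c)); nra.
  by rewrite exprMn; lra.
have m3 : measurable_fun setT (fun y : RR => `|y| ^+ 3 : R).
  by apply: measurable_funX; exact: normr_measurable.
have hv := has_int_dom (measurableT_comp m3 (measurable_gauss_step n)) _ h.
exists (\int[N01]_x (`|gauss_step n x| ^+ 3)).
  by apply: has_int_law => //; apply: hv => x /=; rewrite normrX normr_id.
apply/andP; split; first by apply: Rintegral_ge0 => x _; rewrite exprn_ge0.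
rewrite [X in _ <= X](_ : _ = 4 * (b ^+ 3 * (1 + gauss_moment 6) + c ^+ 3)); last by rewrite /b /c; ring.
by apply: (has_int_le (hv _) h) => [x|x]; rewrite /= ?normrX ?normr_id.
Qed.

Lemma third_moment_gauss_seq n : third_moment (gauss_seq n).
Proof.
have [h1 _] := has_int_gauss_seq n; have [h2 _] := has_int_gauss_seq_sqr n.
by have [v [h3 _] _] := has_int_gauss_seq_cube n; split.
Qed.

Let nr n : (0 < n)%N -> n%:R * r n ^+ 2 = 1.
Proof.
by move=> n0; rewrite exprVn sqr_sqrtr ?ler0n// divff// pnatr_eq0 -lt0n.
Qed.

Let n_gt0 : \forall n \near \oo, (0 < n)%N. Proof. by exists 1%N. Qed.

Let r0 : r n @[n --> \oo] --> 0. Proof. exact: cvg_rt. Qed.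

Lemma cvg_gauss_seq_mean : n%:R * \int[gauss_seq n]_y y + I / 2 @[n --> \oo] --> 0.
Proof.
apply: cvg_near_cst; apply: filterS n_gt0 => n n0.
rewrite (proj2 (has_int_gauss_seq n)) (_ : _ * - _ = - (I / 2) * (n%:R * r n ^+ 2)); last by ring.
by rewrite nr// mulr1 addNr.
Qed.

Lemma cvg_gauss_seq_sqr : n%:R * \int[gauss_seq n]_y (y ^+ 2) - I @[n --> \oo] --> 0.
Proof.
apply: (@cvgr0_le _ _ (fun n => I ^+ 2 / 4 * r n ^+ 2)); last exact: cvgr0Ml (cvgr0X 1 r0).
apply: filterS n_gt0 => n n0.
rewrite (proj2 (has_int_gauss_seq_sqr n)).
rewrite (_ : n%:R * (I * r n ^+ 2 + I ^+ 2 / 4 * r n ^+ 4) = (I + I ^+ 2 / 4 * r n ^+ 2) * (n%:R * r n ^+ 2)); last by ring.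
by rewrite nr// mulr1 addrAC subrr add0r ger0_norm// mulr_ge0 ?sqr_ge0// divr_ge0// sqr_ge0.
Qed.

Lemma cvg_gauss_seq_cube : n%:R * \int[gauss_seq n]_y (`|y| ^+ 3) @[n --> \oo] --> 0.
Proof.
apply: (@cvgr0_le _ _ (fun n => 4 * (Num.sqrt I ^+ 3 * (1 + gauss_moment 6) * r n +
  (I / 2) ^+ 3 * r n ^+ 4))); last first.
  by apply: cvgr0Ml; apply: cvgr0D; apply: cvgr0Ml => //; exact: cvgr0X.
apply: filterS n_gt0 => n n0.
have [v [_ ->] /andP[v0 vle]] := has_int_gauss_seq_cube n.
rewrite ger0_norm; last by rewrite mulr_ge0.
apply: (le_trans (ler_wpM2l (ler0n _ n) vle)).
rewrite (_ : n%:R * _ = 4 * (Num.sqrt I ^+ 3 * (1 + gauss_moment 6) * r n +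
  (I / 2) ^+ 3 * r n ^+ 4) * (n%:R * r n ^+ 2)); last by ring.
by rewrite nr// mulr1.
Qed.

End gaussian_steps.

Lemma eq_law_Rintegral {d1 d2} {T1 : measurableType d1} {T2 : measurableType d2} {R : realType}
  (P : probability T1 R) (Q : probability T2 R)
  (U : T1 -> measurableTypeR R) (V : T2 -> measurableTypeR R) (f : measurableTypeR R -> R) :
  measurable_fun setT U -> measurable_fun setT V -> bmeas f ->
  (forall A, measurable A -> P (U @^-1` A) = Q (V @^-1` A)) ->
  \int[P]_w f (U w) = \int[Q]_w f (V w).
Proof.
move=> mU mV bf UV; rewrite -(Rintegral_law P mU bf) -(Rintegral_law Q mV bf).
rewrite /Rintegral; congr fine; apply: eq_measure_integral => A mA _; exact: UV.
Qed.

(** * Brownian increments on a grid *)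

Section brownian_sum.
Context {R : realType} {d} {T : measurableType d} (P : probability T R).
Notation RR := (measurableTypeR R).
Variables (B N : R -> T -> R) (lam : R).
Hypothesis hBN : BM_indep_Poisson P B N lam.

Lemma measurable_BM t : measurable_fun setT (B t : T -> RR). Proof. by have [h _] := hBN; exact: h. Qed.

Lemma measurable_PP t : measurable_fun setT (N t : T -> RR). Proof. by have [_ [h _]] := hBN; exact: h. Qed.

Lemma BM_PP0 w : B 0 w = 0 /\ N 0 w = 0. Proof. by have [_ [_ []]] := hBN. Qed.

Lemma grid_increments n h : 0 < h ->
  [/\ mutually_independent P
           (fun j : ('I_n + 'I_n)%type => match j with
              | inl i => fun w => B (i.+1%:R * h) w - B (i%:R * h) w
              | inr i => fun w => N (i.+1%:R * h) w - N (i%:R * h) w end),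
         (forall i, (i < n)%N ->
            has_normal_law P (fun w => B (i.+1%:R * h) w - B (i%:R * h) w) 0 h) &
         (forall i, (i < n)%N ->
            has_poisson_law P (fun w => N (i.+1%:R * h) w - N (i%:R * h) w) (lam * h))].
Proof.
move=> h0; have [_ [_ [_ [_ [_ [_ [_ H]]]]]]] := hBN.
have [|i ni|H1 H2 H3] := H n (fun i => i%:R * h).
- by rewrite mul0r.
- by rewrite ltr_pM2r// ltr_nat.
have hE i : i.+1%:R * h - i%:R * h = h by rewrite -mulrBl -natrB// subSn// subnn mul1r.
split; first exact: H1.
- by move=> i ni; have := H2 i ni; rewrite hE.
- by move=> i ni; have := H3 i ni; rewrite hE.
Qed.

(** The increments over a grid of [[0, I]] telescope, so the [n]-fold Gaussian convolution is
    identified through the given Brownian motion itself, at time [I]. *)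
Lemma iter_conv_gauss_seq (I : R) n (f : RR -> R) : 0 < I -> (0 < n)%N -> bmeas f ->
  iter n (conv (gauss_seq I n)) f 0 = \int[P]_w f (B I w - I / 2).
Proof.
move=> I0 n0 bf; have nR : 0 < n%:R :> R by rewrite ltr0n.
pose h := I / n%:R; have h0 : 0 < h by rewrite divr_gt0.
pose U k w : RR := B (k.+1%:R * h) w - B (k%:R * h) w.
pose V k w : RR := N (k.+1%:R * h) w - N (k%:R * h) w.
have mU k : measurable_fun setT (U k) by apply: measurable_funB; exact: measurable_BM.
have mV k : measurable_fun setT (V k) by apply: measurable_funB; exact: measurable_PP.
have [ind hU _] := grid_increments n h0.
pose c : R := I / 2 * ((Num.sqrt n%:R)^-1) ^+ 2.
pose phi (z : RR * RR) : RR := z.1 + - c.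
have mphi : measurable_fun setT phi by apply: measurable_funD.
pose zeta k w : RR := phi (U k w, V k w).
have mz k : measurable_fun setT (zeta k).
  by apply: (measurableT_comp mphi); exact: measurable_fun_pair.
have sqE : Num.sqrt h = Num.sqrt I * (Num.sqrt n%:R)^-1 by rewrite /h sqrtrM ?ltW// sqrtrV.
have cE : c = I / 2 / n%:R by rewrite /c exprVn sqr_sqrtr// ler0n.
have lawz k A : (k < n)%N -> measurable A -> P (zeta k @^-1` A) = gauss_seq I n A.
  move=> kn mA; pose A' : set RR := (fun x : RR => x + - c : RR) @^-1` A.
  have mA' : measurable A'.
    rewrite -[A']setTI.
    suff m : measurable_fun setT (fun x : RR => x + - c : RR) by exact: m.
    exact: measurable_funD.
  have := hU k kn _ mA'; rewrite gt_eqF// normal_prob_affine ?sqrtr_gt0// => e.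
  have -> : zeta k @^-1` A = U k @^-1` A' by [].
  rewrite e lawE; congr (_ _).
  by apply/seteqP; split => x; rewrite /A' /gauss_step /= sqE addr0.
have indz k : (k < n)%N -> forall A C, measurable A -> measurable C ->
    P ((fun w => \sum_(j < k) zeta j w) @^-1` A `&` zeta k @^-1` C) =
    (P ((fun w => (\sum_(j < k) zeta j w)%R) @^-1` A) * gauss_seq I n C)%E.
  move=> kn A C mA mC; rewrite -(lawz k C kn mC).
  exact: (@indep_partial_sum _ _ _ P n U V phi mU mV mphi ind k A C kn mA mC).
rewrite -(Rintegral_sum_indep mz indz bf).
apply: eq_Rintegral => w _; congr f.
have tele m : \sum_(j < m) zeta j w = B (m%:R * h) w - B (0%:R * h) w - m%:R * c.
  elim: m => [|m IH]; first by rewrite big_ord0 subrr mul0r subr0.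
  by rewrite big_ord_recr /= IH /zeta /phi /U /= [m.+1%:R * c]mulr_natl mulrS -mulr_natl; ring.
rewrite tele mul0r (proj1 (BM_PP0 w)) subr0 cE.
by rewrite /h [n%:R * (I / _)]mulrC divfK ?gt_eqF// [n%:R * (_ / _)]mulrC divfK ?gt_eqF.
Qed.

Lemma BM_normal_law t : 0 < t -> has_normal_law P (B t) 0 t.
Proof.
move=> t0; have [_ /(_ 0%N isT) h _] := grid_increments 1 t0.
move=> A mA; rewrite -h//; congr (P _); apply/seteqP.
by split => w /=; rewrite mul1r mul0r (proj1 (BM_PP0 w)) subr0.
Qed.

End brownian_sum.

Lemma trans_densE {R : realType} (th sg lam D x y : R) : 0 < D -> 0 < sg -> 0 < lam ->
  trans_dens th sg lam D x y = mix_dens (lam * D) ((th - lam) * D) (sg * Num.sqrt D) (y - x).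
Proof.
move=> D0 sg0 lam0; rewrite /trans_dens /mix_dens; congr (limn (series _)).
apply/funext => k; rewrite /dens_term /mix_term /poisson_pmf mulr_gt0//.
have s0 : sg * Num.sqrt D != 0 by rewrite mulf_neq0 ?gt_eqF// sqrtr_gt0.
have s2 : (sg * Num.sqrt D) ^+ 2 = sg ^+ 2 * D by rewrite exprMn sqr_sqrtr// ltW.
rewrite normal_pdfE// /normal_peak /normal_fun s2.
rewrite (_ : sg ^+ 2 * D * pi *+ 2 = 2 * pi * sg ^+ 2 * D); last by rewrite -mulr_natl; ring.
rewrite (_ : (sg ^+ 2 * D) *+ 2 = 2 * sg ^+ 2 * D); last by rewrite -mulr_natl; ring.
rewrite (_ : y - x - ((th - lam) * D + k%:R) = y - x - (th - lam) * D - k%:R); last by ring.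
ring.
Qed.

(** * Increments of the observed process *)

Section observed_increments.
Context {R : realType} {d} {T : measurableType d} (P : probability T R).
Notation RR := (measurableTypeR R).
Variables (B N : R -> T -> R) (lam : R).
Hypothesis hBN : BM_indep_Poisson P B N lam.
Variables (a sg h : R).
Hypotheses (lam0 : 0 < lam) (h0 : 0 < h).

Let U k w : RR := B (k.+1%:R * h) w - B (k%:R * h) w.
Let V k w : RR := N (k.+1%:R * h) w - N (k%:R * h) w.

Definition increment k w : R := sg * (B (k.+1%:R * h) w - B (k%:R * h) w) +
  (a + (N (k.+1%:R * h) w - N (k%:R * h) w)).

Let mU k : measurable_fun setT (U k).
Proof. by apply: measurable_funB; exact: (measurable_BM hBN). Qed.

Let mV k : measurable_fun setT (V k).
Proof. by apply: measurable_funB; exact: (measurable_PP hBN). Qed.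

Let psi (z : RR * RR) : RR := sg * z.1 + (a + z.2).

Let mpsi : measurable_fun setT psi.
Proof.
apply: measurable_funD; first exact: measurable_funM.
exact: measurable_funD.
Qed.

Lemma measurable_increment k : measurable_fun setT (increment k : T -> RR).
Proof.
apply: (measurableT_comp mpsi (_ : measurable_fun setT (fun w => (U k w, V k w)))).
exact: measurable_fun_pair.
Qed.

(** Monotonicity of the paths makes the difference of two natural values natural. *)
Let natV k w : exists j : nat, V k w = j%:R.
Proof.
have [_ [_ [_ [_ [nN [mono _]]]]]] := hBN.
have t0 i : 0 <= i%:R * h by rewrite mulr_ge0// ltW.
have [i Ei] := nN w _ (t0 k); have [j Ej] := nN w _ (t0 k.+1).
have := mono w _ _ (t0 k) (_ : k%:R * h <= k.+1%:R * h); rewrite ler_pM2r// ler_nat leqnSn.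
move=> /(_ isT); rewrite Ei Ej ler_nat => ij.
by exists (j - i)%N; rewrite /V Ei Ej natrB.
Qed.

Lemma increment_law n k C : (k < n)%N -> measurable C ->
  P ((increment k : T -> RR) @^-1` C) = step_law (lam * h) (obs a (sg * Num.sqrt h) @^-1` C).
Proof.
move=> kn mC; have [ind hU hV] := grid_increments hBN n h0.
have mpC : measurable (psi @^-1` C) by rewrite -[X in measurable X]setTI; exact: mpsi.
have := step_lawE h0 (mulr_gt0 lam0 h0) (mU k) (mV k) (natV k) (hU k kn) (hV k kn) _ mpC.
move=> /(_ (fun X Y mX mY => @indep_pair_now _ _ _ P n U V ind k X Y kn mX mY)).
have -> : increment k @^-1` C = (fun w => (U k w, V k w)) @^-1` (psi @^-1` C) by [].
move=> ->; congr (_ _).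
by apply/seteqP; split => w /=; rewrite /psi /obs /= mulrA.
Qed.

Lemma Rintegral_increments n (g : RR -> RR) (nu : probability RR R) (f : RR -> R) :
  measurable_fun setT g -> bmeas f ->
  (forall C, measurable C ->
    nu C = step_law (lam * h) ((fun z => g (obs a (sg * Num.sqrt h) z)) @^-1` C)) ->
  \int[P]_w f (\sum_(k < n) g (increment k w)) = iter n (conv nu) f 0.
Proof.
move=> mg bf nuE; have [ind _ _] := grid_increments hBN n h0.
pose phi (z : RR * RR) : RR := g (psi z).
have mphi : measurable_fun setT phi by exact: measurableT_comp mg mpsi.
pose zeta k w : RR := g (increment k w).
have mz k : measurable_fun setT (zeta k) by exact: measurableT_comp mg (measurable_increment k).
have lawz k C : (k < n)%N -> measurable C -> P (zeta k @^-1` C) = nu C.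
  move=> kn mC; rewrite nuE//; apply: (increment_law (C := g @^-1` C) kn).
  by rewrite -[X in measurable X]setTI; exact: mg.
have indz k : (k < n)%N -> forall A C, measurable A -> measurable C ->
    P ((fun w => \sum_(j < k) zeta j w) @^-1` A `&` zeta k @^-1` C) =
    (P ((fun w => (\sum_(j < k) zeta j w)%R) @^-1` A) * nu C)%E.
  move=> kn A C mA mC; rewrite -(lawz k C kn mC).
  exact: (@indep_partial_sum _ _ _ P n U V phi mU mV mphi ind k A C kn mA mC).
exact: (Rintegral_sum_indep mz indz bf).
Qed.

End observed_increments.

(** Off the bad events the two variables coincide; on them the difference is at most [2 * M], and a
    union bound counts [n] events of probability [p]. *)
Lemma Rintegral_off_bad {d} {T : measurableType d} {R : realType} (P : probability T R)
  (f : measurableTypeR R -> R) (M p : R) (Y S : T -> measurableTypeR R) n (bad : nat -> set T) :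
  bmeas f -> (forall x, `|f x| <= M) -> measurable_fun setT Y -> measurable_fun setT S ->
  (forall k, measurable (bad k)) ->
  (forall w, (forall k, (k < n)%N -> ~ bad k w) -> Y w = S w) ->
  (forall k, (k < n)%N -> fine (P (bad k)) = p) ->
  `|\int[P]_w f (Y w) - \int[P]_w f (S w)| <= 2 * M * (n%:R * p).
Proof.
move=> bf fM mY mS mbad YS Pbad.
have M0 : 0 <= M by apply: le_trans (fM 0).
have hY : has_int P (fun w => f (Y w)) (\int[P]_w f (Y w)).
  by split=> //; exact: (bmeas_integrable P (bmeas_comp bf mY)).
have hS : has_int P (fun w => f (S w)) (\int[P]_w f (S w)).
  by split=> //; exact: (bmeas_integrable P (bmeas_comp bf mS)).
have hbad m : (m <= n)%N ->
    has_int P (fun w => \sum_(k < m) (\1_(bad k) w : R)) (m%:R * p).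
  elim: m => [_|m IH mn].
    by apply: (has_int_ext (has_int_cst P 0)) => [w|]; rewrite ?big_ord0 ?mul0r.
  have h : has_int P (\1_(bad m) : T -> R) p.
    rewrite -(Pbad m mn); apply: has_int_ge0 => //.
      by rewrite integral_indic// setIT fineK// fin_num_measure.
  apply: (has_int_ext (has_intD (IH (ltnW mn)) h)) => [w|]; first by rewrite big_ord_recr.
  by rewrite -addn1 natrD mulrDl mul1r.
have hB := has_intZ (2 * M) (hbad n (leqnn n)).
have le w : `|f (Y w) - f (S w)| <= 2 * M * \sum_(k < n) (\1_(bad k) w : R).
  have ge0 k : 0 <= \1_(bad k) w :> R by [].
  have [[k [kn bk]]|nb] := pselect (exists k, (k < n)%N /\ bad k w).
    apply: (@le_trans _ _ (2 * M * 1)).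
      by have := ler_normB (f (Y w)) (f (S w)); have := fM (Y w); have := fM (S w); lra.
    rewrite ler_wpM2l ?mulr_ge0// (bigD1 (Ordinal kn))//= indicE mem_set//=.
    by rewrite lerDl sumr_ge0.
  rewrite YS ?subrr ?normr0; first by rewrite mulr_ge0 ?mulr_ge0// sumr_ge0.
  by move=> k kn bk; apply: nb; exists k.
rewrite ler_norml; apply/andP; split.
  rewrite lerNl opprB; apply: (has_int_le (has_intB hS hY) hB) => w.
  by have := le w; rewrite ler_norml; lra.
by apply: (has_int_le (has_intB hY hS) hB) => w; have := le w; rewrite ler_norml; lra.
Qed.

Lemma ln_prod {R : realType} n (F : nat -> R) : (forall k, 0 < F k) ->
  ln (\prod_(k < n) F k) = \sum_(k < n) ln (F k).
Proof.
move=> F0; elim: n => [|n IH]; first by rewrite !big_ord0 ln1.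
by rewrite !big_ord_recr /= lnM ?IH// posrE ?prodr_gt0.
Qed.

(** * The log-likelihood ratio as a sum of one-step terms *)

Section log_likelihood.
Context {R : realType}.
Variables (Delta : nat -> R) (u v w th lam sg : R).
Hypotheses (hD : forall n, 0 < Delta n <= 1).
Hypotheses (lam0 : 0 < lam) (sg0 : 0 < sg).
(** The drift and the compensator shift the location together, by [u - w], here in units of [sg];
    [B] and [W] are the relative changes of volatility and intensity. *)
Let A : R := (u - w) / sg.
Let B : R := v / sg.
Let W : R := w / lam.
Notation r := (rate_r Delta A B W lam).
Notation q := (rate_q Delta A B W lam).

Lemma log_likelihood_ratioE n (y : nat -> R) : small_step Delta A B W lam n ->
  ln (likelihood (th + u / Num.sqrt (n%:R * Delta n)) (sg + v / Num.sqrt n%:R)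
        (lam + w / Num.sqrt (n%:R * Delta n)) (Delta n) n y
      / likelihood th sg lam (Delta n) n y) =
  \sum_(k < n) ln (step_lr_seq Delta A B W th lam sg n (y k.+1 - y k)).
Proof.
move=> sn; have /andP[D0 _] := hD n; have /and4P[n0 _ _ _] := sn.
have nR : 0 < n%:R :> R by rewrite ltr0n.
have rE : (Num.sqrt n%:R)^-1 = r n by rewrite /rate_r sn.
have qE : (Num.sqrt (n%:R * Delta n))^-1 = q n by rewrite /rate_q sn.
rewrite rE qE.
have e0 := rate_e_gt Delta A B W lam n; have c0 := rate_c_gt Delta A B W lam n.
have sgE : sg + v * r n = sg * (1 + B * r n) by rewrite /B; field; rewrite gt_eqF.
have lamE : lam + w * q n = lam * (1 + W * q n) by rewrite /W; field; rewrite gt_eqF.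
have sg'0 : 0 < sg + v * r n by rewrite sgE mulr_gt0.
have lam'0 : 0 < lam + w * q n by rewrite lamE mulr_gt0.
(* The link between the two rates: over one step, a drift change of order [q n] is a location change
   of order [r n] in units of the step's standard deviation. *)
have qD : q n * Delta n = Num.sqrt (Delta n) * r n.
  rewrite -rE -qE sqrtrM ?ltW// invfM -{2}(sqr_sqrtr (ltW D0)).
  have : Num.sqrt (Delta n) != 0 by rewrite gt_eqF// sqrtr_gt0.
  by move=> sD; rewrite expr2; field; rewrite sD gt_eqF// sqrtr_gt0.
have aE : (th + u * q n - (lam + w * q n)) * Delta n =
    (th - lam) * Delta n + sg * Num.sqrt (Delta n) * (A * r n).
  transitivity ((th - lam) * Delta n + (u - w) * (q n * Delta n)); first by ring.
  by rewrite qD /A; field; rewrite gt_eqF.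
rewrite /likelihood -prodf_div.
rewrite (eq_bigr (fun k : 'I_n => step_lr_seq Delta A B W th lam sg n (y k.+1 - y k))).
  rewrite (@ln_prod _ n (fun k => step_lr_seq Delta A B W th lam sg n (y k.+1 - y k)))// => k.
  by apply: obs_lr_gt0; rewrite ?mulr_gt0// ?sqrtr_gt0.
move=> k _; rewrite !trans_densE// aE lamE sgE /step_lr_seq /step_lr /obs_lr.
by rewrite -[lam * _ * Delta n]mulrAC -[sg * _ * Num.sqrt _]mulrAC.
Qed.

End log_likelihood.

Lemma Gamma_formE {R : realType} (sg lam u v w : R) : 0 < sg -> 0 < lam ->
  let z : 'cV[R]_3 := \col_(i < 3) [:: u; v; w]`_i in
  (z^T *m Gamma sg lam *m z) 0 0 = lan_info ((u - w) / sg) (v / sg) (w / lam) lam.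
Proof.
move=> sg0 lam0 z; rewrite /lan_info.
rewrite mxE !big_ord_recl big_ord0 !mxE !big_ord_recl !big_ord0 !mxE /= /Gamma_entry /=.
by field; rewrite !gt_eqF.
Qed.

(** * Convergence of the log-likelihood ratio *)

Section lan.
Context {R : realType}.
Notation RR := (measurableTypeR R).
Variable Delta : nat -> R.
Hypotheses (hD : forall n, 0 < Delta n <= 1) (hD0 : Delta n @[n --> \oo] --> 0).
Hypothesis hDinf : (n%:R * Delta n) @[n --> \oo] --> +oo.
Variables (th sg lam u v w : R).
Hypotheses (sg0 : 0 < sg) (lam0 : 0 < lam).
Context {d} {T : measurableType d} (P : probability T R).
Variables B N : R -> T -> R.
Hypothesis hBN : BM_indep_Poisson P B N lam.

Let a1 : R := (u - w) / sg.
Let a2 : R := v / sg.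
Let a3 : R := w / lam.
Let I : R := lan_info a1 a2 a3 lam.
Let nu n : probability RR R := ell_law_seq a1 a2 a3 th hD lam0 sg0 n.
Let lr n : R -> R := step_lr_seq Delta a1 a2 a3 th lam sg n.
Let Z n k : T -> R := increment B N ((th - lam) * Delta n) sg (Delta n) k.

Let Dpos n : 0 < Delta n. Proof. by have /andP[] := hD n. Qed.

Let mlr n : measurable_fun setT (lr n : RR -> R).
Proof.
apply: measurable_step_lr; first exact: (pmuln hD lam0).
- exact: (step_sd_gt0 hD sg0).
- exact: rate_c_gt.
- exact: rate_e_gt.
Qed.

Let mlrZ n k : measurable_fun setT (fun om => lr n (Z n k om)).
Proof.
exact: (measurableT_comp (@mlr n) (measurable_increment hBN _ _ (Delta n) k)).
Qed.

Definition log_lr n om := \sum_(k < n) ln (lr n (Z n k om)).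
Let S n om := \sum_(k < n) ell (lr n (Z n k om) - 1).

Lemma measurable_log_lr n : measurable_fun setT (log_lr n : T -> RR).
Proof.
by apply: measurable_sum => k; exact: (measurableT_comp (@measurable_ln R) (@mlrZ n k)).
Qed.

Let mS n : measurable_fun setT (S n : T -> RR).
Proof.
apply: measurable_sum => k; apply: (measurableT_comp (@measurable_ell R)).
exact: measurable_funB.
Qed.

Let bad n k : set T := [set om | (1 / 2 < `|lr n (Z n k om) - 1|)%R].

Let mbadlr n : measurable ([set x | (1 / 2 < `|lr n x - 1|)%R] : set RR).
Proof.
rewrite (_ : [set x | _] = [set: RR] `&` (fun x => `|lr n x - 1|) @^-1` `]1 / 2, +oo[%classic).
  have h : measurable_fun setT (fun x : RR => lr n x - 1 : RR).
    by apply: measurable_funB => //; exact: mlr.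
  by apply: (measurableT_comp (@normr_measurable R setT) h).
by rewrite setTI; apply/seteqP; split => x /=; rewrite in_itv /= andbT.
Qed.

Let Pbad n k : (k < n)%N -> P (bad n k) = step_bad Delta a1 a2 a3 th lam sg n.
Proof. by move=> kn; exact: (increment_law hBN _ _ lam0 (Dpos n) kn (@mbadlr n)). Qed.

Let mbad n k : measurable (bad n k).
Proof.
have h := measurable_increment hBN ((th - lam) * Delta n) sg (Delta n) k.
by have := h measurableT _ (@mbadlr n); rewrite setTI.
Qed.

(** Unless some one-step ratio leaves [[1 / 2, 3 / 2]], clipping changes nothing, and the expected
    number of such steps tends to 0. *)
Lemma cvg_log_lr_clip f (M : R) : bmeas (f : RR -> R) -> (forall x, `|f x| <= M) ->
  \int[P]_om f (log_lr n om) - \int[P]_om f (S n om) @[n --> \oo] --> 0.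
Proof.
move=> bf fM.
have := cvgr0Ml (2 * M) (cvg_step_bad a1 a2 a3 th hD hD0 hDinf lam0 sg0).
apply: cvgr0_le; near=> n.
apply: (Rintegral_off_bad bf fM (@measurable_log_lr n) (@mS n) (@mbad n)) => [om nb|k kn]; last by rewrite Pbad.
apply: eq_bigr => k _; rewrite ell_id; first by rewrite addrC subrK.
by rewrite leNgt; apply/negP/nb.
Unshelve. all: by end_near. Qed.

Let iterS n (f : RR -> R) : bmeas f -> \int[P]_om f (S n om) = iter n (conv (nu n)) f 0.
Proof.
move=> bf; pose g (x : RR) : RR := ell (lr n x - 1).
have mg : measurable_fun setT g.
  apply: (measurableT_comp (@measurable_ell R)).
  by apply: measurable_funB => //; exact: mlr.
have nuE C : measurable C -> nu n C = step_law (lam * Delta n)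
    ((fun z => g (obs ((th - lam) * Delta n) (sg * Num.sqrt (Delta n)) z)) @^-1` C).
  by move=> _; exact: lawE.
exact: (Rintegral_increments hBN lam0 (Dpos n) n mg bf nuE).
Qed.

(** The limit is expressed through [B I] on the original space; only its law matters, and it is
    matched with that of [G] later. *)
Lemma cvg_log_lr_taylor3 f : 0 < I -> taylor3 f ->
  \int[P]_om f (log_lr n om) @[n --> \oo] --> \int[P]_om f (B I om - I / 2).
Proof.
move=> I0 tf; have bf : bmeas f := tf.1; have [_ [M fM]] := bf.
have mean := cvg_ell_law_mean a1 a2 a3 th hD hD0 hDinf lam0 sg0.
have sqr := cvg_ell_law_sqr a1 a2 a3 th hD hD0 hDinf lam0 sg0.
have cube := cvg_ell_law_cube a1 a2 a3 th hD hD0 hDinf lam0 sg0.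
have sub0 (x y : nat -> R) c : n%:R * x n + c @[n --> \oo] --> 0 ->
    n%:R * y n + c @[n --> \oo] --> 0 -> n%:R * (x n - y n) @[n --> \oo] --> 0.
  move=> x0 y0; have E n : n%:R * x n + c + -1 * (n%:R * y n + c) = n%:R * (x n - y n) by ring.
  by have := cvgr0D x0 (cvgr0Ml (-1) y0); under eq_fun do rewrite E.
have c2 : iter n (conv (nu n)) f 0 - iter n (conv (gauss_seq I n)) f 0 @[n --> \oo] --> 0.
  apply: clt_taylor3 => //.
  - by move=> n; exact: third_moment_ell_law_seq.
  - by move=> n; apply: third_moment_gauss_seq; exact: ltW.
  - exact: (sub0 (fun n => \int[nu n]_y y) (fun n => \int[gauss_seq I n]_y y) _
      mean (cvg_gauss_seq_mean I)).
  - exact: (sub0 (fun n => \int[nu n]_y (y ^+ 2)) (fun n => \int[gauss_seq I n]_y (y ^+ 2)) _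
      sqr (cvg_gauss_seq_sqr (ltW I0))).
  - exact: cvg_gauss_seq_cube (ltW I0).
apply/subr_cvg0; apply: cvgr0_le (cvgr0_norm (cvgr0D (cvg_log_lr_clip bf fM) c2)).
exists 1%N => // n /= n0.
by rewrite iterS// (iter_conv_gauss_seq hBN I0 n0 bf) addrA subrK.
Qed.

End lan.

Theorem theorem1 (R : realType) (Delta : nat -> R)
  (hD : forall n, 0 < Delta n <= 1)
  (hD0 : Delta n @[n --> \oo] --> 0)
  (hDinf : (n%:R * Delta n) @[n --> \oo] --> +oo)
  (x th sg lam : R) (hsg : 0 < sg) (hlam : 0 < lam) (u v w : R)
  (d : measure_display) (Omega : measurableType d) (P : probability Omega R)
  (B N : R -> Omega -> R) (hBN : BM_indep_Poisson P B N lam)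
  (d' : measure_display) (Omega' : measurableType d') (Q : probability Omega' R)
  (G : Omega' -> 'cV[R]_3) (hG : centered_gaussian_vector Q G (Gamma sg lam)) :
  let X := fun (t : R) (om : Omega) => x + th * t + sg * B t om + N t om - lam * t in
  let th_n := fun n : nat => th + u / Num.sqrt (n%:R * Delta n) in
  let sg_n := fun n : nat => sg + v / Num.sqrt n%:R in
  let lam_n := fun n : nat => lam + w / Num.sqrt (n%:R * Delta n) in
  let obs := fun (n : nat) (om : Omega) (k : nat) => X (k%:R * Delta n) om in
  let z : 'cV[R]_3 := \col_(i < 3) [:: u; v; w]`_i in
  cvg_in_law P
    (fun (n : nat) (om : Omega) =>
       ln (likelihood (th_n n) (sg_n n) (lam_n n) (Delta n) n (obs n om)
           / likelihood th sg lam (Delta n) n (obs n om)))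
    Q
    (fun om' => (z^T *m G om') 0 0 - 2^-1 * (z^T *m Gamma sg lam *m z) 0 0).
Proof.
move=> X th_n sg_n lam_n obs z.
pose I := lan_info ((u - w) / sg) (v / sg) (w / lam) lam.
rewrite (Gamma_formE u v w hsg hlam) -/I.
have [mG lawG] := hG.
have mZ : measurable_fun setT (fun om' => (z^T *m G om') 0 0 : measurableTypeR R).
  rewrite (_ : (fun _ => _) = fun om' => \sum_(i < 3) z^T 0 i * G om' i 0).
    by apply: measurable_sum => i; apply: measurable_funM => //; exact: mG.
  by apply/funext => om'; rewrite mxE.
have I0 : 0 <= I by exact: lan_info_ge0.
have mZI : measurable_fun setT
    (fun om' => (z^T *m G om') 0 0 - 2^-1 * I : measurableTypeR R).
  exact: measurable_funB.
(* The Brownian comparison requires a time [I > 0]. If [I = 0], positive definiteness forces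
   [u = v = w = 0], and both sides are constantly 0. *)
have [I_eq0|I_gt0] : I = 0 \/ 0 < I by case: (ltgtP 0 I) I0 => // ? _; [right|left].
  have [a0 b0 c0] := lan_info_eq0 hlam I_eq0.
  have div0 (p q : R) : 0 < q -> p / q = 0 -> p = 0.
    by move=> q0 /(congr1 (fun y => y * q)); rewrite mul0r divfK// gt_eqF.
  have v0 := div0 _ _ hsg b0; have w0 := div0 _ _ hlam c0.
  have u0 : u = 0 by have := div0 _ _ hsg a0; rewrite w0 subr0.
  (* With the conventions [0 / 0 = 0] and [ln 0 = 0] this holds for every [x0], so positivity of the
     likelihood need not be discussed. *)
  have lnxx (x0 : R) : ln (x0 / x0) = 0.
    have [->|x00] := eqVneq x0 0; first by rewrite mul0r ln0.
    by rewrite divff// ln1.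
  have E (n : nat) om : ln (likelihood (th_n n) (sg_n n) (lam_n n) (Delta n) n (obs n om)
      / likelihood th sg lam (Delta n) n (obs n om)) = 0.
    by rewrite /th_n /sg_n /lam_n u0 v0 w0 !mul0r !addr0.
  have EZ om' : (z^T *m G om') 0 0 - 2^-1 * I = 0.
    have -> : z = 0 by apply/colP => -[[|[|[|i]]] hi]; rewrite !mxE ?u0 ?v0 ?w0 //=.
    by rewrite I_eq0 mulr0 subr0 trmx0 mul0mx mxE.
  apply: cvg_in_law_taylor3 => //.
    by near=> n; under eq_fun do rewrite E; exact: measurable_cst.
  move=> f _.
  under [X in _ --> X]eq_Rintegral do rewrite EZ.
  rewrite Rintegral_prob_cst; apply: cvg_near_cst; near=> n.
  by under eq_Rintegral do rewrite E; rewrite Rintegral_prob_cst.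
have LE n om : small_step Delta ((u - w) / sg) (v / sg) (w / lam) lam n ->
    ln (likelihood (th_n n) (sg_n n) (lam_n n) (Delta n) n (obs n om)
      / likelihood th sg lam (Delta n) n (obs n om)) =
    log_lr Delta th sg lam u v w B N n om.
  move=> sn; have := log_likelihood_ratioE th hD hlam hsg (obs n om) sn.
  rewrite -/(th_n n) -/(sg_n n) -/(lam_n n) => ->.
  have incE k : obs n om k.+1 - obs n om k =
      increment B N ((th - lam) * Delta n) sg (Delta n) k om.
    by rewrite /obs /X /increment -natr1; ring.
  by under eq_bigr do rewrite incE.
have near_small := near_small_step ((u - w) / sg) (v / sg) (w / lam) lam hD hDinf.
apply: cvg_in_law_taylor3 => //.
  apply: filterS near_small => n sn; under eq_fun do rewrite LE//.
  exact: (measurable_log_lr hD th u v w hsg hlam hBN n).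
move=> f tf; have bf : bmeas f := tf.1.
(* The scalar [z^T G] is normal with variance [z^T Gamma z = I], which is also the law of [B I]. *)
have -> : \int[Q]_w0 f ((z^T *m G w0) 0 0 - 2^-1 * I) = \int[P]_om f (B I om - I / 2).
  have bg := bmeas_addl (- (2^-1 * I)) bf.
  under [RHS]eq_Rintegral do rewrite [I / 2]mulrC.
  apply: (eq_law_Rintegral mZ (measurable_BM hBN I) bg) => A mA.
  rewrite (BM_normal_law hBN I_gt0 mA) (lawG z A mA).
  by rewrite (Gamma_formE u v w hsg hlam).
apply: cvg_trans (cvg_log_lr_taylor3 hD hD0 hDinf th hsg hlam hBN I_gt0 tf).
apply: near_eq_cvg; apply: filterS near_small => n sn.
by apply: eq_Rintegral => om _; rewrite LE.
Unshelve. all: by end_near. Qed.
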